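(* Let $m:S\to T$ be an LF theory morphism and $r$ a term-total partial logical relation on $m$. Let $\mathrm{LR}_{m,r}$ be the operator on theories $E$ including $S$ defined as follows: (1) compute $E^m:=\mathrm{PO}'_m(E)$; (2) let $m_E:E\to E^m$ be the induced morphism and start with the empty logical relation $r_E$ on $m_E$; (3) for each declaration $c:A$ (resp. $c:A=t$) of $E$ for which $\bar r_E(A)$ is defined, add the constant declaration $c^*:\bar r_E(A)\,c$ (resp. $c^*:\bar r_E(A)\,c=\bar r_E(t)$) to $E^m$ and the case $r_E(c)=c^*$ to $r_E$. Then $\mathrm{LR}_{m,r}$ is a natural functor, and every $r_E$ is a term-total logical relation on $m_E$.
   Context: LF theories are lists of constant declarations $c:A$ or $c:A=t$ and includes of previous theories. A morphism $m:S\to T$ maps $S$-constants to $T$-expressions with $\vdash_T m(c):\bar m(A)$ for $c:A$, where $\bar m$ is the homomorphic extension to all expressions and contexts (identity on variables and $\mathrm{type}$, commuting with $\Pi$, $\lambda$, application). The pushout $\mathrm{PO}_m(E)$ of a theory $E$ including $S$ is the theory $E^m$ obtained by replacing the include of $S$ by an include of $T$, each include of a theory $E'$ by an include of $E'^m$, and each declaration $c:A[=t]$ by $c:\bar m(A)[=\bar m(t)]$; it comes with a morphism $E\to E^m$ mapping $S$-constants via $m$ and other constants to themselves; this extends to diagrams, giving a natural functor (a functor together with morphisms $E\to\mathrm{PO}_m(E)$ forming a natural transformation). Argument positions: for a constant with normalized type $\Pi x_1:A_1\ldots\Pi x_n:A_n.B$, positions $c^1,\dots,c^n$; a set $P$ of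 positions is unused if each bound variable at a position in $P$ occurs only inside arguments at positions in $P$; $D\setminus P$ removes those bindings and arguments. $\mathrm{PO}'_m(D):=\mathrm{PO}_m(D)\setminus P_D$, where $P_D$ is a fixed heuristic choice of a set of unused argument positions of $\mathrm{PO}_m(D)$; the resulting theory has the same shape as $E$ and there is an induced morphism $m_E:E\to E^m$. A partial logical relation $r$ on $m:S\to T$ is a partial map from $S$-constants to $T$-expressions such that for every $S$-constant $c:A$, if $r(c)$ is defined then $\bar r(A)$ is defined and $\vdash_T r(c):\bar r(A)\,m(c)$, where $\bar r$ is the partial map: $\bar r(c)=r(c)$; $\bar r(x)=x^*$ if $x^*$ was declared when traversing the binder of $x$, else undefined; $\bar r(\mathrm{type})=\lambda a:\mathrm{type}.\,a\to\mathrm{type}$; $\bar r(\Pi x:A.B)=\lambda f:\bar m(\Pi x:A.B).\,\Pi\,\bar r(x:A).\,\bar r(B)(f\,x)$; $\bar r(\lambda x:A.t)=\lambda\,\bar r(x:A).\,\bar r(t)$; $\bar r(f\,t)=\bar r(f)\,\bar m(t)\,\bar r(t)$ if $\bar r(t)$ is defined, else $\bar r(f)\,\bar m(t)$; $\bar r(\cdot)=\cdot$, $\bar r(\Gamma,x:A)=\bar r(\Gamma),x:\bar m(A),x^*:\bar r(A)\,x$ if $\bar r(A)$ is defined, else $\bar r(\Gamma),x:\bar m(A)$; $\bar r(-)$ is undefined whenever a right-hand side component is. $r$ is term-total if for every constant $c:A$, $r(c)$ is defined whenever $\bar r(A)$ is.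
   Formalization: Morphisms and r must also respect definitions c=t (else LR(E) can be ill-typed). If term-totality is read only for constants whose A is a type, morphisms must also respect definedness of the relations on type families, and c* is omitted when the relation of t is undefined. *)

(* Defs.v *)
From Stdlib Require Import List PeanoNat Bool.
Import ListNotations.

(** * LF expressions *)

Definition name := nat.

(** De Bruijn indices. *)
Inductive expr : Type :=
| Typ : expr
| Con : name -> expr
| Var : nat -> expr
| Pi  : expr -> expr -> expr
| Lam : expr -> expr -> expr
| App : expr -> expr -> expr.

Definition up_ren (rho : nat -> nat) (i : nat) : nat :=
  match i with 0 => 0 | S j => S (rho j) end.

Fixpoint ren (rho : nat -> nat) (t : expr) : expr :=
  match t with
  | Typ => Typ
  | Con c => Con c
  | Var i => Var (rho i)
  | Pi A B => Pi (ren rho A) (ren (up_ren rho) B)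
  | Lam A b => Lam (ren rho A) (ren (up_ren rho) b)
  | App f s => App (ren rho f) (ren rho s)
  end.

Definition shift (k : nat) : expr -> expr := ren (fun i => k + i).

Definition up (sigma : nat -> expr) (i : nat) : expr :=
  match i with 0 => Var 0 | S j => shift 1 (sigma j) end.

Fixpoint subst (sigma : nat -> expr) (t : expr) : expr :=
  match t with
  | Typ => Typ
  | Con c => Con c
  | Var i => sigma i
  | Pi A B => Pi (subst sigma A) (subst (up sigma) B)
  | Lam A b => Lam (subst sigma A) (subst (up sigma) b)
  | App f s => App (subst sigma f) (subst sigma s)
  end.

Definition inst (s : expr) (t : expr) : expr :=
  subst (fun i => match i with 0 => s | S j => Var j end) t.

(** * The LF type system *)

(** [(c, A, None)] is [c : A]; [(c, A, Some t)] is [c : A = t]. *)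
Definition decl : Type := (name * expr * option expr)%type.
Definition dname (d : decl) : name := fst (fst d).

Definition sign := list decl.
Definition ctx := list expr.

(** Definitional equality is beta-eta-delta conversion.  As usual for LF with
    eta, it disregards the domain labels of abstractions: on well-typed
    expressions those are determined up to conversion, and keeping them would
    make raw beta-eta reduction non-confluent. *)
Inductive conv (Sg : sign) : expr -> expr -> Prop :=
| conv_refl t : conv Sg t t
| conv_sym t u : conv Sg t u -> conv Sg u t
| conv_trans t u v : conv Sg t u -> conv Sg u v -> conv Sg t v
| conv_beta A b s : conv Sg (App (Lam A b) s) (inst s b)
| conv_eta A f : conv Sg (Lam A (App (shift 1 f) (Var 0))) f
| conv_delta c A t : In (c, A, Some t) Sg -> conv Sg (Con c) t
| conv_Pi A A' B B' :
    conv Sg A A' -> conv Sg B B' -> conv Sg (Pi A B) (Pi A' B')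
| conv_Lam A A' b b' : conv Sg b b' -> conv Sg (Lam A b) (Lam A' b')
| conv_App f f' s s' :
    conv Sg f f' -> conv Sg s s' -> conv Sg (App f s) (App f' s').

Inductive wf_ctx (Sg : sign) : ctx -> Prop :=
| wf_ctx_nil : wf_ctx Sg []
| wf_ctx_cons G A :
    wf_ctx Sg G -> has_type Sg G A Typ -> wf_ctx Sg (A :: G)
with is_kind (Sg : sign) : ctx -> expr -> Prop :=
| kind_Typ G : wf_ctx Sg G -> is_kind Sg G Typ
| kind_Pi G A K :
    has_type Sg G A Typ -> is_kind Sg (A :: G) K -> is_kind Sg G (Pi A K)
(** [has_type Sg G t A]: [t] is a term and [A] its type, or [t] is a type
    family and [A] its kind. *)
with has_type (Sg : sign) : ctx -> expr -> expr -> Prop :=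
| ty_Con G c A o :
    wf_ctx Sg G -> In (c, A, o) Sg -> has_type Sg G (Con c) A
| ty_Var G i A :
    wf_ctx Sg G -> nth_error G i = Some A ->
    has_type Sg G (Var i) (shift (S i) A)
| ty_Pi G A B :
    has_type Sg G A Typ -> has_type Sg (A :: G) B Typ ->
    has_type Sg G (Pi A B) Typ
| ty_Lam G A b B :
    has_type Sg G A Typ -> has_type Sg (A :: G) b B ->
    has_type Sg G (Lam A b) (Pi A B)
| ty_App G f s A B :
    has_type Sg G f (Pi A B) -> has_type Sg G s A ->
    has_type Sg G (App f s) (inst s B)
| ty_conv_type G t A B :
    has_type Sg G t A -> conv Sg A B -> has_type Sg G B Typ ->
    has_type Sg G t B
| ty_conv_kind G t A B :
    has_type Sg G t A -> conv Sg A B -> is_kind Sg G B ->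
    has_type Sg G t B.

Definition classifier (Sg : sign) (A : expr) : Prop :=
  has_type Sg [] A Typ \/ is_kind Sg [] A.

(** * Theories *)

(** Lists (growing to the right) of constant declarations and of includes; an
    included theory is embedded as a whole, so "previously declared" is
    automatic. *)
Inductive theory : Type :=
| tnil : theory
| tconst : theory -> name -> expr -> option expr -> theory
| tincl : theory -> theory -> theory.

Definition expr_eq_dec (t u : expr) : {t = u} + {t <> u}.
Proof. decide equality; apply Nat.eq_dec. Defined.

Definition theory_eq_dec (E F : theory) : {E = F} + {E <> F}.
Proof.
  decide equality; try apply expr_eq_dec; try apply Nat.eq_dec.
  decide equality; apply expr_eq_dec.
Defined.

(** All declarations of a theory, included ones too, latest first. *)
Fixpoint flat (E : theory) : sign :=
  match E with
  | tnil => []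
  | tconst E0 c A o => (c, A, o) :: flat E0
  | tincl E0 E1 => flat E1 ++ flat E0
  end.

Definition names (E : theory) : list name := map dname (flat E).

Definition memb (c : nat) (l : list nat) : bool := existsb (Nat.eqb c) l.

Fixpoint lookup (c : name) (Sg : sign) : option expr :=
  match Sg with
  | [] => None
  | (d, A, _) :: Sg' => if Nat.eqb c d then Some A else lookup c Sg'
  end.

(** Names stand for qualified identifiers: a name reaching a theory along
    several includes must refer to one and the same declaration. *)
Inductive wf_theory : theory -> Prop :=
| wf_tnil : wf_theory tnil
| wf_tconst E c A o :
    wf_theory E -> ~ In c (names E) -> classifier (flat E) A ->
    (forall t, o = Some t -> has_type (flat E) [] t A) ->
    wf_theory (tconst E c A o)
| wf_tincl E E1 :
    wf_theory E -> wf_theory E1 ->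
    (forall d d', In d (flat E) -> In d' (flat E1) ->
       dname d = dname d' -> d = d') ->
    wf_theory (tincl E E1).

(** [includes X E]: [E] includes [X], directly or not. *)
Fixpoint includes (X E : theory) : Prop :=
  match E with
  | tnil => False
  | tconst E0 _ _ _ => includes X E0
  | tincl E0 E1 => E1 = X \/ includes X E1 \/ includes X E0
  end.

Fixpoint includes_over (X E : theory) : Prop :=
  match E with
  | tnil => True
  | tconst E0 _ _ _ => includes_over X E0
  | tincl E0 E1 =>
      includes_over X E0 /\ (E1 = X \/ (includes X E1 /\ includes_over X E1))
  end.

(** [E] includes [X], and every other theory it includes does so as well. *)
Definition extends (X E : theory) : Prop := includes X E /\ includes_over X E.

(** The declarations that [E] has beyond those of an included [X]. *)
Fixpoint own (X E : theory) : sign :=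
  match E with
  | tnil => []
  | tconst E0 c A o => (c, A, o) :: own X E0
  | tincl E0 E1 =>
      if theory_eq_dec E1 X then own X E0 else own X E1 ++ own X E0
  end.

(** * Morphisms *)

(** Morphisms are total functions on names of which only the values at
    constants of the domain matter. *)
Definition assignment := name -> expr.

(** The homomorphic extension.  The assigned expressions are closed. *)
Fixpoint hom (m : assignment) (t : expr) : expr :=
  match t with
  | Typ => Typ
  | Con c => m c
  | Var i => Var i
  | Pi A B => Pi (hom m A) (hom m B)
  | Lam A b => Lam (hom m A) (hom m b)
  | App f s => App (hom m f) (hom m s)
  end.

(** The equation [c = t] of a defined constant has to be preserved as well. *)
Definition morphism (Sg Sg' : sign) (m : assignment) : Prop :=
  forall c A o, In (c, A, o) Sg ->
    has_type Sg' [] (m c) (hom m A) /\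
    (forall t, o = Some t -> conv Sg' (m c) (hom m t)).

(** Morphisms are identified if they agree up to definitional equality. *)
Definition mor_eq (Sg Sg' : sign) (f g : assignment) : Prop :=
  forall d, In d Sg -> conv Sg' (f (dname d)) (g (dname d)).

(** Morphisms in the category of extensions of [X]. *)
Definition ext_morphism (X E F : theory) (f : assignment) : Prop :=
  morphism (flat E) (flat F) f /\ forall c, In c (names X) -> f c = Con c.

(** A diagram of extensions of a fixed theory. *)
Record diagram : Type := Diagram {
  thys : theory -> Prop;
  mors : theory -> theory -> assignment -> Prop
}.

Definition wf_diagram (X : theory) (D : diagram) : Prop :=
  (forall E, thys D E -> wf_theory E /\ extends X E) /\
  (forall E F f, mors D E F f ->
     thys D E /\ thys D F /\ ext_morphism X E F f).

(** [O], [Om] map the theories and morphisms of the diagram [D] of extensions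
    of [X] to extensions of [Y], functorially and preserving includes; the
    [eta E : E -> O E] extend [m : X -> Y] and form a natural transformation.
    If [D] is closed under identities and composition, it is a category and
    [O], [Om] a functor on it. *)
Record natural_functor (X Y : theory) (m : assignment) (D : diagram)
    (O : theory -> theory)
    (Om : theory -> theory -> assignment -> assignment)
    (eta : theory -> assignment) : Prop := {
  nat_obj : forall E, thys D E -> wf_theory (O E) /\ extends Y (O E);
  nat_mor : forall E F f, mors D E F f ->
    ext_morphism Y (O E) (O F) (Om E F f);
  nat_id : forall E f, mors D E E f ->
    mor_eq (flat E) (flat E) f Con ->
    mor_eq (flat (O E)) (flat (O E)) (Om E E f) Con;
  nat_comp : forall E F G f g h,
    mors D E F f -> mors D F G g -> mors D E G h ->
    mor_eq (flat E) (flat G) h (fun c => hom g (f c)) ->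
    mor_eq (flat (O E)) (flat (O G))
      (Om E G h) (fun c => hom (Om F G g) (Om E F f c));
  nat_eta : forall E, thys D E ->
    morphism (flat E) (flat (O E)) (eta E) /\
    (forall c, In c (names X) -> eta E c = m c);
  nat_square : forall E F f, mors D E F f ->
    mor_eq (flat E) (flat (O F))
      (fun c => hom (Om E F f) (eta E c)) (fun c => hom (eta F) (f c));
  nat_incl : forall E E', thys D E -> thys D E' -> includes E' E ->
    includes (O E') (O E) /\ (forall c, In c (names E') -> eta E c = eta E' c)
}.

(** * Partial logical relations *)

Definition relation := name -> option expr.

(** An environment records, for each variable [x] of a context [G], whether
    the translation of [G] also declares [x*] (right after [x]).  [emb] and
    [star_var] give the indices of [x] and [x*] in the translated context. *)
Definition env := list bool.

Definition width (b : bool) : nat := if b then 2 else 1.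

Fixpoint emb (e : env) (i : nat) : nat :=
  match e, i with
  | [], _ => i
  | b :: _, 0 => if b then 1 else 0
  | b :: e', S j => width b + emb e' j
  end.

Fixpoint star_var (e : env) (i : nat) : option nat :=
  match e, i with
  | [], _ => None
  | b :: _, 0 => if b then Some 0 else None
  | b :: e', S j => option_map (Nat.add (width b)) (star_var e' j)
  end.

(** Application of the translation of a classifier to a subject, contracted if
    it is a redex.  For kinds this is essential: the translation of a kind
    abstracts over type families and only becomes an LF kind once
    instantiated. *)
Definition at_ (R s : expr) : expr :=
  match R with
  | Lam _ b => inst s b
  | _ => App R s
  end.

Fixpoint rel (m : assignment) (r : relation) (e : env) (t : expr)
    : option expr :=
  match t with
  | Typ => Some (Lam Typ (Pi (Var 0) Typ))
  | Con c => r c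
  | Var i => option_map Var (star_var e i)
  | Pi A B =>
      let mA := ren (emb e) (hom m A) in
      let mP := ren (emb e) (hom m (Pi A B)) in
      match rel m r e A with
      | Some rA =>
          match rel m r (true :: e) B with
          | Some rB =>
              (* below the binders f, x, x* *)
              Some (Lam mP (Pi (shift 1 mA) (Pi (at_ (shift 2 rA) (Var 0))
                (at_ (ren (up_ren (up_ren S)) rB) (App (Var 2) (Var 1))))))
          | None => None
          end
      | None =>
          match rel m r (false :: e) B with
          | Some rB =>
              Some (Lam mP (Pi (shift 1 mA)
                (at_ (ren (up_ren S) rB) (App (Var 1) (Var 0)))))
          | None => None
          end
      end
  | Lam A b =>
      let mA := ren (emb e) (hom m A) in
      match rel m r e A with
      | Some rA =>
          match rel m r (true :: e) b with
          | Some rb => Some (Lam mA (Lam (at_ (shift 1 rA) (Var 0)) rb))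
          | None => None
          end
      | None =>
          match rel m r (false :: e) b with
          | Some rb => Some (Lam mA rb)
          | None => None
          end
      end
  | App f s =>
      match rel m r e f with
      | Some rf =>
          let ms := ren (emb e) (hom m s) in
          match rel m r e s with
          | Some rs => Some (App (App rf ms) rs)
          | None => Some (App rf ms)
          end
      | None => None
      end
  end.

(** As for morphisms, the equation of a defined constant is to be preserved:
    the constant and its definiens are related alike. *)
Definition log_rel (Sg Sg' : sign) (m : assignment) (r : relation) : Prop :=
  forall c A o, In (c, A, o) Sg ->
    (forall p, r c = Some p ->
       exists rA, rel m r [] A = Some rA /\
         has_type Sg' [] p (at_ rA (m c))) /\
    (forall t, o = Some t ->
       match r c, rel m r [] t with
       | Some p, Some q => conv Sg' p q
       | None, None => True
       | _, _ => False
       end).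

(** Term-totality concerns the constants [c : A] where [A] is a type.
    [total] demands the same of all constants; since the translation of a
    kind is always defined, it forces [r] to be defined on every constant. *)
Definition term_total (Sg : sign) (m : assignment) (r : relation) : Prop :=
  forall c A o, In (c, A, o) Sg -> has_type Sg [] A Typ ->
    rel m r [] A <> None -> r c <> None.

Definition total (Sg : sign) (m : assignment) (r : relation) : Prop :=
  forall c A o, In (c, A, o) Sg -> rel m r [] A <> None -> r c <> None.

(** * Argument positions *)

(** [In j (P c)]: the argument position of [c] with number [j] (from 0) is
    in the set [P]. *)
Definition positions := name -> list nat.

(** [spine t = Some (c, k)] iff [t] is [c] applied to [k] arguments. *)
Fixpoint spine (t : expr) : option (name * nat) :=
  match t with
  | Con c => Some (c, 0)
  | App f _ =>
      match spine f with Some (c, k) => Some (c, S k) | None => None end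
  | _ => None
  end.

(** Is the argument of [App f _] at a position in [P]? *)
Definition arg_removed (P : positions) (f : expr) : bool :=
  match spine f with Some (c, k) => memb k (P c) | None => false end.

(** Does [Var i] occur outside of the arguments at positions in [P]? *)
Fixpoint occurs (P : positions) (i : nat) (t : expr) : bool :=
  match t with
  | Typ | Con _ => false
  | Var k => Nat.eqb k i
  | Pi A B => occurs P i A || occurs P (S i) B
  | Lam A b => occurs P i A || occurs P (S i) b
  | App f s => occurs P i f || (negb (arg_removed P f) && occurs P i s)
  end.

(** The leading binders of the type of [c] (from number [j] on), and of an
    expression defining or assigned to [c], are unused if at positions in
    [P]. *)
Fixpoint pis_unused (P : positions) (c : name) (j : nat) (A : expr) : Prop :=
  match A with
  | Pi _ B => (In j (P c) -> occurs P 0 B = false) /\ pis_unused P c (S j) B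
  | _ => True
  end.

Fixpoint lams_unused (P : positions) (c : name) (j : nat) (t : expr) : Prop :=
  match t with
  | Lam _ b => (In j (P c) -> occurs P 0 b = false) /\ lams_unused P c (S j) b
  | _ => True
  end.

Fixpoint pis (A : expr) : nat := match A with Pi _ B => S (pis B) | _ => 0 end.
Fixpoint lams (t : expr) : nat :=
  match t with Lam _ b => S (lams b) | _ => 0 end.

Fixpoint beta_normal (t : expr) : Prop :=
  match t with
  | Typ | Con _ | Var _ => True
  | Pi A B => beta_normal A /\ beta_normal B
  | Lam A b => beta_normal A /\ beta_normal b
  | App f s =>
      match f with Lam _ _ => False | _ => True end /\
      beta_normal f /\ beta_normal s
  end.

(** Every constant has enough arguments for the positions in [P] to be present
    ([k] arguments are given from outside).  This and the bounds on [lams]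
    below hold for eta-long forms. *)
Fixpoint saturated (P : positions) (k : nat) (t : expr) : Prop :=
  match t with
  | Typ | Var _ => True
  | Con c => forall j, In j (P c) -> j < k
  | Pi A B => saturated P 0 A /\ saturated P 0 B
  | Lam A b => saturated P 0 A /\ saturated P 0 b
  | App f s => saturated P (S k) f /\ saturated P 0 s
  end.

Definition unused_in_type (P : positions) (c : name) (A : expr) : Prop :=
  beta_normal A /\ saturated P 0 A /\
  (forall j, In j (P c) -> j < pis A) /\ pis_unused P c 0 A.

Definition unused_in_value (P : positions) (c : name) (t : expr) : Prop :=
  beta_normal t /\ saturated P 0 t /\
  (forall j, In j (P c) -> j < lams t) /\ lams_unused P c 0 t.

(** Removal of the arguments at positions in [P] ... *)
Fixpoint rm (P : positions) (t : expr) : expr :=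
  match t with
  | Typ => Typ
  | Con c => Con c
  | Var i => Var i
  | Pi A B => Pi (rm P A) (rm P B)
  | Lam A b => Lam (rm P A) (rm P b)
  | App f s => if arg_removed P f then rm P f else App (rm P f) (rm P s)
  end.

(** ... and also of the bindings of [c] at such positions.  The removed
    variable does not occur any more, so that what is substituted for it is
    immaterial. *)
Fixpoint rm_pis (P : positions) (c : name) (j : nat) (A : expr) : expr :=
  match A with
  | Pi A0 B =>
      if memb j (P c) then inst Typ (rm_pis P c (S j) B)
      else Pi (rm P A0) (rm_pis P c (S j) B)
  | _ => rm P A
  end.

Fixpoint rm_lams (P : positions) (c : name) (j : nat) (t : expr) : expr :=
  match t with
  | Lam A b =>
      if memb j (P c) then inst Typ (rm_lams P c (S j) b)
      else Lam (rm P A) (rm_lams P c (S j) b)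
  | _ => rm P t
  end.

(** With [c : Pi x0:A0. ... B] before the removal and [h] being [Con c], this
    is [fun x0 ... => c xs] where [xs] are the variables not at positions in
    [P]. *)
Fixpoint expand (P : positions) (c : name) (j : nat) (A : expr) (h : expr)
    : expr :=
  match A with
  | Pi A0 B =>
      Lam (rm P A0) (expand P c (S j) B
        (if memb j (P c) then shift 1 h else App (shift 1 h) (Var 0)))
  | _ => h
  end.

(** * Pushout along [m : Sc -> Tg] *)

(** Replaces the include of [Sc] by one of [Tg], and each [c : A = t] by
    [c : ft c A = fv c t]. *)
Fixpoint translate (Sc Tg : theory) (ft fv : name -> expr -> expr)
    (E : theory) : theory :=
  match E with
  | tnil => tnil
  | tconst E0 c A o =>
      tconst (translate Sc Tg ft fv E0) c (ft c A) (option_map (fv c) o)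
  | tincl E0 E1 =>
      tincl (translate Sc Tg ft fv E0)
        (if theory_eq_dec E1 Sc then Tg else translate Sc Tg ft fv E1)
  end.

(** The morphism [E -> PO E]. *)
Definition po_mor (Sc : theory) (m : assignment) : assignment :=
  fun c => if memb c (names Sc) then m c else Con c.

Definition po_thy (Sc Tg : theory) (m : assignment) : theory -> theory :=
  translate Sc Tg (fun _ => hom (po_mor Sc m)) (fun _ => hom (po_mor Sc m)).

(** The choice made for a diagram [D]: a set [removed] of argument positions,
    and a normal form [norm t] of each expression [t] in [PO D]. *)
Record choice : Type := Choice {
  removed : positions;
  norm : expr -> expr
}.

(** Type and definiens of [c] in [E^m = PO'_m E], where [c : A = t] in [E], and
    (by [po_value] too) the value at [c] of the image of a morphism: the normal
    form of the image under pushout, minus the bindings and arguments to be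
    removed. *)
Definition po_type (Sc : theory) (m : assignment) (ch : choice)
    (c : name) (A : expr) : expr :=
  rm_pis (removed ch) c 0 (norm ch (hom (po_mor Sc m) A)).

Definition po_value (Sc : theory) (m : assignment) (ch : choice)
    (c : name) (t : expr) : expr :=
  rm_lams (removed ch) c 0 (norm ch (hom (po_mor Sc m) t)).

(** The induced morphism [m_E : E -> E^m]. *)
Definition ind_mor (Sc : theory) (m : assignment) (ch : choice) (E : theory)
    : assignment :=
  fun c =>
    if memb c (names Sc) then m c
    else match removed ch c, lookup c (flat E) with
         | _ :: _, Some A =>
             expand (removed ch) c 0 (norm ch (hom (po_mor Sc m) A)) (Con c)
         | _, _ => Con c
         end.

(** The choice is sound for the declarations of [E]: normal forms are equal to
    the original expressions, and the removed positions are unused. *)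
Fixpoint good_for_theory (Sc Tg : theory) (m : assignment) (ch : choice)
    (E : theory) : Prop :=
  match E with
  | tnil => True
  | tconst E0 c A o =>
      good_for_theory Sc Tg m ch E0 /\
      let Sg := flat (po_thy Sc Tg m E0) in
      let A1 := hom (po_mor Sc m) A in
      conv Sg A1 (norm ch A1) /\ classifier Sg (norm ch A1) /\
      unused_in_type (removed ch) c (norm ch A1) /\
      (forall t, o = Some t ->
         let t1 := hom (po_mor Sc m) t in
         conv Sg t1 (norm ch t1) /\ has_type Sg [] (norm ch t1) A1 /\
         unused_in_value (removed ch) c (norm ch t1))
  | tincl E0 E1 =>
      good_for_theory Sc Tg m ch E0 /\
      (E1 = Sc \/ good_for_theory Sc Tg m ch E1)
  end.

Definition good_for_morphism (Sc Tg : theory) (m : assignment) (ch : choice)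
    (E F : theory) (f : assignment) : Prop :=
  forall c A o, In (c, A, o) (own Sc E) ->
    let Sg := flat (po_thy Sc Tg m F) in
    let t1 := hom (po_mor Sc m) (f c) in
    conv Sg t1 (norm ch t1) /\
    has_type Sg [] (norm ch t1) (hom (po_mor Sc m) (hom f A)) /\
    unused_in_value (removed ch) c (norm ch t1).

(** No argument positions of [Tg] are removed, since [E^m] includes [Tg]. *)
Definition good_choice (Sc Tg : theory) (m : assignment) (D : diagram)
    (ch : choice) : Prop :=
  (forall c, In c (names Tg) -> removed ch c = []) /\
  (forall E, thys D E -> good_for_theory Sc Tg m ch E) /\
  (forall E F f, mors D E F f -> good_for_morphism Sc Tg m ch E F f).

(** * The operator LR *)

(** The name of [c*] is [star c].  Names are qualified identifiers, so those
    of different theories are distinct and those of starred constants fresh. *)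
Definition fresh_names (Sc Tg : theory) (star : name -> name) (D : diagram)
    : Prop :=
  (forall c d, star c = star d -> c = d) /\
  (forall E, thys D E -> forall d, In d (own Sc E) ->
     ~ In (dname d) (names Sc) /\ ~ In (dname d) (names Tg) /\
     ~ In (star (dname d)) (names Tg) /\
     (forall d', In d' (own Sc E) -> dname d' <> star (dname d))).

(** The relation to be added for [c : A [= t]].  For a type definition
    [c : K = t] it may happen that only that of [t] is undefined; the
    declaration of [c*] then has an undefined component and is omitted. *)
Definition starred (m : assignment) (r : relation) (A : expr)
    (o : option expr) : bool :=
  match rel m r [] A with
  | None => false
  | Some _ =>
      match o with
      | None => true
      | Some t => match rel m r [] t with Some _ => true | None => false end
      end
  end.

(** [r_E]; it is [r] on [Sc], and [r_E1] on an included extension [E1]. *)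
Fixpoint lr_rel (Sc : theory) (m : assignment) (r : relation)
    (star : name -> name) (ch : choice) (E : theory) : relation :=
  match E with
  | tnil => fun _ => None
  | tconst E0 c A o =>
      let r0 := lr_rel Sc m r star ch E0 in
      fun d =>
        if Nat.eqb d c then
          if starred (ind_mor Sc m ch E0) r0 A o
          then Some (Con (star c)) else None
        else r0 d
  | tincl E0 E1 =>
      let r0 := lr_rel Sc m r star ch E0 in
      let r1 := if theory_eq_dec E1 Sc then r
                else lr_rel Sc m r star ch E1 in
      fun d => if memb d (names E1) then r1 d else r0 d
  end.

(** [E^m], with each [c*] declared right after [c]. *)
Fixpoint lr_thy (Sc Tg : theory) (m : assignment) (r : relation)
    (star : name -> name) (ch : choice) (E : theory) : theory :=
  match E with
  | tnil => tnil
  | tconst E0 c A o =>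
      let mE := ind_mor Sc m ch E in
      let rE := lr_rel Sc m r star ch E0 in
      let E' := tconst (lr_thy Sc Tg m r star ch E0)
                  c (po_type Sc m ch c A) (option_map (po_value Sc m ch c) o)
      in
      match rel mE rE [] A, o with
      | Some rA, None => tconst E' (star c) (at_ rA (mE c)) None
      | Some rA, Some t =>
          match rel mE rE [] t with
          | Some rt => tconst E' (star c) (at_ rA (mE c)) (Some rt)
          | None => E'
          end
      | None, _ => E'
      end
  | tincl E0 E1 =>
      tincl (lr_thy Sc Tg m r star ch E0)
        (if theory_eq_dec E1 Sc then Tg else lr_thy Sc Tg m r star ch E1)
  end.

(** [LR f : LR E -> LR F] is the identity on [Tg], maps [c] to the image of
    [f c] under pushout and removal, and [c*] to the relation of [f c]. *)
Definition lr_mor (Sc Tg : theory) (m : assignment) (r : relation)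
    (star : name -> name) (ch : choice) (E F : theory) (f : assignment)
    : assignment :=
  fun x =>
    if memb x (names Tg) then Con x
    else match find (fun d => Nat.eqb x (star (dname d))) (own Sc E) with
         | Some d =>
             match rel (ind_mor Sc m ch F) (lr_rel Sc m r star ch F) []
                     (f (dname d)) with
             | Some p => p
             | None => Con x
             end
         | None => po_value Sc m ch x (f x)
         end.

(** [f : E -> F] maps the type families of [E] on which [r_E] is defined, and
    only those, to families of [F] on which [r_F] is defined.  Holds trivially if
    [r] is total.  Otherwise it is needed: if [E] declares [d : type], then
    [LR E] declares [d* : d -> type], which has no image if [f d] is a type of
    [Sc] on which [r] is undefined. *)
Definition respects_definedness (Sc : theory) (m : assignment) (r : relation)
    (star : name -> name) (ch : choice) (E F : theory) (f : assignment)
    : Prop :=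
  forall c A o, In (c, A, o) (own Sc E) -> is_kind (flat E) [] A ->
    (lr_rel Sc m r star ch E c = None <->
     rel (ind_mor Sc m ch F) (lr_rel Sc m r star ch F) [] (f c) = None).

(* Main.v *)
(** The theories [LR E] are well-formed by the abstraction theorem: if [t : A] and
    the translation of [t] is defined, then so is that of [A], and the former
    has the type obtained by applying the latter to the image of [t].  Its
    conversion case needs that convertible expressions have convertible
    translations.  Whether the translation is defined can be read off simple types,
    which conversion preserves.  But a conversion may pass through ill-typed
    expressions, where the shape of the translation is out of control.  So we
    compare it with a total translation, which supplies dummies for the undefined
    parts and visibly respects parallel reduction; a logical relation over simple
    types connects the two.

    The removal of arguments is typed by expanding every constant just far enough
    to bind its removed arguments: this is a morphism, and the image of a
    saturated expression beta-reduces to the expression after removal.  The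
    bindings are then removed by strengthening.

    On morphisms, naturality of the translation turns the square of [m_E], [m_F],
    [f] and [LR f] into the equation between the relations of [E] and [F].  That
    these are defined at the same places is by induction over the constants of [E]:
    at types by term-totality, at kinds by assumption. *)

From Stdlib Require Import List PeanoNat Bool Lia Wf_nat FunctionalExtensionality.
Require Import Defs.
Import ListNotations.

(** The conversion rule compares raw expressions, so no property of types can be carried along a
    chain of conversions. Instead all definitions are unfolded ([unf]), which leaves beta-eta, and a
    common reduct is taken by confluence. Reduction preserves products, and also the fact that the
    head of a family is not a variable ([fam]); injectivity of products, the separation of types
    from kinds and the invariance of erasures are all read off that reduct. Term-totality makes
    definedness at a term a matter of its type: a constant of a type is related exactly if the
    translation of the type is defined. The properties of [LR E] cannot be proved one at a time. The
    removal of arguments types [c] and the abstraction theorem types [c*], both over the preceding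
    part of [E], where the induced morphism and the relation must already be correct. A single
    invariant ([inv]) therefore follows the structure of [E]. It speaks of all sufficiently long
    expansions of constants: the shortest ones make beta-reduction exact, the longest ones form the
    induced morphism. *)

Definition scons (s : expr) (sigma : nat -> expr) (i : nat) : expr :=
  match i with 0 => s | S j => sigma j end.

Lemma inst_scons s t : inst s t = subst (scons s Var) t.
Proof. reflexivity. Qed.

(** * Renaming, substitution and the homomorphic extension *)

Lemma up_ren_comp r1 r2 :
  (fun i => up_ren r1 (up_ren r2 i)) = up_ren (fun i => r1 (r2 i)).
Proof. extensionality i; now destruct i. Qed.

Lemma ren_ren r1 r2 t : ren r1 (ren r2 t) = ren (fun i => r1 (r2 i)) t.
Proof.
  revert r1 r2; induction t; intros; simpl; try rewrite IHt1, IHt2;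
    rewrite ?up_ren_comp; reflexivity.
Qed.

Lemma up_up_ren s r : (fun i => up s (up_ren r i)) = up (fun i => s (r i)).
Proof. extensionality i; now destruct i. Qed.

Lemma subst_ren s r t : subst s (ren r t) = subst (fun i => s (r i)) t.
Proof.
  revert s r; induction t; intros; simpl; try rewrite IHt1, IHt2;
    rewrite ?up_up_ren; reflexivity.
Qed.

Lemma ren_up s r :
  (fun i => ren (up_ren r) (up s i)) = up (fun i => ren r (s i)).
Proof.
  extensionality i; destruct i; simpl; [easy|].
  unfold shift; now rewrite !ren_ren.
Qed.

Lemma ren_subst r s t : ren r (subst s t) = subst (fun i => ren r (s i)) t.
Proof.
  revert s r; induction t; intros; simpl; try rewrite IHt1, IHt2;
    rewrite ?ren_up; reflexivity.
Qed.

Lemma subst_up s2 s1 :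
  (fun i => subst (up s2) (up s1 i)) = up (fun i => subst s2 (s1 i)).
Proof.
  extensionality i; destruct i; simpl; [easy|].
  unfold shift; now rewrite subst_ren, ren_subst.
Qed.

Lemma subst_subst s2 s1 t :
  subst s2 (subst s1 t) = subst (fun i => subst s2 (s1 i)) t.
Proof.
  revert s1 s2; induction t; intros; simpl; try rewrite IHt1, IHt2;
    rewrite ?subst_up; reflexivity.
Qed.

Lemma up_Var : up Var = Var.
Proof. extensionality i; now destruct i. Qed.

Lemma subst_Var t : subst Var t = t.
Proof. induction t; simpl; rewrite ?up_Var, ?IHt1, ?IHt2; easy. Qed.

Lemma up_ren_subst r : up (fun i => Var (r i)) = fun i => Var (up_ren r i).
Proof. extensionality i; now destruct i. Qed.

Lemma ren_as_subst r t : ren r t = subst (fun i => Var (r i)) t.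
Proof.
  revert r; induction t; intros; simpl; try rewrite IHt1, IHt2;
    rewrite ?up_ren_subst; reflexivity.
Qed.

Lemma ren_id t : ren (fun i => i) t = t.
Proof. now rewrite ren_as_subst, subst_Var. Qed.

#[global] Hint Rewrite ren_ren subst_ren ren_subst subst_subst subst_Var ren_id
  : sub.

(** Normalizes both sides to one substitution each, to be compared pointwise. *)
Ltac asub :=
  unfold inst, shift in *; autorewrite with sub; try reflexivity.
Ltac asub_ext :=
  asub; rewrite ?ren_as_subst; asub;
  match goal with
  | |- subst ?f ?t = subst ?g ?t => f_equal
  | |- subst ?f ?t = ?t => rewrite <- (subst_Var t) at 2; f_equal
  | |- ?t = subst ?f ?t => rewrite <- (subst_Var t) at 1; f_equal
  | _ => idtac
  end;
  try (let i := fresh "i" in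
  extensionality i;
  do 4 try (destruct i as [|i]; simpl; asub; try easy;
            try solve [now rewrite ?ren_as_subst])).

Lemma subst_inst s a b :
  subst s (inst a b) = inst (subst s a) (subst (up s) b).
Proof. asub_ext. Qed.

Lemma ren_inst r a b :
  ren r (inst a b) = inst (ren r a) (ren (up_ren r) b).
Proof. rewrite !ren_as_subst, subst_inst, up_ren_subst; reflexivity. Qed.

Lemma inst_shift s t : inst s (shift 1 t) = t.
Proof. asub. Qed.

Lemma subst_up_shift s t : subst (up s) (shift 1 t) = shift 1 (subst s t).
Proof. asub_ext. Qed.

Lemma ren_up_shift r t : ren (up_ren r) (shift 1 t) = shift 1 (ren r t).
Proof. asub. Qed.

(** Phrased by substitution so that it can be rewritten with directly; [closed_Typ_subst] shows that
    one particular substitution is enough. *)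
Definition closed (t : expr) : Prop := forall s, subst s t = t.

Lemma closed_ren t r : closed t -> ren r t = t.
Proof. intros H; now rewrite ren_as_subst, H. Qed.

Lemma closed_Con c : closed (Con c).
Proof. easy. Qed.

Definition closed_asg (m : assignment) : Prop := forall c, closed (m c).

Lemma hom_ren m r t : closed_asg m -> hom m (ren r t) = ren r (hom m t).
Proof.
  intros Hm; revert r; induction t; intros; simpl; rewrite ?IHt1, ?IHt2; auto.
  symmetry; apply closed_ren, Hm.
Qed.

Lemma hom_subst m s t :
  closed_asg m -> hom m (subst s t) = subst (fun i => hom m (s i)) (hom m t).
Proof.
  intros Hm.
  assert (U : forall s, (fun i => hom m (up s i)) = up (fun i => hom m (s i))).
  { intros s0; extensionality i; destruct i; simpl; [easy|].
    unfold shift; now apply hom_ren. }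
  revert s; induction t; intros; simpl; rewrite ?IHt1, ?IHt2, ?U; auto.
  symmetry; apply Hm.
Qed.

Lemma hom_inst m s t :
  closed_asg m -> hom m (inst s t) = inst (hom m s) (hom m t).
Proof.
  intros Hm; unfold inst; rewrite hom_subst by easy.
  f_equal; extensionality i; now destruct i.
Qed.

Lemma hom_shift m k t : closed_asg m -> hom m (shift k t) = shift k (hom m t).
Proof. apply hom_ren. Qed.

Lemma hom_hom f g t : hom g (hom f t) = hom (fun c => hom g (f c)) t.
Proof. induction t; simpl; congruence. Qed.

Lemma hom_Con t : hom Con t = t.
Proof. induction t; simpl; congruence. Qed.

Fixpoint over (N : name -> Prop) (t : expr) : Prop :=
  match t with
  | Typ | Var _ => True
  | Con c => N c
  | Pi A B => over N A /\ over N B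
  | Lam A b => over N A /\ over N b
  | App f s => over N f /\ over N s
  end.

Lemma over_mono (N N' : name -> Prop) t :
  (forall c, N c -> N' c) -> over N t -> over N' t.
Proof. intros H; induction t; simpl; intuition auto. Qed.

Lemma hom_over (N : name -> Prop) m m' t :
  (forall c, N c -> m c = m' c) -> over N t -> hom m t = hom m' t.
Proof.
  intros H; induction t; simpl; intros; auto; f_equal; intuition auto.
Qed.

Lemma hom_over_id (N : name -> Prop) m t :
  (forall c, N c -> m c = Con c) -> over N t -> hom m t = t.
Proof.
  intros H Ht; rewrite (hom_over N m Con) by easy; apply hom_Con.
Qed.

(** * Definitional equality *)

#[global] Hint Constructors conv : conv.

Lemma conv_ren Sg r t u :
  (forall c A v, In (c, A, Some v) Sg -> closed v) ->
  conv Sg t u -> conv Sg (ren r t) (ren r u).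
Proof.
  intros Hc H; revert r; induction H; intros; simpl; eauto with conv.
  - rewrite ren_inst; apply conv_beta.
  - rewrite ren_up_shift; apply conv_eta.
  - rewrite (closed_ren t) by eauto; eauto with conv.
Qed.

Lemma conv_subst1 Sg s t u :
  (forall c A v, In (c, A, Some v) Sg -> closed v) ->
  conv Sg t u -> conv Sg (subst s t) (subst s u).
Proof.
  intros Hc H; revert s; induction H; intros; simpl; eauto with conv.
  - rewrite subst_inst; apply conv_beta.
  - rewrite subst_up_shift; apply conv_eta.
  - rewrite (Hc _ _ _ H); eauto with conv.
Qed.

Lemma conv_subst2 Sg s s' t :
  (forall c A v, In (c, A, Some v) Sg -> closed v) ->
  (forall i, conv Sg (s i) (s' i)) -> conv Sg (subst s t) (subst s' t).
Proof.
  intros Hc.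
  assert (U : forall s s', (forall i, conv Sg (s i) (s' i)) ->
              forall i, conv Sg (up s i) (up s' i)).
  { intros s0 s1 H i; destruct i; simpl; [apply conv_refl|].
    apply conv_ren; auto. }
  revert s s'; induction t; intros; simpl; auto with conv.
Qed.

Lemma conv_subst Sg s s' t u :
  (forall c A v, In (c, A, Some v) Sg -> closed v) ->
  conv Sg t u -> (forall i, conv Sg (s i) (s' i)) ->
  conv Sg (subst s t) (subst s' u).
Proof.
  intros Hc H Hs; eapply conv_trans.
  - apply conv_subst1; eauto.
  - now apply conv_subst2.
Qed.

Lemma conv_inst Sg a a' b b' :
  (forall c A v, In (c, A, Some v) Sg -> closed v) ->
  conv Sg a a' -> conv Sg b b' -> conv Sg (inst a b) (inst a' b').
Proof.
  intros Hc Ha Hb; apply conv_subst; auto.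
  intros [|i]; auto with conv.
Qed.

Lemma conv_mono Sg Sg' t u : incl Sg Sg' -> conv Sg t u -> conv Sg' t u.
Proof. intros Hi H; induction H; eauto with conv. Qed.

Lemma conv_hom Sg Sg' m t u :
  closed_asg m ->
  (forall c A v, In (c, A, Some v) Sg -> conv Sg' (m c) (hom m v)) ->
  conv Sg t u -> conv Sg' (hom m t) (hom m u).
Proof.
  intros Hm Hd H; induction H; simpl; eauto with conv.
  - rewrite hom_inst by easy; apply conv_beta.
  - rewrite hom_shift by easy; apply conv_eta.
Qed.

Lemma hom_conv (N : name -> Prop) Sg m m' t :
  (forall c, N c -> conv Sg (m c) (m' c)) -> over N t ->
  conv Sg (hom m t) (hom m' t).
Proof.
  intros H; induction t; simpl; intros; auto with conv; intuition auto with conv.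
Qed.

Lemma hom_conv_id (N : name -> Prop) Sg m t :
  (forall c, N c -> conv Sg (m c) (Con c)) -> over N t ->
  conv Sg (hom m t) t.
Proof.
  intros H Ht; rewrite <- (hom_Con t) at 2; now apply hom_conv with N.
Qed.

(** * Confluence of beta-eta reduction *)

Inductive par : expr -> expr -> Prop :=
| par_Typ : par Typ Typ
| par_Con c : par (Con c) (Con c)
| par_Var i : par (Var i) (Var i)
| par_Pi A A' B B' : par A A' -> par B B' -> par (Pi A B) (Pi A' B')
| par_Lam A A' b b' : par A A' -> par b b' -> par (Lam A b) (Lam A' b')
(* Labels can be dropped because [conv] ignores them. *)
| par_label A b b' : par b b' -> par (Lam A b) (Lam Typ b')
| par_App f f' s s' : par f f' -> par s s' -> par (App f s) (App f' s')
| par_beta A b b' s s' :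
    par b b' -> par s s' -> par (App (Lam A b) s) (inst s' b')
| par_eta A f f' : par f f' -> par (Lam A (App (shift 1 f) (Var 0))) f'.
#[global] Hint Constructors par : par.

Lemma par_refl t : par t t.
Proof. induction t; auto with par. Qed.
#[global] Hint Resolve par_refl : par.

Lemma par_ren r t u : par t u -> par (ren r t) (ren r u).
Proof.
  intros H; revert r; induction H; intros; simpl; auto with par.
  - rewrite ren_inst; auto with par.
  - rewrite ren_up_shift; auto with par.
Qed.

Lemma par_up s s' :
  (forall i, par (s i) (s' i)) -> forall i, par (up s i) (up s' i).
Proof. intros H [|i]; simpl; auto with par; now apply par_ren. Qed.

Lemma par_subst s s' t u :
  par t u -> (forall i, par (s i) (s' i)) -> par (subst s t) (subst s' u).
Proof.
  intros H; revert s s'; induction H; intros; simpl; auto using par_up with par.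
  - rewrite subst_inst; auto using par_up with par.
  - rewrite subst_up_shift; auto with par.
Qed.

Lemma par_inst a a' b b' :
  par a a' -> par b b' -> par (inst a b) (inst a' b').
Proof. intros; apply par_subst; auto; intros [|i]; auto with par. Qed.

(** Renaming preserves weak pullbacks. The eta case of [par_ren_inv] needs this: a function whose
    shift lies in the image of [up_ren r] lies itself in the image of [r]. *)
Lemma ren_pullback r1 r2 r3 r4 a b :
  (forall i j, r1 i = r2 j -> exists k, i = r3 k /\ j = r4 k) ->
  ren r1 a = ren r2 b -> exists c, a = ren r3 c /\ b = ren r4 c.
Proof.
  assert (U : forall r1 r2 r3 r4 : nat -> nat,
    (forall i j, r1 i = r2 j -> exists k, i = r3 k /\ j = r4 k) ->
    (forall i j, up_ren r1 i = up_ren r2 j ->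
       exists k, i = up_ren r3 k /\ j = up_ren r4 k)).
  { intros p1 p2 p3 p4 H [|i] [|j] E; simpl in E; try discriminate.
    - exists 0; auto.
    - injection E as E; destruct (H _ _ E) as (k & -> & ->); exists (S k); auto. }
  revert b r1 r2 r3 r4; induction a; intros [] r1 r2 r3 r4 Hp E;
    simpl in E; try discriminate; try (injection E; intros).
  - exists Typ; auto.
  - exists (Con n); subst; auto.
  - destruct (Hp _ _ H) as (k & -> & ->); exists (Var k); auto.
  - destruct (IHa1 _ _ _ _ _ Hp H0) as (c1 & -> & ->).
    destruct (IHa2 _ _ _ _ _ (U _ _ _ _ Hp) H) as (c2 & -> & ->).
    exists (Pi c1 c2); auto.
  - destruct (IHa1 _ _ _ _ _ Hp H0) as (c1 & -> & ->).
    destruct (IHa2 _ _ _ _ _ (U _ _ _ _ Hp) H) as (c2 & -> & ->).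
    exists (Lam c1 c2); auto.
  - destruct (IHa1 _ _ _ _ _ Hp H0) as (c1 & -> & ->).
    destruct (IHa2 _ _ _ _ _ Hp H) as (c2 & -> & ->).
    exists (App c1 c2); auto.
Qed.

Lemma up_ren_inj r :
  (forall i j, r i = r j -> i = j) ->
  forall i j, up_ren r i = up_ren r j -> i = j.
Proof. intros H [|i] [|j]; simpl; intros; try discriminate; auto. Qed.

Lemma ren_inj r t u :
  (forall i j, r i = r j -> i = j) -> ren r t = ren r u -> t = u.
Proof.
  intros Hr E.
  destruct (ren_pullback r r (fun i => i) (fun i => i) t u) as (c & -> & ->);
    eauto.
Qed.

Lemma shift_inj t u : shift 1 t = shift 1 u -> t = u.
Proof. apply ren_inj; simpl; congruence. Qed.

Lemma par_ren_inv r t u :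
  (forall i j, r i = r j -> i = j) -> par (ren r t) u ->
  exists u', u = ren r u' /\ par t u'.
Proof.
  intros Hr H; remember (ren r t) as x eqn:E; revert r t Hr E.
  induction H; intros r t0 Hr E; destruct t0 as [|c0|i0|a1 a2|a1 a2|a1 a2];
    simpl in E; try discriminate; try (injection E; intros; subst).
  - exists Typ; auto with par.
  - eexists (Con _); simpl; split; eauto with par.
  - exists (Var i0); auto with par.
  - edestruct IHpar1 as (A2 & -> & ?); eauto.
    edestruct IHpar2 as (B2 & -> & ?); [|eauto|]; [eauto using up_ren_inj|].
    exists (Pi A2 B2); auto with par.
  - edestruct IHpar1 as (A2 & -> & ?); eauto.
    edestruct IHpar2 as (b2 & -> & ?); [|eauto|]; [eauto using up_ren_inj|].
    exists (Lam A2 b2); auto with par.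
  - edestruct IHpar as (b2 & -> & ?); [|eauto|]; [eauto using up_ren_inj|].
    exists (Lam Typ b2); auto with par.
  - edestruct IHpar1 as (A2 & -> & ?); eauto.
    edestruct IHpar2 as (B2 & -> & ?); eauto.
    exists (App A2 B2); auto with par.
  - destruct a1; simpl in *; try discriminate; injection H2; intros; subst.
    edestruct IHpar1 as (b2 & -> & ?); [|eauto|]; [eauto using up_ren_inj|].
    edestruct IHpar2 as (s2 & -> & ?); eauto.
    exists (inst s2 b2); rewrite ren_inst; auto with par.
  - destruct a2 as [| | | | |g0 x0]; simpl in *; try discriminate; injection H0; intros.
    destruct x0 as [| |i0| | |]; simpl in *; try discriminate; injection H1; intros.
    destruct i0; try discriminate.
    destruct (ren_pullback S (up_ren r) (fun i => r i) S f g0)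
      as (g & -> & ->); [|easy|].
    { intros i [|j] Ej; simpl in Ej; [discriminate|injection Ej as ->].
      exists j; auto. }
    edestruct IHpar as (f2 & -> & ?); eauto.
    exists f2; split; auto. apply par_eta; auto.
Qed.

Fixpoint size (t : expr) : nat :=
  match t with
  | Typ | Con _ | Var _ => 1
  | Pi A B | Lam A B | App A B => S (size A + size B)
  end.

Lemma size_ren r t : size (ren r t) = size t.
Proof. revert r; induction t; intros; simpl; congruence. Qed.

Lemma size_shift k t : size (shift k t) = size t.
Proof. apply size_ren. Qed.

Lemma par_shift_inv t u :
  par (shift 1 t) u -> exists u', u = shift 1 u' /\ par t u'.
Proof. apply par_ren_inv; simpl; congruence. Qed.

Lemma inst_Var0_up b : inst (Var 0) (ren (up_ren S) b) = b.
Proof. asub_ext. Qed.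

(** The critical peak is [Lam A (App (shift 1 (Lam B b)) (Var 0))], which beta takes to [Lam A b]
    and eta to [Lam B b]; [par_label] joins them in [Lam Typ b]. Closing such peaks uses steps that
    are assembled anew rather than found in the given derivations, hence the induction on size. *)
Lemma par_diamond t u1 u2 :
  par t u1 -> par t u2 -> exists v, par u1 v /\ par u2 v.
Proof.
  remember (size t) as n eqn:En.
  revert t u1 u2 En;
    induction n as [n IH] using (well_founded_induction lt_wf).
  intros t u1 u2 En H1 H2.
  assert (J : forall t u1 u2, size t < n -> par t u1 -> par t u2 ->
              exists v, par u1 v /\ par u2 v) by eauto.
  clear IH.
  (* the eta step of [Lam A (App (shift 1 f) (Var 0))] against a step of the body *)
  assert (Eta : forall f f' b, size f < n -> par f f' ->
     par (App (shift 1 f) (Var 0)) b ->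
     exists v, par f' v /\ forall A, par (Lam A b) v).
  { intros f f' b Hs Hf Hb; inversion Hb; subst.
    - apply par_shift_inv in H3 as (f2 & -> & Hf2); inversion H5; subst.
      destruct (J _ _ _ Hs Hf Hf2) as (v & ? & ?); exists v; auto with par.
    - destruct f; simpl in H; try discriminate; injection H as -> ->.
      apply par_ren_inv in H3 as (b1 & -> & Hb1);
        [|apply up_ren_inj; simpl; congruence].
      inversion H5; subst.
      replace (inst (Var 0) (ren _ b1)) with b1
        by (symmetry; apply inst_Var0_up).
      destruct (J _ _ _ Hs Hf (par_label f1 _ _ Hb1)) as (v & ? & Hv).
      inversion Hv; subst.
      + match goal with H : par Typ _ |- _ => inversion H; subst end.
        eexists; split; [eassumption|intros; now apply par_label].
      + eexists; split; [eassumption|intros; now apply par_label].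
      + eexists; split; [eassumption|intros; now apply par_eta]. }
  (* the beta step of [App (Lam A b) s] against a step of both components *)
  assert (Beta : forall A b s f' s1 b' s2, S (size (Lam A b) + size s) = n ->
     par (Lam A b) f' -> par s s1 -> par b b' -> par s s2 ->
     exists v, par (App f' s1) v /\ par (inst s2 b') v).
  { intros A b s f' s1 b' s2 Hn Hf Hs1 Hb Hs2; simpl in Hn.
    destruct (J s s1 s2) as (s3 & Hs13 & Hs23); [lia|easy|easy|].
    inversion Hf; subst.
    - destruct (J b b'0 b') as (b3 & ? & ?); [lia|easy|easy|].
      exists (inst s3 b3); auto using par_inst with par.
    - destruct (J b b'0 b') as (b3 & ? & ?); [lia|easy|easy|].
      exists (inst s3 b3); auto using par_inst with par.
    - rewrite ?size_shift in *; simpl in Hn; rewrite ?size_shift in *.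
      inversion Hb; subst.
      + match goal with H : par (shift 1 _) _ |- _ =>
          apply par_shift_inv in H as (f2 & -> & Hf2) end.
        match goal with H : par (Var 0) _ |- _ => inversion H; subst end.
        destruct (J f f' f2) as (v & ? & ?); [lia|easy|easy|].
        exists (App v s3); unfold inst; simpl.
        change (subst _ (shift 1 f2)) with (inst s2 (shift 1 f2)).
        rewrite inst_shift; auto with par.
      + destruct f as [| | | |f1 f2|];
          match goal with E : _ = shift 1 _ |- _ => simpl in E; try discriminate;
            injection E as -> -> end.
        match goal with H : par (ren _ _) _ |- _ => rename H into Hb0 end.
        apply par_ren_inv in Hb0 as (b1 & -> & Hb1);
          [|apply up_ren_inj; simpl; congruence].
        match goal with H : par (Var 0) _ |- _ => inversion H; subst end.
        replace (inst (Var 0) (ren _ b1)) with b1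
          by (symmetry; apply inst_Var0_up).
        apply (J (App (Lam f1 f2) s)); simpl in *; [lia| |]; auto with par. }
  inversion H1; subst; inversion H2; subst; simpl in *;
    try solve [eexists; eauto with par].
  - destruct (J A A' A'0) as (v1 & ? & ?), (J B B' B'0) as (v2 & ? & ?); auto; try lia.
    exists (Pi v1 v2); auto with par.
  - destruct (J b b' b'0) as (v2 & ? & ?); auto; try lia.
    exists (Lam Typ v2); auto with par.
  - destruct (J b b' b'0) as (v2 & ? & ?); auto; try lia.
    exists (Lam Typ v2); auto with par.
  - destruct (Eta f u2 b') as (v & ? & ?); auto;
      rewrite ?size_shift in *; try lia; exists v; auto.
  - destruct (J b b' b'0) as (v2 & ? & ?); auto; try lia.
    exists (Lam Typ v2); auto with par.
  - destruct (J b b' b'0) as (v2 & ? & ?); auto; try lia.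
    exists (Lam Typ v2); auto with par.
  - destruct (Eta f u2 b') as (v & ? & ?); auto;
      rewrite ?size_shift in *; try lia; exists v; auto.
  - destruct (J f f' f'0) as (v1 & ? & ?), (J s s' s'0) as (v2 & ? & ?); auto; try lia.
    exists (App v1 v2); auto with par.
  - eapply Beta; eauto.
  - match goal with |- exists v, par ?x v /\ par ?y v =>
      enough (exists v, par y v /\ par x v) as (v & ? & ?) by eauto end.
    eapply Beta; eauto.
  - destruct (J b b' b'0) as (v1 & ? & ?), (J s s' s'0) as (v2 & ? & ?); auto; try lia.
    exists (inst v2 v1); auto using par_inst.
  - destruct (Eta f u1 b') as (v & ? & ?); auto;
      rewrite ?size_shift in *; try lia; exists v; auto.
  - destruct (Eta f u1 b') as (v & ? & ?); auto;
      rewrite ?size_shift in *; try lia; exists v; auto.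
  - match goal with E : shift 1 _ = shift 1 _ |- _ => apply shift_inj in E as -> end.
    rewrite ?size_shift in *.
    eapply J; [|eauto|eauto]; lia.
Qed.

Inductive pars : expr -> expr -> Prop :=
| pars_refl t : pars t t
| pars_step t u v : par t u -> pars u v -> pars t v.

Lemma pars_trans t u v : pars t u -> pars u v -> pars t v.
Proof. intros H; induction H; eauto using pars_step. Qed.

Lemma par_pars t u : par t u -> pars t u.
Proof. intros; eapply pars_step; eauto; apply pars_refl. Qed.

Lemma par_strip t u1 u2 :
  par t u1 -> pars t u2 -> exists v, pars u1 v /\ par u2 v.
Proof.
  intros H1 H2; revert u1 H1; induction H2; intros u1 H1.
  - exists u1; split; auto; apply pars_refl.
  - destruct (par_diamond _ _ _ H1 H) as (w & Hw & Hw').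
    destruct (IHpars _ Hw') as (v' & ? & ?); eauto using pars_step.
Qed.

Lemma pars_confluent t u1 u2 :
  pars t u1 -> pars t u2 -> exists v, pars u1 v /\ pars u2 v.
Proof.
  intros H1; revert u2; induction H1; intros u2 H2.
  - exists u2; split; auto; apply pars_refl.
  - destruct (par_strip _ _ _ H H2) as (w & Hw & Hw').
    destruct (IHpars _ Hw) as (v' & ? & ?); eauto using pars_step.
Qed.

Lemma pars_cong (F : expr -> expr -> expr) t t' u u' :
  (forall t t' u u', par t t' -> par u u' -> par (F t u) (F t' u')) ->
  pars t t' -> pars u u' -> pars (F t u) (F t' u').
Proof.
  intros HF Ht Hu; apply pars_trans with (F t' u).
  - induction Ht; eauto using pars_refl, pars_step, par_refl.
  - induction Hu; eauto using pars_refl, pars_step, par_refl.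
Qed.

(** Dropping the label first lets abstractions with unrelated labels meet. *)
Lemma pars_Lam A b b' : pars b b' -> pars (Lam A b) (Lam Typ b').
Proof.
  intros H; eapply pars_step; [apply par_label, par_refl|].
  induction H; eauto using pars_refl, pars_step with par.
Qed.

Lemma conv_pars t u : conv [] t u -> exists v, pars t v /\ pars u v.
Proof.
  intros H; induction H.
  - exists t; split; apply pars_refl.
  - destruct IHconv as (v & ? & ?); eauto.
  - destruct IHconv1 as (v1 & ? & J1), IHconv2 as (v2 & J2 & ?).
    destruct (pars_confluent _ _ _ J1 J2) as (w & ? & ?).
    exists w; eauto using pars_trans.
  - exists (inst s b); auto using par_pars, pars_refl with par.
  - exists f; auto using par_pars, pars_refl with par.
  - easy.
  - destruct IHconv1 as (v1 & ? & ?), IHconv2 as (v2 & ? & ?).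
    exists (Pi v1 v2); split; apply pars_cong; auto with par.
  - destruct IHconv as (v1 & ? & ?); exists (Lam Typ v1); auto using pars_Lam.
  - destruct IHconv1 as (v1 & ? & ?), IHconv2 as (v2 & ? & ?).
    exists (App v1 v2); split; apply pars_cong; auto with par.
Qed.

Lemma par_conv Sg t u : par t u -> conv Sg t u.
Proof.
  intros H; induction H; auto with conv.
  - apply conv_trans with (App (Lam A b') s'); auto with conv.
  - apply conv_trans with f; auto with conv.
Qed.

Lemma pars_conv Sg t u : pars t u -> conv Sg t u.
Proof. intros H; induction H; eauto using par_conv with conv. Qed.

Lemma pars_Typ u : pars Typ u -> u = Typ.
Proof.
  intros H; remember Typ as t eqn:E; induction H; subst; auto.
  inversion H; subst; auto.
Qed.

Lemma pars_Pi A B u :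
  pars (Pi A B) u -> exists A' B', u = Pi A' B' /\ pars A A' /\ pars B B'.
Proof.
  intros H; remember (Pi A B) as t eqn:E; revert A B E; induction H; intros; subst.
  - exists A, B; auto using pars_refl.
  - inversion H; subst.
    destruct (IHpars _ _ eq_refl) as (A2 & B2 & -> & ? & ?).
    exists A2, B2; eauto using pars_step.
Qed.

(** * Typing *)

(** Lets a single rule for products, abstractions and conversion serve types ([Some Typ]) as well as
    kinds ([None]). *)
Definition is_sort (s : option expr) : Prop := s = None \/ s = Some Typ.

(** [ht Sg G t (Some A)] is [t : A] and [ht Sg G t None] says that [t] is a kind.
    The context is not required to be well-formed, and abstractions carry the
    well-formedness of the type of the body. *)
Inductive ht (Sg : sign) : ctx -> expr -> option expr -> Prop :=
| ht_Typ G : ht Sg G Typ None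
| ht_Con G c A o : In (c, A, o) Sg -> ht Sg G (Con c) (Some A)
| ht_Var G i A :
    nth_error G i = Some A -> ht Sg G (Var i) (Some (shift (S i) A))
| ht_Pi G A B s :
    is_sort s -> ht Sg G A (Some Typ) -> ht Sg (A :: G) B s ->
    ht Sg G (Pi A B) s
| ht_Lam G A b B s :
    is_sort s -> ht Sg G A (Some Typ) -> ht Sg (A :: G) b (Some B) ->
    ht Sg (A :: G) B s -> ht Sg G (Lam A b) (Some (Pi A B))
| ht_App G f a A B :
    ht Sg G f (Some (Pi A B)) -> ht Sg G a (Some A) ->
    ht Sg G (App f a) (Some (inst a B))
| ht_conv G t A B s :
    is_sort s -> ht Sg G t (Some A) -> conv Sg A B -> ht Sg G B s ->
    ht Sg G t (Some B).

Inductive wfc (Sg : sign) : ctx -> Prop :=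
| wfc_nil : wfc Sg []
| wfc_cons G A : wfc Sg G -> ht Sg G A (Some Typ) -> wfc Sg (A :: G).

Definition cls (Sg : sign) (G : ctx) (A : expr) : Prop :=
  exists s, is_sort s /\ ht Sg G A s.

(** A theory reached along several includes is flattened several times, so a declaration may recur,
    but only identically. *)
Inductive wfs : sign -> Prop :=
| wfs_nil : wfs []
| wfs_cons Sg c A o :
    wfs Sg ->
    (forall A' o', In (c, A', o') Sg -> A' = A /\ o' = o) ->
    cls Sg [] A ->
    (forall t, o = Some t -> ht Sg [] t (Some A)) ->
    wfs ((c, A, o) :: Sg).

Lemma is_sort_map (f : expr -> expr) s :
  f Typ = Typ -> is_sort s -> option_map f s = s.
Proof. intros H [-> | ->]; simpl; congruence. Qed.

Lemma sort_None : is_sort None.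
Proof. now left. Qed.

Lemma sort_Typ : is_sort (Some Typ).
Proof. now right. Qed.
#[global] Hint Resolve sort_None sort_Typ : core.

Lemma ht_agree Sg G t T s1 s2 :
  ht Sg G t T -> (forall i, i < length G -> s1 i = s2 i) ->
  subst s1 t = subst s2 t.
Proof.
  assert (U : forall (G : ctx) A s1 s2, (forall i, i < length G -> s1 i = s2 i) ->
    forall i, i < length (A :: G) -> up s1 i = up s2 i).
  { intros G0 A p1 p2 H [|i] Hi; simpl in *; auto. rewrite H; auto; lia. }
  intros H; revert s1 s2; induction H; intros; simpl; auto.
  - apply H0, nth_error_Some; congruence.
  - f_equal; eauto.
  - f_equal; eauto.
  - f_equal; eauto.
Qed.

Lemma ht_closed Sg t T : ht Sg [] t T -> closed t.
Proof.
  intros H s; rewrite <- (subst_Var t) at 2.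
  eapply ht_agree; eauto; simpl; lia.
Qed.

Lemma cls_closed Sg A : cls Sg [] A -> closed A.
Proof. intros (s & _ & H); eapply ht_closed; eauto. Qed.

Lemma wfs_closed Sg c A o :
  wfs Sg -> In (c, A, o) Sg -> closed A /\ forall t, o = Some t -> closed t.
Proof.
  induction 1; simpl; [easy|]; intros [E|E]; [|auto].
  injection E as -> -> ->; split; [eapply cls_closed; eauto|].
  intros; eapply ht_closed; eauto.
Qed.

Lemma wfs_closed_type Sg c A o : wfs Sg -> In (c, A, o) Sg -> closed A.
Proof. intros Hs H; exact (proj1 (wfs_closed _ _ _ _ Hs H)). Qed.

Lemma wfs_closed_def Sg : wfs Sg ->
  forall c A v, In (c, A, Some v) Sg -> closed v.
Proof. intros Hs c A v H; exact (proj2 (wfs_closed _ _ _ _ Hs H) v eq_refl). Qed.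
#[global] Hint Resolve wfs_closed_type wfs_closed_def : core.

Lemma wfs_unique Sg c A o A' o' :
  wfs Sg -> In (c, A, o) Sg -> In (c, A', o') Sg -> A' = A /\ o' = o.
Proof.
  induction 1; simpl; [easy|]; intros [E|E] [E'|E']; auto.
  - injection E as -> -> ->; injection E' as -> ->; auto.
  - injection E as -> -> ->; eauto.
  - injection E' as -> -> ->. destruct (H0 _ _ E); subst; auto.
Qed.

Lemma ht_mono Sg Sg' G t T : incl Sg Sg' -> ht Sg G t T -> ht Sg' G t T.
Proof.
  intros Hi H; induction H; eauto using ht, conv_mono.
Qed.

Lemma cls_mono Sg Sg' G A : incl Sg Sg' -> cls Sg G A -> cls Sg' G A.
Proof. intros Hi (s & ? & ?); exists s; eauto using ht_mono. Qed.

(** * Renaming and substitution in typing derivations *)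

Definition ctx_ren (G' : ctx) (r : nat -> nat) (G : ctx) : Prop :=
  forall i A, nth_error G i = Some A -> exists A',
    nth_error G' (r i) = Some A' /\ shift (S (r i)) A' = ren r (shift (S i) A).

Lemma ctx_ren_up G' r G A :
  ctx_ren G' r G -> ctx_ren (ren r A :: G') (up_ren r) (A :: G).
Proof.
  intros H [|i] B E; simpl in *.
  - injection E as <-; eexists; split; [reflexivity|].
    rewrite ren_up_shift; reflexivity.
  - destruct (H _ _ E) as (B' & ? & E'); exists B'; split; auto.
    transitivity (shift 1 (shift (S (r i)) B')); [asub|].
    rewrite E', <- ren_up_shift. f_equal. asub.
Qed.

Lemma ctx_ren_shift G A : ctx_ren (A :: G) S G.
Proof. intros i B E; exists B; split; auto. asub. Qed.

Lemma ht_ren Sg G t T : wfs Sg -> ht Sg G t T -> forall G' r,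
  ctx_ren G' r G -> ht Sg G' (ren r t) (option_map (ren r) T).
Proof.
  intros Hs H; induction H; intros G' r Hr; simpl.
  - constructor.
  - rewrite closed_ren by eauto. econstructor; eauto.
  - destruct (Hr _ _ H) as (A' & ? & <-); now constructor.
  - pose proof (is_sort_map (ren r) s eq_refl H) as E.
    rewrite E; apply ht_Pi; [easy|apply (IHht1 _ _ Hr)|].
    rewrite <- (is_sort_map (ren (up_ren r)) s eq_refl H).
    apply IHht2, ctx_ren_up, Hr.
  - apply ht_Lam with (s := s); [easy| | |].
    + apply (IHht1 _ _ Hr).
    + apply (IHht2 _ _ (ctx_ren_up _ _ _ A Hr)).
    + rewrite <- (is_sort_map (ren (up_ren r)) s eq_refl H).
      apply (IHht3 _ _ (ctx_ren_up _ _ _ A Hr)).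
  - rewrite ren_inst; eapply ht_App; [apply (IHht1 _ _ Hr)|apply (IHht2 _ _ Hr)].
  - eapply ht_conv with (s := s); [easy|apply (IHht1 _ _ Hr)| |].
    + apply conv_ren; eauto.
    + rewrite <- (is_sort_map (ren r) s eq_refl H); auto.
Qed.

Lemma ht_shift Sg G t T A :
  wfs Sg -> ht Sg G t T -> ht Sg (A :: G) (shift 1 t) (option_map (shift 1) T).
Proof.
  intros Hs H; apply (ht_ren _ _ _ _ Hs H (A :: G) S), ctx_ren_shift.
Qed.

Lemma ht_shift_sort Sg G t s A : wfs Sg -> is_sort s ->
  ht Sg G t s -> ht Sg (A :: G) (shift 1 t) s.
Proof.
  intros Hs H Ht; rewrite <- (is_sort_map (shift 1) s eq_refl H).
  now apply ht_shift.
Qed.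

Lemma ht_weaken_nil Sg G t T : wfs Sg -> ht Sg [] t T -> ht Sg G t T.
Proof.
  intros Hs H; apply (ht_ren _ _ _ _ Hs) with (r := fun i => i) (G' := G) in H.
  - rewrite ren_id in H; destruct T; simpl in H; rewrite ?ren_id in H; auto.
  - intros [|i]; simpl; discriminate.
Qed.

Definition ctx_sub (Sg : sign) (G' : ctx) (s : nat -> expr) (G : ctx) : Prop :=
  forall i A, nth_error G i = Some A ->
    ht Sg G' (s i) (Some (subst s (shift (S i) A))).

Lemma ctx_sub_up Sg G' s G A :
  wfs Sg -> ctx_sub Sg G' s G ->
  ctx_sub Sg (subst s A :: G') (up s) (A :: G).
Proof.
  intros Hs H [|i] B E; simpl in E.
  - injection E as <-. rewrite subst_up_shift. now constructor.
  - simpl. replace (subst (up s) (shift (S (S i)) B))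
      with (shift 1 (subst s (shift (S i) B))).
    + apply (ht_shift Sg G' (s i) (Some (subst s (shift (S i) B)))); auto.
    + rewrite <- subst_up_shift. f_equal. asub.
Qed.

Lemma ht_subst Sg G t T : wfs Sg -> ht Sg G t T -> forall G' s,
  ctx_sub Sg G' s G -> ht Sg G' (subst s t) (option_map (subst s) T).
Proof.
  intros Hs H; induction H; intros G' r Hr; simpl.
  - constructor.
  - rewrite (wfs_closed_type _ _ _ _ Hs H). econstructor; eauto.
  - now apply Hr.
  - pose proof (is_sort_map (subst r) s eq_refl H) as E.
    rewrite E; apply ht_Pi; [easy|apply (IHht1 _ _ Hr)|].
    rewrite <- (is_sort_map (subst (up r)) s eq_refl H).
    apply IHht2, ctx_sub_up; auto.
  - apply ht_Lam with (s := s); [easy| | |].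
    + apply (IHht1 _ _ Hr).
    + apply (IHht2 _ _ (ctx_sub_up _ _ _ _ A Hs Hr)).
    + rewrite <- (is_sort_map (subst (up r)) s eq_refl H).
      apply (IHht3 _ _ (ctx_sub_up _ _ _ _ A Hs Hr)).
  - rewrite subst_inst; eapply ht_App; [apply (IHht1 _ _ Hr)|apply (IHht2 _ _ Hr)].
  - eapply ht_conv with (s := s); [easy|apply (IHht1 _ _ Hr)| |].
    + apply conv_subst1; eauto.
    + rewrite <- (is_sort_map (subst r) s eq_refl H); auto.
Qed.

Lemma ctx_sub_inst Sg G a A :
  ht Sg G a (Some A) -> ctx_sub Sg G (scons a Var) (A :: G).
Proof.
  intros H [|i] B E; simpl in *.
  - injection E as <-. change (subst _ _) with (inst a (shift 1 A)).
    now rewrite inst_shift.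
  - replace (subst (scons a Var) (shift (S (S i)) B)) with (shift (S i) B)
      by asub_ext.
    now constructor.
Qed.

Lemma ht_inst Sg G a A t T : wfs Sg ->
  ht Sg (A :: G) t T -> ht Sg G a (Some A) ->
  ht Sg G (inst a t) (option_map (inst a) T).
Proof.
  intros Hs H Ha; apply (ht_subst _ _ _ _ Hs H), ctx_sub_inst, Ha.
Qed.

Lemma ht_inst_sort Sg G a A t s : wfs Sg -> is_sort s ->
  ht Sg (A :: G) t s -> ht Sg G a (Some A) -> ht Sg G (inst a t) s.
Proof.
  intros Hs H Ht Ha; rewrite <- (is_sort_map (inst a) s eq_refl H).
  eapply ht_inst; eauto.
Qed.

Lemma ctx_sub_conv Sg G A A' s :
  wfs Sg -> is_sort s -> ht Sg G A s -> conv Sg A A' ->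
  ctx_sub Sg (A' :: G) Var (A :: G).
Proof.
  intros Hs Hsort HA Hc [|i] B E; simpl in E; rewrite subst_Var.
  - injection E as <-.
    apply ht_conv with (s := s) (A := shift 1 A'); auto.
    + now constructor.
    + apply conv_ren; eauto with conv.
    + now apply ht_shift_sort.
  - now constructor.
Qed.

Lemma ht_ctx_conv Sg G A A' s t T :
  wfs Sg -> is_sort s -> ht Sg G A s -> conv Sg A A' ->
  ht Sg (A :: G) t T -> ht Sg (A' :: G) t T.
Proof.
  intros Hs Hsort HA Hc H.
  pose proof (ht_subst _ _ _ _ Hs H _ _ (ctx_sub_conv _ _ _ _ _ Hs Hsort HA Hc)) as J.
  rewrite subst_Var in J; destruct T; simpl in J; rewrite ?subst_Var in J; auto.
Qed.

(** * Inversion and validity of typing *)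

Lemma ht_Pi_inv Sg G A B T : ht Sg G (Pi A B) T ->
  exists s, is_sort s /\ ht Sg G A (Some Typ) /\ ht Sg (A :: G) B s /\
    (T = None -> s = None) /\
    (forall X, T = Some X -> s = Some Typ /\ conv Sg Typ X).
Proof.
  intros H; remember (Pi A B) as t eqn:E; revert A B E.
  induction H; intros A0 B0 E; try discriminate.
  - injection E as -> ->; exists s; repeat split; auto.
    + destruct H; congruence.
    + destruct H; subst; try discriminate. injection H2 as <-. apply conv_refl.
  - destruct (IHht1 _ _ E) as (s' & ? & ? & ? & ? & J).
    exists s'; repeat split; auto; try discriminate.
    + eapply J; eauto.
    + injection H7 as <-. eapply conv_trans; [eapply J; eauto|auto].
Qed.

Lemma ht_Lam_inv Sg G A b X : ht Sg G (Lam A b) (Some X) ->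
  exists B s, is_sort s /\ ht Sg G A (Some Typ) /\ ht Sg (A :: G) b (Some B) /\
    ht Sg (A :: G) B s /\ conv Sg (Pi A B) X.
Proof.
  intros H; remember (Lam A b) as t eqn:E; remember (Some X) as T eqn:ET.
  revert A b X E ET; induction H; intros A0 b0 X E ET; try discriminate.
  - injection E as -> ->; injection ET as <-; exists B, s; auto with conv.
  - injection ET as <-; destruct (IHht1 _ _ _ E eq_refl) as (B' & s' & ? & ? & ? & ? & ?).
    exists B', s'; intuition eauto with conv.
Qed.

Lemma ht_App_inv Sg G f a X : ht Sg G (App f a) (Some X) ->
  exists A B, ht Sg G f (Some (Pi A B)) /\ ht Sg G a (Some A) /\
    conv Sg (inst a B) X.
Proof.
  intros H; remember (App f a) as t eqn:E; remember (Some X) as T eqn:ET.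
  revert f a X E ET; induction H; intros f0 a0 X E ET; try discriminate.
  - injection E as -> ->; injection ET as <-; exists A, B; auto with conv.
  - injection ET as <-; destruct (IHht1 _ _ _ E eq_refl) as (A' & B' & ? & ? & ?).
    exists A', B'; intuition eauto with conv.
Qed.

Lemma ht_Con_inv Sg G c X : ht Sg G (Con c) (Some X) ->
  exists A o, In (c, A, o) Sg /\ conv Sg A X.
Proof.
  intros H; remember (Con c) as t eqn:E; remember (Some X) as T eqn:ET.
  revert c X E ET; induction H; intros c0 X E ET; try discriminate.
  - injection E as ->; injection ET as <-; eauto with conv.
  - injection ET as <-; destruct (IHht1 _ _ E eq_refl) as (A' & o & ? & ?).
    exists A', o; eauto with conv.
Qed.

Lemma ht_Var_inv Sg G i X : ht Sg G (Var i) (Some X) ->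
  exists A, nth_error G i = Some A /\ conv Sg (shift (S i) A) X.
Proof.
  intros H; remember (Var i) as t eqn:E; remember (Some X) as T eqn:ET.
  revert i X E ET; induction H; intros i0 X E ET; try discriminate.
  - injection E as ->; injection ET as <-; eauto with conv.
  - injection ET as <-; destruct (IHht1 _ _ E eq_refl) as (A' & ? & ?).
    exists A'; eauto with conv.
Qed.

Lemma ht_Typ_inv Sg G X : ~ ht Sg G Typ (Some X).
Proof.
  intros H; remember Typ as t eqn:E; remember (Some X) as T eqn:ET.
  revert X E ET; induction H; intros X E ET; try discriminate; subst; eauto.
Qed.

Lemma ht_None_inv Sg G t : ht Sg G t None ->
  t = Typ \/ exists A B, t = Pi A B /\ ht Sg G A (Some Typ) /\ ht Sg (A :: G) B None.
Proof.
  intros H; remember None as T eqn:E; destruct H; try discriminate; auto.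
  subst; right; exists A, B; auto.
Qed.

Lemma cls_In Sg c A o : wfs Sg -> In (c, A, o) Sg -> cls Sg [] A.
Proof.
  induction 1; simpl; [easy|]; intros [E|E].
  - injection E as -> -> ->; eapply cls_mono; [|eauto]; auto with datatypes.
  - eapply cls_mono; [|eauto]; auto with datatypes.
Qed.

Lemma ht_In_def Sg c A t : wfs Sg -> In (c, A, Some t) Sg -> ht Sg [] t (Some A).
Proof.
  induction 1; simpl; [easy|]; intros [E|E].
  - injection E as -> -> ->; eapply ht_mono; [|eauto]; auto with datatypes.
  - eapply ht_mono; [|eauto]; auto with datatypes.
Qed.

Lemma wfc_nth Sg G i A : wfs Sg -> wfc Sg G -> nth_error G i = Some A ->
  ht Sg G (shift (S i) A) (Some Typ).
Proof.
  intros Hs Hw; revert i A; induction Hw; intros [|i] B E; simpl in E; try discriminate.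
  - injection E as <-; now apply ht_shift_sort.
  - replace (shift (S (S i)) B) with (shift 1 (shift (S i) B)) by asub.
    apply ht_shift_sort; auto.
Qed.

Lemma ht_valid Sg G t A : wfs Sg -> wfc Sg G -> ht Sg G t (Some A) -> cls Sg G A.
Proof.
  intros Hs Hw H; remember (Some A) as T eqn:E; revert Hw A E.
  induction H; intros Hw A0 E; try discriminate.
  - injection E as <-; destruct (cls_In _ _ _ _ Hs H) as (s & ? & ?).
    exists s; auto using ht_weaken_nil.
  - injection E as <-; exists (Some Typ); split; auto; eapply wfc_nth; eauto.
  - subst s; destruct H; [discriminate|]. injection H as ->.
    exists None; split; auto; constructor.
  - injection E as <-; exists s; split; auto; now constructor.
  - injection E as <-. destruct (IHht1 Hw _ eq_refl) as (s & ? & HP).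
    apply ht_Pi_inv in HP as (s' & ? & ? & ? & _).
    exists s'; split; auto; eapply ht_inst_sort; eauto.
  - injection E as <-; exists s; auto.
Qed.

Lemma ht_conv_cls Sg G t A B :
  ht Sg G t (Some A) -> conv Sg A B -> cls Sg G B -> ht Sg G t (Some B).
Proof. intros ? ? (s & ? & ?); eapply ht_conv; eauto. Qed.

Scheme wf_ctx_mut := Minimality for wf_ctx Sort Prop
  with is_kind_mut := Minimality for is_kind Sort Prop
  with has_type_mut := Minimality for has_type Sort Prop.
Combined Scheme typing_mut from wf_ctx_mut, is_kind_mut, has_type_mut.

(** [ht] omits the context checks so that renaming and substitution need no assumption on the target
    context. Its additional premise for abstractions is recovered here from [ht_valid]. *)
Lemma typing_ht Sg : wfs Sg ->
  (forall G, wf_ctx Sg G -> wfc Sg G) /\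
  (forall G K, is_kind Sg G K -> wfc Sg G /\ ht Sg G K None) /\
  (forall G t A, has_type Sg G t A -> wfc Sg G /\ ht Sg G t (Some A)).
Proof.
  intros Hs; apply typing_mut; intros.
  - constructor.
  - constructor; tauto.
  - split; auto; constructor.
  - split; [tauto|]. apply ht_Pi; solve [auto|tauto].
  - split; auto; econstructor; eauto.
  - split; auto; econstructor; eauto.
  - split; [tauto|]; apply ht_Pi; solve [auto|tauto].
  - split; [tauto|].
    destruct (ht_valid Sg (A :: G) b B) as (s & ? & ?); try tauto.
    eapply ht_Lam; intuition eauto.
  - split; [tauto|]; eapply ht_App; intuition eauto.
  - split; [tauto|]; apply ht_conv with A (Some Typ); intuition auto.
  - split; [tauto|]; apply ht_conv with A None; intuition auto.
Qed.

Lemma ht_typing Sg G t T : ht Sg G t T -> wfc Sg G -> wf_ctx Sg G ->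
  match T with
  | None => is_kind Sg G t
  | Some A => has_type Sg G t A
  end.
Proof.
  intros H; induction H; intros Hw Hw'.
  - now constructor.
  - econstructor; eauto.
  - now constructor.
  - assert (J : has_type Sg G A Typ) by (apply IHht1; auto).
    destruct H; subst; constructor; auto; apply IHht2; now constructor.
  - assert (J : has_type Sg G A Typ) by (apply IHht1; auto).
    constructor; auto; apply IHht2; now constructor.
  - econstructor; [apply IHht1|apply IHht2]; auto.
  - destruct H; subst.
    + eapply ty_conv_kind; [apply IHht1| |apply IHht2]; auto.
    + eapply ty_conv_type; [apply IHht1| |apply IHht2]; auto.
Qed.

Lemma ht_nil_has_type Sg t A : ht Sg [] t (Some A) -> has_type Sg [] t A.
Proof. intros H; apply (ht_typing _ _ _ _ H); constructor. Qed.

Lemma ht_nil_is_kind Sg t : ht Sg [] t None -> is_kind Sg [] t.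
Proof. intros H; apply (ht_typing _ _ _ _ H); constructor. Qed.

Lemma cls_classifier Sg A : cls Sg [] A -> classifier Sg A.
Proof.
  intros (s & [-> | ->] & H); [right; now apply ht_nil_is_kind|].
  left; now apply ht_nil_has_type.
Qed.

Lemma has_type_ht Sg G t A : wfs Sg -> has_type Sg G t A -> ht Sg G t (Some A).
Proof. intros Hs H; now apply (typing_ht Sg Hs). Qed.

Lemma is_kind_ht Sg G t : wfs Sg -> is_kind Sg G t -> ht Sg G t None.
Proof. intros Hs H; now apply (typing_ht Sg Hs). Qed.

Lemma classifier_cls Sg A : wfs Sg -> classifier Sg A -> cls Sg [] A.
Proof.
  intros Hs [H|H]; [exists (Some Typ)|exists None]; split; auto.
  - now apply has_type_ht.
  - now apply is_kind_ht.
Qed.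

(** * Signatures of theories and the constants of an expression *)

Lemma wfs_app S1 S0 :
  wfs S1 -> wfs S0 ->
  (forall d d', In d S0 -> In d' S1 -> dname d = dname d' -> d = d') ->
  wfs (S1 ++ S0).
Proof.
  intros H H0; induction H; simpl; auto; intros Hc.
  constructor.
  - apply IHwfs; intros; apply Hc; simpl; auto.
  - intros A' o' Hin; apply in_app_or in Hin as [Hin|Hin]; auto.
    assert (E : (c, A', o') = (c, A, o)) by (apply Hc; simpl; auto).
    now injection E as -> ->.
  - eapply cls_mono; [|eassumption]; auto with datatypes.
  - intros; eapply ht_mono; [|eauto]; auto with datatypes.
Qed.

Lemma names_In E c : In c (names E) <-> exists A o, In (c, A, o) (flat E).
Proof.
  unfold names; rewrite in_map_iff; split.
  - intros ([[c' A] o] & <- & H); eauto.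
  - intros (A & o & H); exists (c, A, o); auto.
Qed.

Lemma wf_theory_wfs E : wf_theory E -> wfs (flat E).
Proof.
  induction 1; simpl.
  - constructor.
  - constructor; auto.
    + intros A' o' Hin; exfalso; apply H0, names_In; eauto.
    + now apply classifier_cls.
    + intros; apply has_type_ht; auto.
  - apply wfs_app; auto.
Qed.

Definition in_sig (Sg : sign) (c : name) : Prop := exists A o, In (c, A, o) Sg.

Lemma ht_over Sg G t T : ht Sg G t T -> over (in_sig Sg) t.
Proof.
  intros H; induction H; simpl; auto; exists A, o; auto.
Qed.

Lemma cls_over Sg G A : cls Sg G A -> over (in_sig Sg) A.
Proof. intros (s & _ & H); eapply ht_over; eauto. Qed.

(** Replacing every variable by [Typ] leaves nothing for a further substitution to act on. *)
Lemma closed_Typ_subst t : subst (fun _ => Typ) t = t -> closed t.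
Proof. intros H s; rewrite <- H; asub. Qed.

Lemma closed_hom m t : closed_asg m -> closed t -> closed (hom m t).
Proof.
  intros Hm Ht; apply closed_Typ_subst.
  rewrite <- (Ht (fun _ => Typ)) at 2. now rewrite hom_subst.
Qed.

Lemma memb_In c l : memb c l = true <-> In c l.
Proof.
  unfold memb; rewrite existsb_exists; split.
  - intros (x & H & E); apply Nat.eqb_eq in E; now subst.
  - intros H; exists c; split; auto; apply Nat.eqb_refl.
Qed.

Lemma memb_false c l : memb c l = false <-> ~ In c l.
Proof. rewrite <- memb_In; destruct (memb c l); split; congruence. Qed.

Lemma in_sig_names Sg c : in_sig Sg c <-> In c (map dname Sg).
Proof.
  unfold in_sig; rewrite in_map_iff; split.
  - intros (A & o & H); exists (c, A, o); auto.
  - intros ([[c' A] o] & <- & H); eauto.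
Qed.

(** * Recursion over the declarations of a signature *)

Section SigRec.
Context {X : Type} (base : name -> X) (step : (name -> X) -> decl -> X).

(** The guard skips a declaration that recurs further down the list, so each constant is evaluated
    at its earliest occurrence. *)
Fixpoint sig_rec (Sg : sign) : name -> X :=
  match Sg with
  | [] => base
  | d :: Sg' => fun c =>
      if Nat.eqb c (dname d) && negb (memb c (map dname Sg'))
      then step (sig_rec Sg') d else sig_rec Sg' c
  end.

Lemma sig_rec_tail d Sg c : in_sig Sg c -> sig_rec (d :: Sg) c = sig_rec Sg c.
Proof.
  intros H; simpl. apply in_sig_names, memb_In in H; rewrite H.
  now rewrite andb_false_r.
Qed.

(** If a step inspects only the constants occurring in a declaration, the initial segment it was
    computed over may be replaced by the whole signature. This yields the fixpoint equations of
    [unf], [unf_depth] and [er_base]. *)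
Lemma sig_rec_eq Sg c A o :
  (forall (N : name -> Prop) k k' d A o, (forall c, N c -> k c = k' c) ->
     over N A -> (forall t, o = Some t -> over N t) ->
     step k (d, A, o) = step k' (d, A, o)) ->
  wfs Sg -> In (c, A, o) Sg -> sig_rec Sg c = step (sig_rec Sg) (c, A, o).
Proof.
  intros Hl; induction 1 as [|Sg d A0 o0 Hs IH Hu Hc Ht]; intros Hin; [easy|].
  assert (L : forall d' A o, over (in_sig Sg) A ->
            (forall t, o = Some t -> over (in_sig Sg) t) ->
            step (sig_rec ((d, A0, o0) :: Sg)) (d', A, o) =
            step (sig_rec Sg) (d', A, o)).
  { intros; apply Hl with (in_sig Sg); auto using sig_rec_tail. }
  destruct Hin as [E|Hin].
  - injection E as -> -> ->.
    rewrite L; [|eapply cls_over; eauto|intros; eapply ht_over; eauto].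
    destruct (memb c (map dname Sg)) eqn:E.
    + apply memb_In, in_sig_names in E as (A' & o' & E).
      destruct (Hu _ _ E) as [-> ->].
      rewrite sig_rec_tail by (exists A, o; auto). now apply IH.
    + simpl; unfold dname at 1; simpl; now rewrite Nat.eqb_refl, E.
  - rewrite L.
    + rewrite sig_rec_tail by (exists A, o; auto). now apply IH.
    + eapply cls_over, cls_In; eauto.
    + intros t ->. eapply ht_over, ht_In_def; eauto.
Qed.
End SigRec.

(** Well-founded induction on constants: a declaration mentions only earlier ones. *)
Lemma wfs_decl_ind Sg (Q : name -> Prop) : wfs Sg ->
  (forall c A o, In (c, A, o) Sg ->
     over Q A -> (forall t, o = Some t -> over Q t) -> Q c) ->
  forall c, in_sig Sg c -> Q c.
Proof.
  intros Hs HQ.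
  assert (J : forall Sg', wfs Sg' -> incl Sg' Sg -> forall c, in_sig Sg' c -> Q c).
  { induction 1 as [|Sg' d A0 o0 Hs' IH Hu Hc Ht]; intros Hi c (A & o & Hin); [easy|].
    assert (Hi' : incl Sg' Sg) by (intros x Hx; apply Hi; simpl; auto).
    destruct Hin as [E|Hin].
    - injection E as -> -> ->. apply HQ with A o.
      + apply Hi; simpl; auto.
      + eapply over_mono, cls_over; eauto.
      + intros; eapply over_mono, ht_over; eauto.
    - apply IH; auto; exists A, o; auto. }
  apply J; auto using incl_refl.
Qed.

Lemma lookup_wfs Sg c A o : wfs Sg -> In (c, A, o) Sg -> lookup c Sg = Some A.
Proof.
  intros Hs H. assert (J : exists A', lookup c Sg = Some A' /\ exists o', In (c, A', o') Sg).
  { clear Hs; induction Sg as [|[[d B] o'] S IH]; simpl in *; [easy|].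
    destruct (Nat.eqb_spec c d); [subst; eauto|].
    destruct H as [H|H]; [congruence|].
    destruct (IH H) as (A' & ? & o'' & ?); eauto. }
  destruct J as (A' & -> & o' & H').
  now destruct (wfs_unique _ _ _ _ _ _ Hs H H') as [-> _].
Qed.

(** * Unfolding of definitions *)

(** Made an assignment so that the full unfolding of [t] is [hom (unf Sg) t] and the lemmas on [hom]
    apply to it. *)
Definition unf : sign -> assignment :=
  sig_rec Con (fun k d =>
    match d with
    | (c, _, Some t) => hom k t
    | (c, _, None) => Con c
    end).

Lemma unf_eq Sg c A o : wfs Sg -> In (c, A, o) Sg ->
  unf Sg c = match o with Some t => hom (unf Sg) t | None => Con c end.
Proof.
  intros Hs H; unfold unf; rewrite (sig_rec_eq _ _ Sg c A o); auto.
  intros N k k' d A' o' Hk _ Ho; destruct o'; auto. eapply hom_over; eauto.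
Qed.

Lemma unf_closed Sg : wfs Sg -> closed_asg (unf Sg).
Proof.
  induction 1 as [|Sg d A0 o0 Hs IH Hu Hc Ht]; intros c; simpl.
  - apply closed_Con.
  - unfold unf; simpl. destruct (_ && _); [|apply IH].
    destruct o0; [|apply closed_Con].
    apply closed_hom; [apply IH|]. eapply ht_closed; eauto.
Qed.

Lemma unf_conv Sg c : wfs Sg -> conv Sg (Con c) (unf Sg c).
Proof.
  intros Hs; revert c; induction Hs as [|Sg d A0 o0 Hs IH Hu Hc Ht]; intros c.
  - apply conv_refl.
  - unfold unf; simpl.
    assert (J : forall c, conv ((d, A0, o0) :: Sg) (Con c) (unf Sg c)).
    { intros; eapply conv_mono; [|apply IH]; auto with datatypes. }
    destruct (Nat.eqb c _ && _) eqn:E; [|apply J].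
    apply andb_true_iff in E as [E _]; apply Nat.eqb_eq in E; simpl in E; subst.
    destruct o0 as [t|]; [|apply conv_refl].
    apply conv_trans with t; [eapply conv_delta; simpl; eauto|].
    apply conv_sym, hom_conv_id with (fun _ => True); auto using conv_sym.
    apply over_mono with (in_sig Sg); auto; eapply ht_over; eauto.
Qed.

Lemma over_True t : over (fun _ => True) t.
Proof. induction t; simpl; auto. Qed.

Lemma hom_unf_conv Sg t : wfs Sg -> conv Sg t (hom (unf Sg) t).
Proof.
  intros Hs; apply conv_sym, hom_conv_id with (fun _ => True).
  - intros; now apply conv_sym, unf_conv.
  - apply over_True.
Qed.

(** Unfolding maps both sides of a delta step to the same expression, so only beta-eta is left and
    confluence applies. *)
Lemma conv_unf Sg t u : wfs Sg -> conv Sg t u ->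
  exists v, pars (hom (unf Sg) t) v /\ pars (hom (unf Sg) u) v.
Proof.
  intros Hs H; apply conv_pars. revert H; apply conv_hom; [now apply unf_closed|].
  intros; erewrite unf_eq by eauto; apply conv_refl.
Qed.

Lemma conv_Pi_inj Sg A B A' B' : wfs Sg ->
  conv Sg (Pi A B) (Pi A' B') -> conv Sg A A' /\ conv Sg B B'.
Proof.
  intros Hs H; apply conv_unf in H as (v & H1 & H2); auto; simpl in *.
  apply pars_Pi in H1 as (A1 & B1 & -> & ? & ?).
  apply pars_Pi in H2 as (A2 & B2 & E & ? & ?). injection E as <- <-.
  split; (eapply conv_trans; [apply hom_unf_conv; auto|]);
    (eapply conv_trans; [eapply pars_conv; eauto|]); apply conv_sym;
    (eapply conv_trans; [apply hom_unf_conv; auto|]); eapply pars_conv; eauto.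
Qed.

Lemma conv_Typ_Pi Sg A B : wfs Sg -> ~ conv Sg Typ (Pi A B).
Proof.
  intros Hs H; apply conv_unf in H as (v & H1 & H2); auto; simpl in *.
  apply pars_Typ in H1 as ->.
  apply pars_Pi in H2 as (? & ? & ? & _); discriminate.
Qed.

Lemma conv_Pi_Typ Sg A B : wfs Sg -> ~ conv Sg (Pi A B) Typ.
Proof. intros Hs H; eapply conv_Typ_Pi; eauto using conv_sym. Qed.

Fixpoint neutral (P : name -> Prop) (t : expr) : Prop :=
  match t with
  | Con c => P c
  | App f _ => neutral P f
  | _ => False
  end.

Definition primitive (Sg : sign) (c : name) : Prop := exists A, In (c, A, None) Sg.

Lemma neutral_ren P r t : neutral P t -> neutral P (ren r t).
Proof. induction t; simpl; auto. Qed.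

Lemma neutral_pars P t u : neutral P t -> pars t u -> neutral P u.
Proof.
  assert (J : forall t u, par t u -> neutral P t -> neutral P u).
  { induction 1; simpl; tauto. }
  intros Ht H; induction H; eauto.
Qed.

Lemma conv_Pi_neutral Sg A B t : wfs Sg ->
  neutral (primitive Sg) t -> ~ conv Sg (Pi A B) t.
Proof.
  intros Hs Ht H; apply conv_unf in H as (v & H1 & H2); auto; simpl in *.
  apply pars_Pi in H1 as (? & ? & -> & _).
  apply neutral_pars with (P := primitive Sg) in H2; [easy|].
  clear H2; induction t; simpl in *; auto.
  destruct Ht as (C & H); erewrite unf_eq by eauto; simpl; exists C; auto.
Qed.

(** * Type families and kinds *)

(** [fam P false t]: [t] is a type family in that its head is not a variable;
    [fam P true t]: [t] is a kind. [P] holds of the constants for families. *)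
Fixpoint fam (P : name -> Prop) (k : bool) (t : expr) : Prop :=
  match t with
  | Typ => k = true
  | Con c => k = false /\ P c
  | Var _ => False
  | Pi A B => fam P false A /\ fam P k B
  | Lam _ b => k = false /\ fam P false b
  | App f _ => k = false /\ fam P false f
  end.

Lemma fam_subst P k s t : fam P k t -> fam P k (subst s t).
Proof. revert k s; induction t; simpl; intros; intuition auto. Qed.

Lemma fam_ren P k r t : fam P k t -> fam P k (ren r t).
Proof. rewrite ren_as_subst; apply fam_subst. Qed.

Lemma fam_par P k t u : par t u -> fam P k t -> fam P k u.
Proof.
  intros H; revert k; induction H; simpl; intros; intuition auto.
  - subst; now apply fam_subst, IHpar1.
  - subst; apply IHpar. rewrite <- (inst_shift Typ f). now apply fam_subst.
Qed.

Lemma fam_pars P k t u : pars t u -> fam P k t -> fam P k u.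
Proof. induction 1; eauto using fam_par. Qed.

Lemma fam_excl P t : fam P true t -> fam P false t -> False.
Proof. induction t; simpl; intuition discriminate. Qed.

Lemma fam_mono (P P' : name -> Prop) k t :
  (forall c, P c -> P' c) -> fam P k t -> fam P' k t.
Proof. intros H; revert k; induction t; simpl; intros; intuition auto. Qed.

Lemma fam_hom P k m t :
  (forall c, P c -> fam P false (m c)) -> fam P k t -> fam P k (hom m t).
Proof.
  intros H; revert k; induction t; simpl; intros; intuition auto. subst; auto.
Qed.

Fixpoint ends_in_Typ (t : expr) : Prop :=
  match t with Typ => True | Pi _ B => ends_in_Typ B | _ => False end.

Lemma fam_true_ends P t : fam P true t -> ends_in_Typ t.
Proof. induction t; simpl; intuition discriminate. Qed.

Lemma fam_false_ends P t : fam P false t -> ~ ends_in_Typ t.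
Proof. induction t; simpl; intuition discriminate. Qed.

Definition famc (Sg : sign) (c : name) : Prop :=
  exists A o, In (c, A, o) Sg /\ ends_in_Typ A.

Definition sig_sorted (Sg : sign) : Prop :=
  (forall c A o, In (c, A, o) Sg ->
     fam (famc Sg) true A \/ fam (famc Sg) false A) /\
  (forall c, famc Sg c -> fam (famc Sg) false (unf Sg c)).

Lemma conv_fam_excl Sg K A : wfs Sg -> sig_sorted Sg ->
  fam (famc Sg) true K -> fam (famc Sg) false A -> ~ conv Sg K A.
Proof.
  intros Hs [_ Hd] HK HA H; apply conv_unf in H as (v & H1 & H2); auto.
  apply (fam_excl (famc Sg) v); [apply (fam_pars _ _ _ _ H1)|apply (fam_pars _ _ _ _ H2)];
    now apply fam_hom.
Qed.

(** The critical case is the conversion rule, which might pass from a type to a kind;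
    [conv_fam_excl] forbids this on a common reduct, because reduction preserves both forms. *)
Lemma ht_fam_gen Sg G t T : wfs Sg -> sig_sorted Sg ->
  Forall (fam (famc Sg) false) G -> ht Sg G t T ->
  match T with
  | None => fam (famc Sg) true t
  | Some A => fam (famc Sg) true A /\ fam (famc Sg) false t \/
              fam (famc Sg) false A
  end.
Proof.
  intros Hs Hf HG H; revert HG; induction H; intros HG; simpl; auto.
  - destruct (proj1 Hf _ _ _ H) as [J|J]; [left|right]; auto.
    repeat split; auto. exists A, o; split; auto; eapply fam_true_ends; eauto.
  - right; apply fam_ren. rewrite Forall_forall in HG.
    apply HG; eapply nth_error_In; eauto.
  - destruct (IHht1 HG) as [[_ HA]|J]; [|easy].
    specialize (IHht2 (Forall_cons _ HA HG)).
    destruct H; subst; simpl; auto.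
    destruct IHht2 as [[_ HB]|J]; [|easy]. left; auto.
  - destruct (IHht1 HG) as [[_ HA]|J]; [|easy].
    destruct (IHht2 (Forall_cons _ HA HG)); [left|right]; intuition auto.
  - destruct (IHht1 HG) as [[[? ?] ?]|[? ?]]; [left|right]; repeat split; auto;
      now apply fam_subst.
  - specialize (IHht1 HG); specialize (IHht2 HG).
    destruct H; subst; simpl in *; [|right; now destruct IHht2 as [[_ ?]|?]].
    destruct IHht1 as [[? ?]|?]; [left; auto|].
    exfalso; eapply conv_fam_excl; eauto using conv_sym.
Qed.

(** Sorting the constants and sorting the typed expressions depend on each other; the knot is cut by
    applying [ht_fam_gen] to the preceding declarations only. *)
Lemma wfs_sorted Sg : wfs Sg -> sig_sorted Sg.
Proof.
  induction 1 as [|Sg d A0 o0 Hs IH Hu Hc Ht].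
  - split; [easy|]. intros c (A & o & [] & _).
  - assert (M : forall c, famc Sg c -> famc ((d, A0, o0) :: Sg) c).
    { intros c (A & o & ? & ?); exists A, o; simpl; auto. }
    assert (HA0 : fam (famc Sg) true A0 \/ fam (famc Sg) false A0).
    { destruct Hc as (s & [-> | ->] & H).
      - left; apply (ht_fam_gen _ _ _ _ Hs IH) in H; auto.
      - right; apply (ht_fam_gen _ _ _ _ Hs IH) in H; auto. simpl in H.
        tauto || (destruct H as [[_ H]|H]; easy). }
    split.
    + intros c A o [E|Hin].
      * injection E as -> -> ->. destruct HA0; [left|right]; eauto using fam_mono.
      * destruct (proj1 IH _ _ _ Hin); [left|right]; eauto using fam_mono.
    + intros c Hfc; unfold unf; simpl.
      destruct (Nat.eqb c _ && _) eqn:E.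
      * apply andb_true_iff in E as [E1 E2]; apply Nat.eqb_eq in E1; simpl in E1; subst.
        destruct o0 as [t|]; [|simpl; auto].
        apply fam_mono with (famc Sg); auto.
        apply fam_hom; [apply IH|].
        specialize (Ht t eq_refl).
        apply (ht_fam_gen _ _ _ _ Hs IH) in Ht; auto.
        destruct Ht as [[_ Ht]|Ht]; auto; exfalso.
        destruct Hfc as (A & o & Hin & He).
        assert (A = A0) as ->.
        { destruct Hin as [E|Hin]; [now injection E|].
          now destruct (Hu _ _ Hin). }
        eapply fam_false_ends; eauto.
      * apply fam_mono with (famc Sg); auto; apply IH.
        destruct Hfc as (A & o & [Hin|Hin] & He); [|exists A, o; auto].
        injection Hin as -> -> ->; simpl in E; rewrite Nat.eqb_refl in E.
        unfold dname in E at 1; simpl in E.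
        apply negb_false_iff, memb_In, in_sig_names in E as (A' & o' & E).
        destruct (Hu _ _ E) as [-> ->]; exists A, o; auto.
Qed.

Lemma wfc_fam Sg G : wfs Sg -> wfc Sg G -> Forall (fam (famc Sg) false) G.
Proof.
  intros Hs; induction 1; constructor; auto.
  apply ht_fam_gen in H0; auto using wfs_sorted.
  destruct H0 as [[_ H0]|H0]; easy.
Qed.

Lemma ht_fam Sg G t T : wfs Sg -> wfc Sg G -> ht Sg G t T ->
  match T with
  | None => fam (famc Sg) true t
  | Some A => fam (famc Sg) true A /\ fam (famc Sg) false t \/
              fam (famc Sg) false A
  end.
Proof.
  intros; apply ht_fam_gen with G; auto using wfs_sorted, wfc_fam.
Qed.

Lemma ht_type_fam Sg G A : wfs Sg -> wfc Sg G -> ht Sg G A (Some Typ) ->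
  fam (famc Sg) false A.
Proof.
  intros Hs Hw H; apply ht_fam in H; auto. destruct H as [[_ H]|H]; easy.
Qed.

Lemma ht_kind_fam Sg G A : wfs Sg -> wfc Sg G -> ht Sg G A None ->
  fam (famc Sg) true A.
Proof. intros Hs Hw H; apply ht_fam in H; auto. Qed.

Lemma cls_fam Sg G A : wfs Sg -> wfc Sg G -> cls Sg G A ->
  fam (famc Sg) true A \/ fam (famc Sg) false A.
Proof.
  intros Hs Hw (s & [-> | ->] & H); [left; eapply ht_kind_fam|right; eapply ht_type_fam];
    eauto.
Qed.

(** * Subject reduction for beta *)

Inductive red : expr -> expr -> Prop :=
| red_beta A b s : red (App (Lam A b) s) (inst s b)
| red_Pi1 A A' B : red A A' -> red (Pi A B) (Pi A' B)
| red_Pi2 A B B' : red B B' -> red (Pi A B) (Pi A B')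
| red_Lam1 A A' b : red A A' -> red (Lam A b) (Lam A' b)
| red_Lam2 A b b' : red b b' -> red (Lam A b) (Lam A b')
| red_App1 f f' s : red f f' -> red (App f s) (App f' s)
| red_App2 f s s' : red s s' -> red (App f s) (App f s').

Lemma red_conv Sg t u : red t u -> conv Sg t u.
Proof. intros H; induction H; auto with conv. Qed.

(** Eta is left out: its subject reduction rests on strengthening, which is itself derived from this
    lemma through weak head normal forms. *)
Lemma ht_red Sg G t T : wfs Sg -> ht Sg G t T -> wfc Sg G ->
  forall u, red t u -> ht Sg G u T.
Proof.
  intros Hs H; induction H; intros Hw u Hr; try solve [inversion Hr].
  - assert (wfc Sg (A :: G)) by (constructor; auto).
    inversion Hr; subst; apply ht_Pi; auto.
    eapply ht_ctx_conv with (A := A) (s := Some Typ); eauto using red_conv.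
  - assert (wfc Sg (A :: G)) by (constructor; auto).
    assert (cls Sg G (Pi A B)) by (exists s; auto using ht_Pi).
    inversion Hr; subst.
    + eapply ht_conv_cls with (A := Pi A' B); auto using red_conv, conv_sym with conv.
      eapply ht_Lam; eauto;
      eapply ht_ctx_conv with (A := A) (s := Some Typ); eauto using red_conv.
    + eapply ht_Lam; eauto.
  - assert (HC : cls Sg G (inst a B)).
    { eapply ht_valid; eauto. eapply ht_App; eauto. }
    inversion Hr; subst.
    + apply ht_Lam_inv in H as (B' & s & ? & ? & ? & ? & HP).
      apply conv_Pi_inj in HP as [HA HB]; auto.
      eapply ht_conv_cls with (A := inst a B'); auto.
      * eapply (ht_inst _ _ _ _ _ (Some B')); eauto.
        eapply ht_conv with (s := Some Typ); eauto with conv.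
      * apply conv_inst; eauto with conv.
    + eapply ht_App; eauto.
    + eapply ht_conv_cls with (A := inst s' B); auto.
      * eapply ht_App; eauto.
      * apply conv_inst; eauto using red_conv, conv_sym with conv.
  - eapply ht_conv; eauto.
Qed.

Inductive reds : expr -> expr -> Prop :=
| reds_refl t : reds t t
| reds_step t u v : red t u -> reds u v -> reds t v.

Lemma reds_trans t u v : reds t u -> reds u v -> reds t v.
Proof. intros H; induction H; eauto using reds_step. Qed.

Lemma reds_cong (F : expr -> expr -> expr) t t' u u' :
  (forall t t' u, red t t' -> red (F t u) (F t' u)) ->
  (forall t u u', red u u' -> red (F t u) (F t u')) ->
  reds t t' -> reds u u' -> reds (F t u) (F t' u').
Proof.
  intros H1 H2 Ht Hu; apply reds_trans with (F t' u).
  - induction Ht; eauto using reds_refl, reds_step.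
  - induction Hu; eauto using reds_refl, reds_step.
Qed.

Lemma ht_reds Sg G t u T : wfs Sg -> wfc Sg G -> reds t u -> ht Sg G t T ->
  ht Sg G u T.
Proof. intros Hs Hw H; induction H; eauto using ht_red. Qed.

Lemma reds_conv Sg t u : reds t u -> conv Sg t u.
Proof. intros H; induction H; eauto using red_conv with conv. Qed.

(** * Weak head normal forms of type families *)

(** Termination measure for weak head reduction of families, which makes strong normalisation
    dispensable. A delta step replaces a constant by a definiens of smaller depth, and a beta step
    removes an application and an abstraction; substitution leaves the depth alone, since the head
    of a family is no variable. *)
Fixpoint head_depth (h : name -> nat) (t : expr) : nat :=
  match t with
  | Con c => h c
  | App f _ => S (head_depth h f)
  | Lam _ b => S (head_depth h b)
  | _ => 0
  end.

Definition unf_depth : sign -> name -> nat :=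
  sig_rec (fun _ => 0) (fun k d =>
    match d with
    | (_, _, Some t) => S (head_depth k t)
    | (_, _, None) => 0
    end).

Lemma unf_depth_eq Sg c A t : wfs Sg -> In (c, A, Some t) Sg ->
  unf_depth Sg c = S (head_depth (unf_depth Sg) t).
Proof.
  intros Hs H; unfold unf_depth; rewrite (sig_rec_eq _ _ Sg c A (Some t)); auto.
  intros N k k' d A' o' Hk _ Ho; destruct o' as [t'|]; auto.
  specialize (Ho _ eq_refl); f_equal.
  clear - Hk Ho; induction t'; simpl in *; intuition auto.
Qed.

Lemma head_depth_subst P k h s t :
  fam P k t -> head_depth h (subst s t) = head_depth h t.
Proof.
  revert k s; induction t; simpl; intros; auto; try easy.
  - f_equal; eapply IHt2; apply H.
  - f_equal; eapply IHt1; apply H.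
Qed.

(** The bound on the depth of [N] lets the induction continue once the function part of an
    application has been reduced. *)
Lemma whnf Sg G F K : wfs Sg -> wfc Sg G ->
  ht Sg G F (Some K) -> fam (famc Sg) false F ->
  exists N, ht Sg G N (Some K) /\ conv Sg F N /\ fam (famc Sg) false N /\
    head_depth (unf_depth Sg) N <= head_depth (unf_depth Sg) F /\
    (neutral (primitive Sg) N \/ (exists A B, N = Pi A B) \/
     exists A b, N = Lam A b).
Proof.
  intros Hs Hw.
  remember (head_depth (unf_depth Sg) F) as n eqn:En.
  revert F K En; induction n as [n IH] using (well_founded_induction lt_wf).
  intros F K -> H HF; destruct F; simpl in HF; try easy.
  - pose proof H as H'.
    apply ht_Con_inv in H as (A & o & Hin & Hc). destruct o as [t|].
    + assert (Ht : ht Sg G t (Some K)).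
      { eapply ht_conv_cls; eauto using ht_valid.
        apply ht_weaken_nil; eauto using ht_In_def. }
      simpl in *; erewrite unf_depth_eq in * by eauto.
      assert (Hft : fam (famc Sg) false t).
      { pose proof (ht_In_def _ _ _ _ Hs Hin) as J.
        apply ht_fam in J; auto using wfc_nil. destruct J as [[_ J]|J]; auto.
        exfalso; destruct HF as (_ & A' & o' & Hin' & He).
        destruct (wfs_unique _ _ _ _ _ _ Hs Hin Hin') as [-> _].
        eapply fam_false_ends; eauto. }
      destruct (IH _ (Nat.lt_succ_diag_r _) t K eq_refl Ht Hft)
        as (N & ? & ? & ? & ? & ?).
      exists N; intuition auto; eauto with conv.
    + exists (Con n); simpl; intuition auto with conv. left; exists A; auto.
  - exists (Pi F1 F2); simpl; intuition eauto with conv.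
  - exists (Lam F1 F2); simpl; intuition eauto with conv.
  - pose proof H as H'.
    apply ht_App_inv in H as (A & B & Hf & Ha & Hc); simpl in IH.
    destruct (IH _ (Nat.lt_succ_diag_r _) F1 _ eq_refl Hf) as (N & HN & HcN & HfN & Hd & HN');
      [tauto|].
    assert (HA : ht Sg G (App N F2) (Some K)).
    { eapply ht_conv_cls; eauto using ht_valid. eapply ht_App; eauto. }
    destruct HN' as [HN'|[(A1 & B1 & ->)|(A1 & b & ->)]].
    + exists (App N F2); simpl; repeat split; auto with conv; lia.
    + exfalso; apply ht_Pi_inv in HN as (s & _ & _ & _ & _ & J).
      destruct (J _ eq_refl) as [_ E]. eapply conv_Typ_Pi; eauto.
    + assert (HI : ht Sg G (inst F2 b) (Some K)) by (eapply ht_red; eauto; constructor).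
      simpl in *.
      assert (E : head_depth (unf_depth Sg) (inst F2 b) = head_depth (unf_depth Sg) b)
        by (eapply head_depth_subst; apply HfN).
      destruct (IH (head_depth (unf_depth Sg) (inst F2 b))) with (F := inst F2 b) (K := K)
        as (N & ? & ? & ? & ? & ?); auto; [lia|now apply fam_subst|].
      exists N; intuition auto; try lia.
      all: eapply conv_trans; [|eassumption].
      all: apply conv_trans with (App (Lam A1 b) F2); auto with conv.
Qed.

(** In strengthening, the product [Pi A B] lives in the larger context only. The weak head normal
    form of [F] provides components in the smaller one. *)
Lemma cls_Pi_form Sg G F A B r : wfs Sg -> wfc Sg G -> cls Sg G F ->
  conv Sg (Pi A B) (ren r F) ->
  exists A1 B1, conv Sg F (Pi A1 B1) /\ cls Sg G (Pi A1 B1).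
Proof.
  intros Hs Hw (s & [-> | ->] & H) Hc.
  - pose proof H as H'.
    apply ht_None_inv in H as [->|(A1 & B1 & -> & ? & ?)].
    + exfalso; eapply conv_Pi_Typ; eauto.
    + exists A1, B1; split; auto with conv. exists None; auto.
  - destruct (whnf Sg G F Typ) as (N & HN & HcN & HfN & _ & HN'); auto.
    { eapply ht_type_fam; eauto. }
    destruct HN' as [HN'|[(A1 & B1 & ->)|(A1 & b & ->)]].
    + exfalso; apply (conv_Pi_neutral Sg A B (ren r N)); auto using neutral_ren.
      eapply conv_trans; [exact Hc|]; apply conv_ren; eauto.
    + exists A1, B1; split; auto. exists (Some Typ); auto.
    + apply ht_Lam_inv in HN as (? & ? & _ & _ & _ & _ & E).
      exfalso; eapply conv_Pi_Typ; eauto.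
Qed.

(** * Strengthening *)

(** Types are recovered only up to conversion, since those derived in the larger context may mention
    the dropped variables. The left inverse [l] of [r] carries conversions back to the smaller
    context. *)
Lemma strengthening Sg t : wfs Sg -> forall G G' r l T,
  ht Sg G (ren r t) T -> wfc Sg G' ->
  (forall i, l (r i) = i) ->
  (forall i A, nth_error G (r i) = Some A -> exists A',
     nth_error G' i = Some A' /\
     conv Sg (shift (S (r i)) A) (ren r (shift (S i) A'))) ->
  match T with
  | None => ht Sg G' t None
  | Some A => exists A', ht Sg G' t (Some A') /\ conv Sg A (ren r A')
  end.
Proof.
  intros Hs.
  assert (Rl : forall r l : nat -> nat, (forall i, l (r i) = i) -> forall a b,
    conv Sg (ren r a) (ren r b) -> conv Sg a b).
  { intros r l Hl a b H. apply (conv_ren _ l) in H; eauto.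
    rewrite !ren_ren in H.
    replace (fun i => l (r i)) with (fun i : nat => i) in H
      by (extensionality i; auto).
    now rewrite !ren_id in H. }
  assert (Sort : forall G G' r l t s, is_sort s ->
    (forall i, l (r i) = i) ->
    match s with
    | None => ht Sg G' t None
    | Some A => exists A', ht Sg G' t (Some A') /\ conv Sg A (ren r A')
    end -> ht Sg G (ren r t) s -> ht Sg G' t s).
  { intros G G' r l t0 s [-> | ->] Hl H _; auto.
    destruct H as (A' & H & Hc).
    apply ht_conv with A' None; auto; [|constructor].
    apply conv_sym, (Rl r l Hl); auto. }
  assert (Up : forall G G' r A, 
    (forall i A, nth_error G (r i) = Some A -> exists A',
      nth_error G' i = Some A' /\
      conv Sg (shift (S (r i)) A) (ren r (shift (S i) A'))) ->
    (forall i A1, nth_error (ren r A :: G) (up_ren r i) = Some A1 -> exists A',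
      nth_error (A :: G') i = Some A' /\
      conv Sg (shift (S (up_ren r i)) A1) (ren (up_ren r) (shift (S i) A')))).
  { intros G G' r A H [|i] A1 E; simpl in E.
    - injection E as <-. exists A; split; auto.
      simpl (up_ren r 0). rewrite ren_up_shift; apply conv_refl.
    - destruct (H _ _ E) as (A' & ? & Hc); exists A'; split; auto.
      replace (ren (up_ren r) (shift (S (S i)) A'))
        with (shift 1 (ren r (shift (S i) A')))
        by (rewrite <- ren_up_shift; f_equal; asub).
      replace (shift (S (up_ren r (S i))) A1) with (shift 1 (shift (S (r i)) A1))
        by asub.
      apply conv_ren; eauto. }
  assert (Upl : forall r l : nat -> nat, (forall i, l (r i) = i) ->
    forall i, up_ren l (up_ren r i) = i).
  { intros r l H [|i]; simpl; auto. }
  induction t; intros G G' r l T H Hw' Hl HG; simpl in H.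
  - destruct T; [exfalso; eapply ht_Typ_inv; eauto|constructor].
  - destruct T as [X|]; [|apply ht_None_inv in H as [?|(? & ? & ? & _)]; discriminate].
    apply ht_Con_inv in H as (A & o & Hin & Hc). exists A; split.
    + econstructor; eauto.
    + rewrite closed_ren by eauto. auto with conv.
  - destruct T as [X|]; [|apply ht_None_inv in H as [?|(? & ? & ? & _)]; discriminate].
    apply ht_Var_inv in H as (A & E & Hc).
    destruct (HG _ _ E) as (A' & E' & Hc').
    exists (shift (S n) A'); split; [now constructor|].
    eauto with conv.
  - apply ht_Pi_inv in H as (s & Hsort & HA & HB & H1 & H2).
    assert (HA' : ht Sg G' t1 (Some Typ)).
    { eapply (Sort G G' r l t1 (Some Typ)); eauto. eapply (IHt1 _ _ _ _ (Some Typ)); eauto. }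
    assert (HB' : ht Sg (t1 :: G') t2 s).
    { eapply (Sort (ren r t1 :: G) (t1 :: G') (up_ren r) (up_ren l)); eauto.
      eapply IHt2; eauto. constructor; auto. }
    destruct T as [X|].
    + destruct (H2 _ eq_refl) as [-> ?].
      exists Typ; split; [apply ht_Pi; auto|simpl; auto with conv].
    + rewrite (H1 eq_refl) in *. apply ht_Pi; auto.
  - destruct T as [X|]; [|apply ht_None_inv in H as [?|(? & ? & ? & _)]; discriminate].
    apply ht_Lam_inv in H as (B & s & Hsort & HA & Hb & HB & Hc).
    assert (HA' : ht Sg G' t1 (Some Typ)).
    { eapply (Sort G G' r l t1 (Some Typ)); eauto. eapply (IHt1 _ _ _ _ (Some Typ)); eauto. }
    assert (Hw1 : wfc Sg (t1 :: G')) by (constructor; auto).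
    destruct (IHt2 (ren r t1 :: G) (t1 :: G') (up_ren r) (up_ren l) (Some B))
      as (B' & Hb' & HcB); eauto.
    destruct (ht_valid _ _ _ _ Hs Hw1 Hb') as (s' & ? & ?).
    exists (Pi t1 B'); split; [eapply ht_Lam; eauto|].
    simpl; apply conv_trans with (Pi (ren r t1) B); auto with conv.
  - destruct T as [X|]; [|apply ht_None_inv in H as [?|(? & ? & ? & _)]; discriminate].
    apply ht_App_inv in H as (A & B & Hf & Ha & Hc).
    destruct (IHt1 _ _ _ _ _ Hf Hw' Hl HG) as (F & HF & HcF).
    destruct (IHt2 _ _ _ _ _ Ha Hw' Hl HG) as (A' & HA & HcA).
    destruct (cls_Pi_form Sg G' F A B r) as (A1 & B1 & HcF' & HC); eauto using ht_valid.
    assert (Hc1 : conv Sg (Pi A B) (ren r (Pi A1 B1))).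
    { eapply conv_trans; [exact HcF|]; apply conv_ren; eauto. }
    simpl in Hc1; apply conv_Pi_inj in Hc1 as [HcA1 HcB1]; auto.
    assert (HA1 : ht Sg G' A1 (Some Typ)).
    { destruct HC as (s & _ & HC); apply ht_Pi_inv in HC as (? & _ & ? & _); auto. }
    exists (inst t2 B1); split.
    + eapply ht_App; [eapply ht_conv_cls; eauto|].
      eapply ht_conv_cls; [exact HA| |exists (Some Typ); auto].
      apply (Rl r l Hl). eauto with conv.
    + apply conv_trans with (inst (ren r t2) B); auto with conv.
      rewrite ren_inst. apply conv_inst; eauto with conv.
Qed.

Lemma strengthen_shift Sg G A t T : wfs Sg -> wfc Sg G ->
  ht Sg (A :: G) (shift 1 t) (Some (shift 1 T)) -> cls Sg (A :: G) (shift 1 T) ->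
  ht Sg G t (Some T).
Proof.
  intros Hs Hw Ht HT.
  assert (C : forall i B, nth_error (A :: G) (1 + i) = Some B -> exists B',
     nth_error G i = Some B' /\
     conv Sg (shift (S (1 + i)) B) (ren (fun i => 1 + i) (shift (S i) B'))).
  { intros i B E; exists B; split; auto. asub. apply conv_refl. }
  assert (Rl : forall a b, conv Sg (shift 1 a) (shift 1 b) -> conv Sg a b).
  { intros a b H; apply (conv_subst1 _ (scons Typ Var)) in H; eauto.
    change (conv Sg (inst Typ (shift 1 a)) (inst Typ (shift 1 b))) in H.
    now rewrite !inst_shift in H. }
  destruct (strengthening Sg t Hs _ _ _ pred _ Ht Hw (fun i => eq_refl) C)
    as (T' & Ht' & Hc).
  apply ht_conv_cls with T'; auto; [apply Rl; auto with conv|].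
  destruct HT as (s & Hsort & HT); exists s; split; auto.
  pose proof (strengthening Sg T Hs _ _ _ pred _ HT Hw (fun i => eq_refl) C) as J.
  destruct Hsort as [-> | ->]; auto.
  destruct J as (T2 & J & Hc2). apply ht_conv with T2 None; auto; [|constructor].
  apply Rl; auto with conv.
Qed.

Lemma strengthen_shift_sort Sg G A t s : wfs Sg -> wfc Sg G -> is_sort s ->
  ht Sg (A :: G) (shift 1 t) s -> ht Sg G t s.
Proof.
  intros Hs Hw [-> | ->] H.
  - apply (strengthening Sg t Hs (A :: G) G S pred None); auto.
    intros i B E; exists B; split; auto. asub. apply conv_refl.
  - apply strengthen_shift with (A := A) (T := Typ); auto.
    exists None; split; auto; constructor.
Qed.

(** * Morphisms preserve typing *)

Lemma wfc_wf_ctx Sg G : wfc Sg G -> wf_ctx Sg G.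
Proof.
  induction 1; constructor; auto. apply (ht_typing _ _ _ _ H0); auto.
Qed.

Definition mor_ok (Sg Sg' : sign) (m : assignment) : Prop :=
  forall c A o, In (c, A, o) Sg ->
    ht Sg' [] (m c) (Some (hom m A)) /\
    forall t, o = Some t -> conv Sg' (m c) (hom m t).

Lemma morphism_ok Sg Sg' m : wfs Sg' -> morphism Sg Sg' m -> mor_ok Sg Sg' m.
Proof.
  intros Hs H c A o Hin; destruct (H _ _ _ Hin); split; auto using has_type_ht.
Qed.

Lemma ok_morphism Sg Sg' m : mor_ok Sg Sg' m -> morphism Sg Sg' m.
Proof.
  intros H c A o Hin; destruct (H _ _ _ Hin); split; auto using ht_nil_has_type.
Qed.

Lemma mor_ok_conv Sg Sg' m t u : closed_asg m -> mor_ok Sg Sg' m ->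
  conv Sg t u -> conv Sg' (hom m t) (hom m u).
Proof.
  intros Hm H; apply conv_hom; auto. intros; eapply H; eauto.
Qed.

Lemma typing_hom Sg Sg' m : wfs Sg' -> closed_asg m -> mor_ok Sg Sg' m ->
  (forall G, wf_ctx Sg G -> wfc Sg' (map (hom m) G)) /\
  (forall G K, is_kind Sg G K ->
     wfc Sg' (map (hom m) G) /\ ht Sg' (map (hom m) G) (hom m K) None) /\
  (forall G t A, has_type Sg G t A ->
     wfc Sg' (map (hom m) G) /\
     ht Sg' (map (hom m) G) (hom m t) (Some (hom m A))).
Proof.
  intros Hs Hm H; apply typing_mut; simpl; intros.
  - constructor.
  - constructor; tauto.
  - split; auto; constructor.
  - split; [tauto|]; apply ht_Pi; solve [auto|tauto].
  - split; auto; apply ht_weaken_nil; auto; eapply H; eauto.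
  - split; auto. rewrite hom_shift by easy; constructor.
    now apply map_nth_error.
  - split; [tauto|]; apply ht_Pi; solve [auto|tauto].
  - split; [tauto|].
    destruct (ht_valid Sg' (map (hom m) (A :: G)) (hom m b) (hom m B))
      as (s & ? & ?); simpl; try tauto.
    eapply ht_Lam; simpl in *; intuition eauto.
  - split; [tauto|]; rewrite hom_inst by easy; eapply ht_App; intuition eauto.
  - split; [tauto|]; apply ht_conv with (hom m A) (Some Typ); intuition auto.
    eapply mor_ok_conv; eauto.
  - split; [tauto|]; apply ht_conv with (hom m A) None; intuition auto.
    eapply mor_ok_conv; eauto.
Qed.

Lemma ht_hom Sg Sg' m G t T : wfs Sg' -> closed_asg m -> mor_ok Sg Sg' m ->
  wfc Sg G -> ht Sg G t T ->
  ht Sg' (map (hom m) G) (hom m t) (option_map (hom m) T).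
Proof.
  intros Hs Hm H Hw Ht.
  apply ht_typing in Ht; auto using wfc_wf_ctx.
  destruct T; now apply (typing_hom _ _ _ Hs Hm H) in Ht.
Qed.

Lemma ht_hom_nil Sg Sg' m t T : wfs Sg' -> closed_asg m -> mor_ok Sg Sg' m ->
  ht Sg [] t T -> ht Sg' [] (hom m t) (option_map (hom m) T).
Proof. intros; apply (ht_hom Sg Sg' m [] t T); auto; constructor. Qed.

Lemma cls_hom_nil Sg Sg' m A : wfs Sg' -> closed_asg m -> mor_ok Sg Sg' m ->
  cls Sg [] A -> cls Sg' [] (hom m A).
Proof.
  intros Hs Hm H (s & Hsort & HA); exists s; split; auto.
  rewrite <- (is_sort_map (hom m) s eq_refl Hsort).
  now apply ht_hom_nil with Sg.
Qed.

(** * Renaming and substitution in the relational translation *)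

Definition is_some {X} (o : option X) : bool :=
  match o with Some _ => true | None => false end.

Ltac cong :=
  repeat match goal with
  | |- Some _ = Some _ => f_equal
  | |- Pi _ _ = Pi _ _ => f_equal
  | |- Lam _ _ = Lam _ _ => f_equal
  | |- App _ _ = App _ _ => f_equal
  | |- at_ _ _ = at_ _ _ => f_equal
  end.

Definition closed_rel (r : relation) : Prop :=
  forall c p, r c = Some p -> closed p.

Definition nonvar (t : expr) : Prop := match t with Var _ => False | _ => True end.

Lemma ren_at rho R s : ren rho (at_ R s) = at_ (ren rho R) (ren rho s).
Proof. destruct R; simpl; auto. apply ren_inst. Qed.

(** A variable [R] might be replaced by an abstraction, which [at_] would then contract. *)
Lemma subst_at sigma R s : nonvar R ->
  subst sigma (at_ R s) = at_ (subst sigma R) (subst sigma s).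
Proof. destruct R; simpl; try easy. intros _; apply subst_inst. Qed.

Lemma shift_at k R s : shift k (at_ R s) = at_ (shift k R) (shift k s).
Proof. apply ren_at. Qed.

Lemma conv_at_App Sg R s : conv Sg (at_ R s) (App R s).
Proof. destruct R; simpl; auto with conv. Qed.

Lemma conv_at Sg R R' s s' : conv Sg R R' -> conv Sg s s' ->
  conv Sg (at_ R s) (at_ R' s').
Proof.
  intros HR Hs; eapply conv_trans; [apply conv_at_App|].
  eapply conv_trans; [|apply conv_sym, conv_at_App]. auto with conv.
Qed.

Lemma closed_nonvar t : closed t -> nonvar t.
Proof. intros H; destruct t; simpl; auto. specialize (H (fun _ => Typ)); discriminate. Qed.

(** Under [k] binders the shift moves exactly the indices from [k] on, so an expression that it
    fixes contains none of these. *)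
Lemma closed_ren_S t : ren S t = t -> closed t.
Proof.
  intros H s.
  assert (J : forall t k, ren (Nat.iter k up_ren S) t = t ->
                subst (Nat.iter k up s) t = t).
  { clear; induction t; intros k H; simpl in *; try injection H; intros; auto;
      try solve [rewrite ?IHt1, ?IHt2 by easy; f_equal;
                 first [apply (IHt2 (S k)) | apply (IHt1 (S k)) | idtac]; easy].
    clear H; revert n H0; induction k; intros n H; simpl in *; [lia|].
    destruct n; simpl in *; auto. rewrite IHk; auto. }
  now apply (J t 0).
Qed.

Definition up_env_ren (b : bool) (rho : nat -> nat) : nat -> nat :=
  if b then up_ren (up_ren rho) else up_ren rho.

Definition up_env (b : bool) (sigma : nat -> expr) : nat -> expr :=
  if b then up (up sigma) else up sigma.

Section Rel.
Variables (m : assignment) (r : relation).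
Hypotheses (Hm : closed_asg m) (Hr : closed_rel r).

(** [rho'] follows [rho] in the translated contexts, at [x] as well as at [x*], and the variables
    that have an [x*] are the same on both sides. *)
Definition env_ren (e2 : env) (rho rho' : nat -> nat) (e1 : env) : Prop :=
  (forall i, rho' (emb e1 i) = emb e2 (rho i)) /\
  (forall i, option_map rho' (star_var e1 i) = star_var e2 (rho i)).

Lemma env_ren_up e1 e2 rho rho' b : env_ren e2 rho rho' e1 ->
  env_ren (b :: e2) (up_ren rho) (up_env_ren b rho') (b :: e1).
Proof.
  intros [H1 H2]; split; intros [|i]; destruct b; simpl; auto.
  all: rewrite <- H2; now destruct (star_var e1 i).
Qed.

Lemma env_ren_shift e b : env_ren (b :: e) S (fun i => width b + i) e.
Proof. split; intros i; simpl; auto; now destruct (star_var e i). Qed.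

Lemma ren_emb e1 e2 rho rho' t : env_ren e2 rho rho' e1 ->
  ren (emb e2) (hom m (ren rho t)) = ren rho' (ren (emb e1) (hom m t)).
Proof.
  intros [H _]; rewrite hom_ren, !ren_ren by easy. f_equal.
  extensionality i; auto.
Qed.

Lemma rel_ren t : forall e1 e2 rho rho', env_ren e2 rho rho' e1 ->
  rel m r e2 (ren rho t) = option_map (ren rho') (rel m r e1 t).
Proof.
  induction t; intros e1 e2 rho rho' He; cbn [rel ren].
  - reflexivity.
  - destruct (r n) eqn:E; simpl; auto. now rewrite closed_ren by eauto.
  - destruct He as [_ H]; rewrite <- H; now destruct (star_var e1 n).
  - change (Pi (ren rho t1) (ren (up_ren rho) t2)) with (ren rho (Pi t1 t2)).
    rewrite (IHt1 _ _ _ _ He), !(ren_emb _ _ _ _ _ He).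
    destruct (rel m r e1 t1) as [rA|]; cbn [option_map].
    + rewrite (IHt2 _ _ _ _ (env_ren_up _ _ _ _ true He)).
      destruct (rel m r (true :: e1) t2) as [rB|]; cbn [option_map]; auto.
      cbn [ren]; rewrite !ren_at; cbn [up_env_ren]; cong; simpl; asub_ext.
    + rewrite (IHt2 _ _ _ _ (env_ren_up _ _ _ _ false He)).
      destruct (rel m r (false :: e1) t2) as [rB|]; cbn [option_map]; auto.
      cbn [ren]; rewrite !ren_at; cbn [up_env_ren]; cong; simpl; asub_ext.
  - rewrite (IHt1 _ _ _ _ He), !(ren_emb _ _ _ _ _ He).
    destruct (rel m r e1 t1) as [rA|]; cbn [option_map].
    + rewrite (IHt2 _ _ _ _ (env_ren_up _ _ _ _ true He)).
      destruct (rel m r (true :: e1) t2) as [rB|]; cbn [option_map]; auto.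
      cbn [ren]; rewrite !ren_at; cbn [up_env_ren]; cong; simpl; asub_ext.
    + rewrite (IHt2 _ _ _ _ (env_ren_up _ _ _ _ false He)).
      destruct (rel m r (false :: e1) t2) as [rB|]; cbn [option_map]; auto.
  - rewrite (IHt1 _ _ _ _ He), (IHt2 _ _ _ _ He), !(ren_emb _ _ _ _ _ He).
    destruct (rel m r e1 t1), (rel m r e1 t2); auto.
Qed.

(** Only type families, never variables, occur as components of products and as
    labels. *)
Fixpoint well_labelled (t : expr) : Prop :=
  match t with
  | Typ | Con _ | Var _ => True
  | Pi A B => nonvar A /\ nonvar B /\ well_labelled A /\ well_labelled B
  | Lam A b => nonvar A /\ well_labelled A /\ well_labelled b
  | App f s => well_labelled f /\ well_labelled s
  end.

Lemma rel_nonvar e t p : nonvar t -> rel m r e t = Some p -> nonvar p.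
Proof.
  destruct t; simpl; intros Ht H; try easy.
  - injection H as <-; easy.
  - eapply closed_nonvar; eauto.
  - destruct (rel m r e t1), (rel m r _ t2); try discriminate; injection H as <-; easy.
  - destruct (rel m r e t1), (rel m r _ t2); try discriminate; injection H as <-; easy.
  - destruct (rel m r e t1), (rel m r e t2); try discriminate; injection H as <-; easy.
Qed.

Definition env_sub (e2 : env) (sigma sigma' : nat -> expr) (e1 : env) : Prop :=
  (forall i, sigma' (emb e1 i) = ren (emb e2) (hom m (sigma i))) /\
  (forall i, rel m r e2 (sigma i) = option_map sigma' (star_var e1 i)).

Lemma env_sub_up e1 e2 sigma sigma' b : env_sub e2 sigma sigma' e1 ->
  env_sub (b :: e2) (up sigma) (up_env b sigma') (b :: e1).
Proof.
  intros [H1 H2]; split; intros [|i]; try (destruct b; simpl; easy).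
  - simpl (up sigma (S i)).
    change (shift 1 (sigma i)) with (ren S (sigma i)).
    rewrite (ren_emb e2 (b :: e2) S _ _ (env_ren_shift e2 b)), <- H1.
    destruct b; simpl; asub.
  - simpl (up sigma (S i)).
    change (shift 1 (sigma i)) with (ren S (sigma i)).
    rewrite (rel_ren _ _ _ _ _ (env_ren_shift e2 b)), H2.
    simpl; destruct (star_var e1 i); simpl; auto.
    destruct b; simpl; f_equal; asub.
Qed.

Lemma subst_emb e1 e2 sigma sigma' t : env_sub e2 sigma sigma' e1 ->
  ren (emb e2) (hom m (subst sigma t)) = subst sigma' (ren (emb e1) (hom m t)).
Proof.
  intros [H _]; rewrite hom_subst by easy; asub. f_equal.
  extensionality i; auto.
Qed.

Lemma rel_subst t : well_labelled t -> forall e1 e2 sigma sigma',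
  env_sub e2 sigma sigma' e1 ->
  rel m r e2 (subst sigma t) = option_map (subst sigma') (rel m r e1 t).
Proof.
  induction t; intros Ht e1 e2 sigma sigma' He; cbn [rel subst]; simpl in Ht.
  - reflexivity.
  - destruct (r n) eqn:E; simpl; auto. now rewrite (Hr _ _ E).
  - destruct He as [_ H]; rewrite H; now destruct (star_var e1 n).
  - destruct Ht as (HA & HB & Ht1 & Ht2).
    change (Pi (subst sigma t1) (subst (up sigma) t2)) with (subst sigma (Pi t1 t2)).
    rewrite (IHt1 Ht1 _ _ _ _ He), !(subst_emb _ _ _ _ _ He).
    destruct (rel m r e1 t1) as [rA|] eqn:EA; cbn [option_map].
    + rewrite (IHt2 Ht2 _ _ _ _ (env_sub_up _ _ _ _ true He)).
      destruct (rel m r (true :: e1) t2) as [rB|] eqn:EB; cbn [option_map]; auto.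
      apply rel_nonvar in EA; apply rel_nonvar in EB; auto.
      cbn [subst]; rewrite !subst_at by (destruct rA, rB; easy).
      cbn [up_env]; cong; simpl; asub_ext.
    + rewrite (IHt2 Ht2 _ _ _ _ (env_sub_up _ _ _ _ false He)).
      destruct (rel m r (false :: e1) t2) as [rB|] eqn:EB; cbn [option_map]; auto.
      apply rel_nonvar in EB; auto.
      cbn [subst]; rewrite !subst_at by (destruct rB; easy).
      cbn [up_env]; cong; simpl; asub_ext.
  - destruct Ht as (HA & Ht1 & Ht2).
    rewrite (IHt1 Ht1 _ _ _ _ He), !(subst_emb _ _ _ _ _ He).
    destruct (rel m r e1 t1) as [rA|] eqn:EA; cbn [option_map].
    + rewrite (IHt2 Ht2 _ _ _ _ (env_sub_up _ _ _ _ true He)).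
      destruct (rel m r (true :: e1) t2) as [rB|] eqn:EB; cbn [option_map]; auto.
      apply rel_nonvar in EA; auto.
      cbn [subst]; rewrite !subst_at by (destruct rA; easy).
      cbn [up_env]; cong; simpl; asub_ext.
    + rewrite (IHt2 Ht2 _ _ _ _ (env_sub_up _ _ _ _ false He)).
      destruct (rel m r (false :: e1) t2) as [rB|] eqn:EB; cbn [option_map]; auto.
  - destruct Ht as [Ht1 Ht2].
    rewrite (IHt1 Ht1 _ _ _ _ He), (IHt2 Ht2 _ _ _ _ He), !(subst_emb _ _ _ _ _ He).
    destruct (rel m r e1 t1), (rel m r e1 t2); auto.
Qed.

(** If there is an [x*], it has index 0, so the relation of [a] comes before its image. *)
Definition rel_inst_sub (e : env) (a : expr) : nat -> expr :=
  match rel m r e a with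
  | Some ra => scons ra (scons (ren (emb e) (hom m a)) Var)
  | None => scons (ren (emb e) (hom m a)) Var
  end.

Lemma rel_inst e a t : well_labelled t ->
  rel m r e (inst a t) =
  option_map (subst (rel_inst_sub e a)) (rel m r (is_some (rel m r e a) :: e) t).
Proof.
  intros Ht; apply rel_subst; auto. unfold rel_inst_sub.
  split; intros [|i]; destruct (rel m r e a) eqn:E; simpl; auto.
  - now destruct (star_var e i).
  - now destruct (star_var e i).
Qed.

Lemma closed_rel_nil t p : closed t -> rel m r [] t = Some p -> closed p.
Proof.
  intros Ht H; apply closed_ren_S.
  assert (E : rel m r [] (ren S t) = option_map (ren S) (rel m r [] t))
    by (apply rel_ren; split; easy).
  rewrite closed_ren, H in E by easy; simpl in E; congruence.
Qed.

Lemma rel_closed e t : closed t -> rel m r e t = rel m r [] t.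
Proof.
  (* Weakening past all of [e] does nothing to [t]; in the translated context the corresponding
     offset is the total width of [e]. *)
  intros Ht. rewrite <- (closed_ren t (fun i => i + length e)) at 1 by easy.
  rewrite (rel_ren t [] e (fun i => i + length e)
             (fun i => i + fold_right (fun b n => width b + n) 0 e)).
  - destruct (rel m r [] t) as [p|] eqn:E; simpl; auto.
    f_equal; apply closed_ren, (closed_rel_nil t); auto.
  - split; intros i; simpl.
    + induction e; simpl; [lia|]. rewrite Nat.add_succ_r; simpl; rewrite <- IHe; lia.
    + induction e; simpl; [easy|].
      rewrite Nat.add_succ_r; simpl; now rewrite <- IHe.
Qed.
End Rel.

(** * Erasure to simple types *)

(** [Base b] is the erasure of the atomic types on which the relation is
    defined ([b = true]), resp. undefined. *)
Inductive sty : Type :=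
| Base : bool -> sty
| Arr : sty -> sty -> sty.

Fixpoint defined (tau : sty) : bool :=
  match tau with Base b => b | Arr _ tau => defined tau end.

(** Arguments of families are forgotten, as they do not influence definedness. [Typ] becomes
    [Base true] because the translation of a kind is always defined; the value at a variable is a
    default, never reached at the head of a family. *)
Fixpoint er (base : name -> sty) (A : expr) : sty :=
  match A with
  | Typ => Base true
  | Con c => base c
  | Var _ => Base true
  | Pi A B => Arr (er base A) (er base B)
  | Lam _ b => er base b
  | App f _ => er base f
  end.

Lemma er_ren base rho A : er base (ren rho A) = er base A.
Proof. revert rho; induction A; simpl; intros; congruence. Qed.

Lemma er_subst P k base sigma A :
  fam P k A -> er base (subst sigma A) = er base A.
Proof.
  revert k sigma; induction A; simpl; intros; auto; try easy.
  - f_equal; [eapply IHA1|eapply IHA2]; apply H.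
  - eapply IHA2; apply H.
  - eapply IHA1; apply H.
Qed.

Lemma er_par P k base A B : par A B -> fam P k A -> er base A = er base B.
Proof.
  intros H; revert k; induction H; simpl; intros k Hf; auto.
  - f_equal; [eapply IHpar1|eapply IHpar2]; apply Hf.
  - eapply IHpar2; apply Hf.
  - eapply IHpar; apply Hf.
  - eapply IHpar1; apply Hf.
  - unfold inst; erewrite er_subst; [eapply IHpar1; apply Hf|].
    eapply fam_par; [eauto|apply Hf].
  - unfold shift; rewrite er_ren. eapply IHpar.
    rewrite <- (inst_shift Typ f). eapply fam_subst; apply Hf.
Qed.

Lemma er_pars P k base A B : pars A B -> fam P k A -> er base A = er base B.
Proof.
  intros H; induction H; intros Hf; auto.
  erewrite er_par by eauto. eauto using fam_par.
Qed.

Lemma er_hom P k base f A :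
  over (fun c => P c -> er base (f c) = base c) A -> fam P k A ->
  er base (hom f A) = er base A.
Proof.
  revert k; induction A; simpl; intros; auto; try easy.
  - apply H, H0.
  - f_equal; [eapply IHA1|eapply IHA2]; first [apply H|apply H0].
  - eapply IHA2; [apply H|apply H0].
  - eapply IHA1; [apply H|apply H0].
Qed.

(** A defined family is erased through its definiens, which makes delta steps preserve erasures. *)
Definition er_base (Sg : sign) (r : relation) : name -> sty :=
  sig_rec (fun _ => Base false) (fun k d =>
    match d with
    | (_, _, Some t) => er k t
    | (c, _, None) => Base (is_some (r c))
    end) Sg.

Lemma er_base_eq Sg r c A o : wfs Sg -> In (c, A, o) Sg ->
  er_base Sg r c =
  match o with Some t => er (er_base Sg r) t | None => Base (is_some (r c)) end.
Proof.
  intros Hs H; unfold er_base; rewrite (sig_rec_eq _ _ Sg c A o); auto.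
  intros N k k' d A' o' Hk _ Ho; destruct o' as [t|]; auto.
  specialize (Ho t eq_refl); clear - Hk Ho.
  induction t; simpl in *; auto;
    try match goal with |- Arr _ _ = _ => f_equal end; intuition auto.
Qed.

Definition rel_ok (Sg Sg' : sign) (m : assignment) (r : relation) : Prop :=
  forall c A o, In (c, A, o) Sg ->
    (forall p, r c = Some p ->
       exists rA, rel m r [] A = Some rA /\
         ht Sg' [] p (Some (at_ rA (m c)))) /\
    (forall t, o = Some t ->
       match r c, rel m r [] t with
       | Some p, Some q => conv Sg' p q
       | None, None => True
       | _, _ => False
       end).

Record lrel (Sg Sg' : sign) (m : assignment) (r : relation) : Prop := {
  lrel_src : wfs Sg;
  lrel_tgt : wfs Sg';
  lrel_mor_closed : closed_asg m;
  lrel_rel_closed : closed_rel r;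
  lrel_mor : mor_ok Sg Sg' m;
  lrel_rel : rel_ok Sg Sg' m r;
  lrel_total : forall c A o, In (c, A, o) Sg -> fam (famc Sg) false A ->
    rel m r [] A <> None -> r c <> None
}.

Section Definedness.
Variables (m : assignment) (r : relation).

(** Domains, labels and arguments decide only how many binders or arguments are produced; whether
    there is a result depends on the head constant alone. *)
Lemma rel_fam_defined P k base A :
  over (fun c => P c -> is_some (r c) = defined (base c)) A -> fam P k A ->
  forall e, is_some (rel m r e A) = defined (er base A).
Proof.
  revert k; induction A; simpl; intros k Ho Hf e; auto; try easy.
  - now apply Ho.
  - destruct (rel m r e A1).
    + rewrite <- (IHA2 k (proj2 Ho) (proj2 Hf) (true :: e)).
      now destruct (rel m r (true :: e) A2).
    + rewrite <- (IHA2 k (proj2 Ho) (proj2 Hf) (false :: e)).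
      now destruct (rel m r (false :: e) A2).
  - destruct (rel m r e A1).
    + rewrite <- (IHA2 false (proj2 Ho) (proj2 Hf) (true :: e)).
      now destruct (rel m r (true :: e) A2).
    + rewrite <- (IHA2 false (proj2 Ho) (proj2 Hf) (false :: e)).
      now destruct (rel m r (false :: e) A2).
  - rewrite <- (IHA1 false (proj1 Ho) (proj2 Hf) e).
    destruct (rel m r e A1), (rel m r e A2); auto.
Qed.
End Definedness.

Lemma fam_kind_sort Sg A : wfs Sg -> cls Sg [] A ->
  fam (famc Sg) true A \/ fam (famc Sg) false A /\ ht Sg [] A (Some Typ).
Proof.
  intros Hs (s & [-> | ->] & H).
  - left; eapply ht_kind_fam; eauto using wfc_nil.
  - right; split; auto; eapply ht_type_fam; eauto using wfc_nil.
Qed.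

Lemma fam_nonvar P k A : fam P k A -> nonvar A.
Proof. now destruct A. Qed.

Lemma ht_well_labelled Sg G t T : wfs Sg -> ht Sg G t T -> wfc Sg G ->
  well_labelled t.
Proof.
  intros Hs H; induction H; intros Hw; simpl; auto.
  - assert (Hw1 : wfc Sg (A :: G)) by (constructor; auto).
    assert (cls Sg (A :: G) B) as HB by (exists s; auto).
    repeat split; auto.
    + exact (fam_nonvar _ _ _ (ht_type_fam Sg G A Hs Hw H0)).
    + destruct (cls_fam _ _ _ Hs Hw1 HB); eapply fam_nonvar; eauto.
  - assert (Hw1 : wfc Sg (A :: G)) by (constructor; auto).
    repeat split; auto. exact (fam_nonvar _ _ _ (ht_type_fam Sg G A Hs Hw H0)).
Qed.

Lemma ctx_ren_comp G2 r2 G1 r1 G0 :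
  ctx_ren G2 r2 G1 -> ctx_ren G1 r1 G0 -> ctx_ren G2 (fun i => r2 (r1 i)) G0.
Proof.
  intros H2 H1 i A E. destruct (H1 _ _ E) as (A1 & E1 & J1).
  destruct (H2 _ _ E1) as (A2 & E2 & J2). exists A2; split; auto.
  now rewrite J2, J1, ren_ren.
Qed.

Lemma ctx_ren_id G : ctx_ren G (fun i => i) G.
Proof. intros i A E; exists A; split; auto. now rewrite ren_id. Qed.

Lemma ht_at Sg G R s X : ht Sg G R (Some (Pi X Typ)) -> ht Sg G s (Some X) ->
  wfs Sg -> ht Sg G (at_ R s) (Some Typ).
Proof.
  intros HR Hs W.
  destruct R; simpl; try (change Typ with (inst s Typ); eapply ht_App; eauto).
  apply ht_Lam_inv in HR as (B & k & ? & ? & ? & ? & Hc).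
  apply conv_Pi_inj in Hc as [Hc1 Hc2]; auto.
  apply ht_conv with (inst s B) None; auto; [| |constructor].
  - eapply (ht_inst _ _ _ _ _ (Some B)); eauto.
    eapply ht_conv with (s := Some Typ); eauto using conv_sym.
  - change Typ with (inst s Typ). apply conv_inst; eauto with conv.
Qed.

(** * Simple types and definedness for a fixed logical relation *)

Section Relation.
Variables (Sg Sg' : sign) (m : assignment) (r : relation).
Hypothesis L : lrel Sg Sg' m r.

#[local] Lemma src_wfs : wfs Sg.
Proof. apply L. Qed.
#[local] Lemma tgt_wfs : wfs Sg'.
Proof. apply L. Qed.
#[local] Lemma asg_closed : closed_asg m.
Proof. apply L. Qed.
#[local] Lemma asg_rel_closed : closed_rel r.
Proof. apply L. Qed.
#[local] Lemma asg_mor_ok : mor_ok Sg Sg' m.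
Proof. apply L. Qed.
#[local] Lemma asg_rel_ok : rel_ok Sg Sg' m r.
Proof. apply L. Qed.
#[local] Lemma asg_total : forall c A o, In (c, A, o) Sg -> fam (famc Sg) false A ->
  rel m r [] A <> None -> r c <> None.
Proof. apply L. Qed.
#[local] Hint Resolve src_wfs tgt_wfs asg_closed asg_rel_closed asg_mor_ok asg_rel_ok : core.

#[local] Notation P := (famc Sg).
#[local] Notation erb := (er (er_base Sg r)).

Lemma ht_def_fam c A t : In (c, A, Some t) Sg -> P c -> fam P false t.
Proof.
  intros Hin (A' & o & Hin' & He).
  destruct (wfs_unique _ _ _ _ _ _ src_wfs Hin Hin') as [-> _].
  pose proof (ht_In_def _ _ _ _ src_wfs Hin) as H.
  apply ht_fam in H; auto using wfc_nil. destruct H as [[_ H]|H]; auto.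
  exfalso; eapply fam_false_ends; eauto.
Qed.

(** Uses that equations of defined constants are preserved: a family and its definiens are either
    both related or both not. *)
Lemma famc_defined c : P c -> is_some (r c) = defined (er_base Sg r c).
Proof.
  intros Hc; assert (Hin : in_sig Sg c) by (destruct Hc as (A & o & ? & _); exists A, o; auto).
  revert c Hin Hc.
  apply (wfs_decl_ind Sg (fun c => P c -> is_some (r c) = defined (er_base Sg r c)) src_wfs).
  intros c A [t|] Hin _ Ho Hc; rewrite (er_base_eq _ _ _ _ _ src_wfs Hin); auto.
  specialize (Ho t eq_refl).
  rewrite <- (rel_fam_defined m r P false _ t Ho (ht_def_fam _ _ _ Hin Hc) []).
  destruct (asg_rel_ok _ _ _ Hin) as [_ J]; specialize (J t eq_refl).
  destruct (r c), (rel m r [] t); easy.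
Qed.

Lemma over_all (N : name -> Prop) t : (forall c, N c) -> over N t.
Proof. intros H; induction t; simpl; auto. Qed.

Lemma fam_defined k e A : fam P k A -> is_some (rel m r e A) = defined (erb A).
Proof.
  intros H; eapply rel_fam_defined with (P := P); eauto.
  apply over_all, famc_defined.
Qed.

Lemma er_base_unf c : P c -> erb (unf Sg c) = er_base Sg r c.
Proof.
  intros Hc; assert (Hin : in_sig Sg c) by (destruct Hc as (A & o & ? & _); exists A, o; auto).
  revert c Hin Hc.
  apply (wfs_decl_ind Sg (fun c => P c -> erb (unf Sg c) = er_base Sg r c) src_wfs).
  intros c A o Hin _ Ho Hc; erewrite (unf_eq _ _ _ _ src_wfs Hin); unfold erb.
  destruct o as [t|]; auto. rewrite (er_base_eq _ _ _ _ _ src_wfs Hin).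
  eapply er_hom; [apply Ho; auto|eapply ht_def_fam; eauto].
Qed.

Lemma er_unf k A : fam P k A -> erb (hom (unf Sg) A) = erb A.
Proof. intros H; eapply er_hom; eauto. apply over_all, er_base_unf. Qed.

Lemma fam_unf k A : fam P k A -> fam P k (hom (unf Sg) A).
Proof. apply fam_hom, (wfs_sorted _ src_wfs). Qed.

Lemma er_conv k A B : fam P k A -> fam P k B -> conv Sg A B -> erb A = erb B.
Proof.
  intros HA HB Hc; apply conv_unf in Hc as (v & H1 & H2); auto.
  rewrite <- (er_unf k A), <- (er_unf k B) by auto.
  transitivity (erb v); [|symmetry]; eapply er_pars; eauto using fam_unf.
Qed.

Lemma conv_fam_kind k k' A B : fam P k A -> fam P k' B -> conv Sg A B -> k = k'.
Proof.
  intros HA HB Hc; destruct k, k'; auto; exfalso.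
  - apply (conv_fam_excl Sg A B src_wfs (wfs_sorted _ src_wfs) HA HB Hc).
  - apply (conv_fam_excl Sg B A src_wfs (wfs_sorted _ src_wfs) HB HA), conv_sym, Hc.
Qed.

(** [stt Gamma t tau k]: simple typing, with [k = true] for type families. *)
Inductive stt : list sty -> expr -> sty -> bool -> Prop :=
| stt_Con Ga c A o k : In (c, A, o) Sg -> fam P k A -> stt Ga (Con c) (erb A) k
| stt_Var Ga i tau : nth_error Ga i = Some tau -> stt Ga (Var i) tau false
| stt_Pi Ga A B :
    fam P false A -> stt Ga A (Base true) true ->
    fam P false B -> stt (erb A :: Ga) B (Base true) true ->
    stt Ga (Pi A B) (Base true) true
| stt_Lam Ga A b tau k :
    fam P false A -> stt Ga A (Base true) true ->
    stt (erb A :: Ga) b tau k -> stt Ga (Lam A b) (Arr (erb A) tau) k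
| stt_App Ga f a sg tau k :
    stt Ga f (Arr sg tau) k -> stt Ga a sg false -> stt Ga (App f a) tau k.

Lemma fam_kind_unique k k' A : fam P k A -> fam P k' A -> k = k'.
Proof. intros; destruct k, k'; auto; exfalso; eapply fam_excl; eauto. Qed.

(** Dependency disappears because erasure is insensitive to instantiation, and the conversion rule
    because it is insensitive to conversion of classifiers. *)
Lemma ht_stt_gen G t T : ht Sg G t T -> wfc Sg G -> forall A, T = Some A ->
  exists k, fam P k A /\ stt (map erb G) t (erb A) k.
Proof.
  intros H; induction H; intros Hw A0 E; try discriminate.
  - injection E as <-.
    destruct (cls_fam Sg [] A) as [J|J]; auto using wfc_nil; [eapply cls_In; eauto| |];
      eexists; split; eauto; econstructor; eauto.
  - injection E as <-. exists false; split.
    + eapply ht_type_fam; eauto; eapply wfc_nth; eauto.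
    + constructor. rewrite (er_ren _ _ A : erb (shift (S i) A) = erb A).
      now apply map_nth_error.
  - destruct H as [->| ->]; [discriminate|]. injection E as <-.
    assert (Hw1 : wfc Sg (A :: G)) by (constructor; auto).
    destruct (IHht1 Hw _ eq_refl) as (k1 & E1 & S1); simpl in E1.
    destruct (IHht2 Hw1 _ eq_refl) as (k2 & E2 & S2); simpl in E2; subst.
    exists true; split; [reflexivity|].
    apply stt_Pi; auto; [now apply (ht_type_fam Sg G)|now apply (ht_type_fam Sg (A :: G))].
  - injection E as <-.
    assert (Hw1 : wfc Sg (A :: G)) by (constructor; auto).
    destruct (IHht1 Hw _ eq_refl) as (k1 & E1 & S1); simpl in E1; subst.
    destruct (IHht2 Hw1 _ eq_refl) as (k2 & E2 & S2).
    assert (fam P false A) by now apply (ht_type_fam Sg G).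
    exists k2; split; [simpl; auto|]. simpl; constructor; auto.
  - injection E as <-.
    destruct (IHht1 Hw _ eq_refl) as (k1 & [E1 E1'] & S1).
    destruct (IHht2 Hw _ eq_refl) as (k2 & E2 & S2).
    rewrite (fam_kind_unique _ _ _ E2 E1) in *.
    exists k1; split; [now apply fam_subst|].
    rewrite (er_subst P k1 _ _ B E1' : erb (inst a B) = erb B).
    econstructor; eauto.
  - injection E as <-.
    destruct (IHht1 Hw _ eq_refl) as (k1 & E1 & S1).
    assert (HB : exists k, fam P k B).
    { assert (HC : cls Sg G B) by (exists s; auto).
      destruct (cls_fam Sg G B src_wfs Hw HC); eauto. }
    destruct HB as (k & HB).
    assert (k1 = k) as -> by exact (conv_fam_kind _ _ _ _ E1 HB H1).
    exists k; split; auto. now rewrite <- (er_conv k A B E1 HB H1).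
Qed.

Lemma ht_stt G t A : wfc Sg G -> ht Sg G t (Some A) ->
  exists k, fam P k A /\ stt (map erb G) t (erb A) k.
Proof. intros; eapply ht_stt_gen; eauto. Qed.

Lemma ht_type_stt G A : wfc Sg G -> ht Sg G A (Some Typ) ->
  fam P false A /\ stt (map erb G) A (Base true) true.
Proof.
  intros Hw H; split; [eapply ht_type_fam; eauto|].
  destruct (ht_stt _ _ _ Hw H) as (k & E & S); simpl in E; subst; auto.
Qed.

(** One direction is part of being a logical relation, the other is term-totality. *)
Lemma con_defined c A o e : In (c, A, o) Sg -> fam P false A ->
  is_some (r c) = is_some (rel m r e A).
Proof.
  intros Hin HA.
  rewrite (rel_closed m r) by eauto.
  destruct (asg_rel_ok _ _ _ Hin) as [J _]; pose proof (asg_total _ _ _ Hin HA) as Ht.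
  destruct (r c) as [p|].
  - destruct (J p eq_refl) as (rA & -> & _); auto.
  - destruct (rel m r [] A); auto. exfalso; apply Ht; congruence.
Qed.

Lemma nth_star (Ga : list sty) i tau : nth_error Ga i = Some tau ->
  is_some (star_var (map defined Ga) i) = defined tau.
Proof.
  revert i; induction Ga; intros [|i] H; simpl in *; try discriminate.
  - injection H as ->; now destruct (defined tau).
  - rewrite <- (IHGa _ H); now destruct (star_var _ i).
Qed.

Lemma stt_fam Ga t tau : stt Ga t tau true -> fam P false t.
Proof.
  intros H; remember true as k eqn:E; revert E; induction H; simpl; intros; subst; auto;
    try discriminate.
  split; auto. exists A, o; split; auto; eapply fam_true_ends; eauto.
Qed.

(** Restricted to terms: a kind always has a translation and so says nothing about the relation on
    its families, for which [fam_defined] is used. *)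
Lemma stt_defined Ga t tau : stt Ga t tau false ->
  is_some (rel m r (map defined Ga) t) = defined tau.
Proof.
  intros H; remember false as k eqn:E; revert E; induction H; intros; subst;
    try discriminate; cbn [rel].
  - rewrite (con_defined c A o (map defined Ga)) by auto.
    now apply fam_defined with false.
  - rewrite <- (nth_star _ _ _ H); now destruct (star_var _ i).
  - specialize (IHstt2 eq_refl); simpl in IHstt2; simpl.
    rewrite <- IHstt2, <- (fam_defined false (map defined Ga) A H).
    destruct (rel m r (map defined Ga) A); simpl.
    + now destruct (rel m r (true :: _) b).
    + now destruct (rel m r (false :: _) b).
  - specialize (IHstt1 eq_refl); simpl in IHstt1; rewrite <- IHstt1.
    destruct (rel m r (map defined Ga) f), (rel m r (map defined Ga) a); auto.
Qed.

(** * A label-free total variant of the translation *)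

(** Every variable [x] is accompanied by [x*] in the context of [tot t]; the
    indices of both are [S (twice i)] and [twice i]. *)
Fixpoint twice (i : nat) : nat := match i with 0 => 0 | S j => S (S (twice j)) end.

(** Inserts, resp. removes, the arguments that are related to arguments of
    types on which the relation is undefined. *)
Fixpoint pad (insert : bool) (tau : sty) (t : expr) : expr :=
  match tau with
  | Base _ => t
  | Arr sg tau =>
      if defined sg then
        Lam Typ (Lam Typ (pad insert tau
          (App (App (shift 2 t) (Var 1)) (pad (negb insert) sg (Var 0)))))
      else if insert then
        Lam Typ (Lam Typ (pad insert tau (App (shift 2 t) (Var 1))))
      else
        Lam Typ (pad insert tau (App (App (shift 1 t) (Var 0)) Typ))
  end.

Lemma pad_subst tau : forall b s t,
  subst s (pad b tau t) = pad b tau (subst s t).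
Proof.
  induction tau as [d|sg IH1 tau IH2]; intros b s t; simpl; auto.
  destruct (defined sg); [|destruct b]; simpl; rewrite ?IH2; simpl; rewrite ?IH1; simpl;
    repeat f_equal; asub_ext.
Qed.

Lemma pad_ren tau b rho t : ren rho (pad b tau t) = pad b tau (ren rho t).
Proof. rewrite !ren_as_subst; apply pad_subst. Qed.

Lemma pad_conv tau : forall b t u,
  conv Sg' t u -> conv Sg' (pad b tau t) (pad b tau u).
Proof.
  induction tau as [d|sg IH1 tau IH2]; intros b t u H; simpl; auto.
  assert (forall k, conv Sg' (shift k t) (shift k u)) by (intros; apply conv_ren; eauto).
  destruct (defined sg); [|destruct b]; auto 8 with conv.
Qed.

(** [Typ] is the dummy for a missing relation. *)
Definition ctot (c : name) : expr :=
  match lookup c Sg, r c with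
  | Some A, Some p => pad true (erb A) p
  | _, _ => Typ
  end.

Lemma ctot_closed : closed_asg ctot.
Proof.
  intros c s; unfold ctot; destruct (lookup c Sg); auto.
  destruct (r c) eqn:E; auto. rewrite pad_subst; f_equal. eapply asg_rel_closed; eauto.
Qed.

Fixpoint tot (t : expr) : expr :=
  match t with
  | Typ => Typ
  | Con c => ctot c
  | Var i => Var (twice i)
  | Pi A B =>
      let mA := ren (fun i => S (twice i)) (hom m A) in
      if defined (erb A) then
        Lam Typ (Pi (shift 1 mA) (Pi (App (shift 2 (tot A)) (Var 0))
          (App (subst (scons (pad true (erb A) (Var 0))
                  (fun i => Var (S (up_ren S i)))) (tot B))
             (App (Var 2) (Var 1)))))
      else
        Lam Typ (Pi (shift 1 mA)
          (App (subst (scons Typ (fun i => Var (up_ren S i))) (tot B))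
             (App (Var 1) (Var 0))))
  | Lam _ b => Lam Typ (Lam Typ (tot b))
  | App f s => App (App (tot f) (ren (fun i => S (twice i)) (hom m s))) (tot s)
  end.

(** The only case distinction of [tot] is on the erasure of the domain of a product; requiring that
    domain to be a family keeps the outcome stable under substitution and reduction. *)
Fixpoint clean (t : expr) : Prop :=
  match t with
  | Typ | Con _ | Var _ => True
  | Pi A B => fam P false A /\ clean A /\ clean B
  | Lam _ b => clean b
  | App f s => clean f /\ clean s
  end.

Lemma clean_ren rho t : clean t -> clean (ren rho t).
Proof.
  revert rho; induction t; simpl; intros; intuition auto using fam_ren.
Qed.

Lemma clean_subst sigma t :
  clean t -> (forall i, clean (sigma i)) -> clean (subst sigma t).
Proof.
  revert sigma; induction t; simpl; intros sigma Ht Hsg; intuition auto using fam_subst.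
  - apply IHt2; auto. intros [|i]; simpl; auto. now apply clean_ren.
  - apply IHt2; auto. intros [|i]; simpl; auto. now apply clean_ren.
Qed.

Lemma clean_hom f t :
  (forall c, P c -> fam P false (f c)) ->
  over (fun c => clean (f c)) t -> clean t -> clean (hom f t).
Proof.
  intros Hf; induction t; simpl; intros; intuition auto using fam_hom.
Qed.

Lemma tot_ren t : forall rho rho',
  (forall i, rho' (twice i) = twice (rho i)) ->
  (forall i, rho' (S (twice i)) = S (twice (rho i))) ->
  tot (ren rho t) = ren rho' (tot t).
Proof.
  assert (M : forall t rho rho', (forall i, rho' (S (twice i)) = S (twice (rho i))) ->
    ren (fun i => S (twice i)) (hom m (ren rho t)) =
    ren rho' (ren (fun i => S (twice i)) (hom m t))).
  { intros t0 rho rho' H; rewrite hom_ren, !ren_ren by auto. f_equal.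
    extensionality i; auto. }
  induction t; intros rho rho' H1 H2; cbn [tot ren].
  - reflexivity.
  - symmetry; apply closed_ren, ctot_closed.
  - simpl; now rewrite H1.
  - rewrite er_ren, (M _ _ _ H2), (IHt1 _ _ H1 H2),
      (IHt2 (up_ren rho) (up_ren (up_ren rho')))
      by (intros [|i]; simpl; rewrite ?H1, ?H2; auto).
    destruct (defined _); cbn [ren]; cong; simpl; asub_ext;
      now rewrite ?pad_ren, ?pad_subst, ?ren_as_subst.
  - rewrite (IHt2 (up_ren rho) (up_ren (up_ren rho')))
      by (intros [|i]; simpl; rewrite ?H1, ?H2; auto).
    reflexivity.
  - rewrite (M _ _ _ H2), (IHt1 _ _ H1 H2), (IHt2 _ _ H1 H2); reflexivity.
Qed.

(** In contrast to [env_sub], nothing is asked about which expressions are related, since every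
    variable has a partner. This is what makes [tot] usable on ill-typed expressions. *)
Lemma tot_subst t : clean t -> forall sigma sigma',
  (forall i, sigma' (twice i) = tot (sigma i)) ->
  (forall i, sigma' (S (twice i)) = ren (fun i => S (twice i)) (hom m (sigma i))) ->
  tot (subst sigma t) = subst sigma' (tot t).
Proof.
  assert (M : forall t sigma sigma',
    (forall i, sigma' (S (twice i)) = ren (fun i => S (twice i)) (hom m (sigma i))) ->
    ren (fun i => S (twice i)) (hom m (subst sigma t)) =
    subst sigma' (ren (fun i => S (twice i)) (hom m t))).
  { intros t0 sigma sigma' H; rewrite hom_subst by auto; asub. f_equal.
    extensionality i; auto. }
  assert (U : forall sigma sigma',
    (forall i, sigma' (twice i) = tot (sigma i)) ->
    (forall i, sigma' (S (twice i)) = ren (fun i => S (twice i)) (hom m (sigma i))) ->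
    (forall i, up (up sigma') (twice i) = tot (up sigma i)) /\
    (forall i, up (up sigma') (S (twice i)) =
       ren (fun i => S (twice i)) (hom m (up sigma i)))).
  { intros sigma sigma' H1 H2; split; intros [|i]; simpl; auto.
    - unfold shift at 3. rewrite (tot_ren _ _ (fun i => S (S i))), H1 by auto. asub.
    - rewrite H2, hom_shift by auto. asub. }
  induction t; intros Ht sigma sigma' H1 H2; cbn [tot subst].
  - reflexivity.
  - symmetry; apply ctot_closed.
  - simpl; now rewrite H1.
  - destruct Ht as (HA & Ht1 & Ht2), (U _ _ H1 H2) as [U1 U2].
    rewrite (er_subst _ _ _ _ _ HA), (M _ _ _ H2), (IHt1 Ht1 _ _ H1 H2),
      (IHt2 Ht2 _ _ U1 U2).
    destruct (defined _); cbn [subst]; cong; simpl; asub_ext;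
      now rewrite ?pad_ren, ?pad_subst, ?ren_as_subst.
  - destruct (U _ _ H1 H2) as [U1 U2].
    now rewrite (IHt2 Ht _ _ U1 U2).
  - rewrite (M _ _ _ H2), (IHt1 (proj1 Ht) _ _ H1 H2), (IHt2 (proj2 Ht) _ _ H1 H2).
    reflexivity.
Qed.

Lemma tot_closed t : clean t -> closed t -> closed (tot t).
Proof.
  intros Hc Ht; apply closed_Typ_subst.
  rewrite <- (tot_subst t Hc (fun _ => Typ)) by auto. now rewrite Ht.
Qed.

Lemma conv_beta2 S X Y b u v :
  conv S (App (App (Lam X (Lam Y b)) u) v) (subst (scons v (scons u Var)) b).
Proof.
  eapply conv_trans; [apply conv_App; [apply conv_beta|apply conv_refl]|].
  unfold inst at 1; simpl. eapply conv_trans; [apply conv_beta|].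
  replace (inst v _) with (subst (scons v (scons u Var)) b); auto with conv.
  asub_ext.
Qed.

Lemma tot_par t u : par t u -> clean t -> clean u /\ conv Sg' (tot t) (tot u).
Proof.
  assert (M : forall t u, par t u -> conv Sg' (ren (fun i => S (twice i)) (hom m t))
                (ren (fun i => S (twice i)) (hom m u))).
  { intros t0 u0 H; apply conv_ren; eauto. apply (conv_hom [] Sg'); auto; try easy.
    now apply par_conv. }
  assert (Hd := wfs_closed_def _ tgt_wfs).
  induction 1; simpl; intros Hc; auto with conv.
  - destruct Hc as (HA & HA' & HB).
    destruct (IHpar1 HA'), (IHpar2 HB).
    split; [eauto using fam_par|].
    rewrite <- (er_par _ _ _ _ _ H HA).
    destruct (defined _); apply conv_Lam; repeat apply conv_Pi; try apply conv_App;
      auto using conv_ren, conv_subst1 with conv.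
    + apply conv_ren; auto.
    + apply conv_ren; auto.
    + apply conv_ren; auto.
  - destruct (IHpar2 Hc); auto with conv.
  - destruct (IHpar Hc); auto with conv.
  - destruct (IHpar1 (proj1 Hc)), (IHpar2 (proj2 Hc)); auto with conv.
  - destruct (IHpar1 (proj1 Hc)), (IHpar2 (proj2 Hc)); split.
    + apply clean_subst; auto. intros [|i]; simpl; auto.
    + eapply conv_trans; [apply conv_beta2|].
      unfold inst; rewrite (tot_subst b' ltac:(auto) _
        (scons (tot s') (scons (ren (fun i => S (twice i)) (hom m s')) Var)))
        by (intros [|i]; simpl; auto).
      apply conv_subst; auto. intros [|[|i]]; simpl; auto with conv.
  - assert (Hf : clean f).
    { rewrite <- (inst_shift Typ f). apply clean_subst; [apply Hc|].
      intros [|i]; simpl; auto. }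
    destruct (IHpar Hf) as [Hf' Hc']; split; auto.
    apply conv_trans with (tot f); auto.
    (* One eta step becomes two, for [x] and for [x*]. *)
    unfold shift; rewrite (tot_ren _ _ (fun i => S (S i))) by auto.
    eapply conv_trans; [|apply (conv_eta Sg' Typ)]. apply conv_Lam.
    eapply conv_trans; [|apply (conv_eta Sg' Typ)]. apply conv_Lam.
    replace (shift 1 (App (shift 1 (tot f)) (Var 0)))
      with (App (ren (fun i => S (S i)) (tot f)) (Var 1))
      by (unfold shift; cbn [ren]; now rewrite ren_ren).
    apply conv_refl.
Qed.

Lemma tot_pars t u : pars t u -> clean t -> conv Sg' (tot t) (tot u).
Proof.
  induction 1; intros Hc; [apply conv_refl|].
  destruct (tot_par _ _ H Hc); eauto with conv.
Qed.

(** * The logical relation between [tot t] and the translation of [t] *)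

(** A Kripke logical relation: [rho] makes it stable under weakening. Where the argument type
    carries no relation, the total side [X] receives an arbitrary [a], and its result must not
    depend on it. *)
Fixpoint LR (tau : sty) (X Y : expr) : Prop :=
  match tau with
  | Base _ => conv Sg' X Y
  | Arr sg tau => forall rho x,
      if defined sg then
        forall a b, LR sg a b ->
          LR tau (App (App (ren rho X) x) a) (App (App (ren rho Y) x) b)
      else
        forall a, LR tau (App (App (ren rho X) x) a) (App (ren rho Y) x)
  end.

Lemma LR_conv tau : forall X X' Y Y', conv Sg' X X' -> conv Sg' Y Y' ->
  LR tau X Y -> LR tau X' Y'.
Proof.
  assert (Hd := wfs_closed_def _ tgt_wfs).
  induction tau as [d|sg _ tau IH]; intros X X' Y Y' HX HY H; simpl in *.
  - eauto with conv.
  - intros rho x; specialize (H rho x); destruct (defined sg).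
    + intros a b Hab; eapply IH; [| |apply H, Hab]; auto using conv_ren with conv.
    + intros a; eapply IH; [| |apply (H a)]; auto using conv_ren with conv.
Qed.

Lemma LR_ren tau X Y rho : LR tau X Y -> LR tau (ren rho X) (ren rho Y).
Proof.
  destruct tau as [d|sg tau]; simpl; intros H.
  - apply conv_ren; eauto.
  - intros rho' x; rewrite !ren_ren; apply H.
Qed.

(** The two halves are the reflection and reification of normalisation by evaluation. They are
    proved together, because each uses the other at the domain of an arrow. *)
Lemma LR_pad tau :
  (forall Y, LR tau (pad true tau Y) Y) /\
  (forall X Y, LR tau X Y -> conv Sg' Y (pad false tau X)).
Proof.
  assert (Hd := wfs_closed_def _ tgt_wfs).
  induction tau as [d|sg [IHs1 IHs2] tau [IH1 IH2]]; simpl; split; intros.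
  - apply conv_refl.
  - now apply conv_sym.
  - destruct (defined sg).
    + intros a b Hab. eapply LR_conv; [apply conv_sym| |apply IH1].
      * simpl; rewrite pad_ren. simpl. rewrite pad_ren; simpl.
        eapply conv_trans; [apply conv_beta2|].
        rewrite pad_subst; simpl; rewrite pad_subst; simpl.
        apply pad_conv, conv_App; [apply conv_refl|].
        apply conv_sym, IHs2, Hab.
      * apply conv_App; [|apply conv_refl]; apply conv_App; [|apply conv_refl].
        replace (subst _ _) with (ren rho Y); [apply conv_refl|asub_ext].
    + intros a. eapply LR_conv; [apply conv_sym| |apply IH1].
      * simpl; rewrite pad_ren; simpl.
        eapply conv_trans; [apply conv_beta2|].
        rewrite pad_subst; simpl. apply conv_refl.
      * apply conv_App; [|apply conv_refl].
        replace (subst _ _) with (ren rho Y); [apply conv_refl|asub_ext].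
  - destruct (defined sg).
    + eapply conv_trans; [apply conv_sym, (conv_eta Sg' Typ)|]. apply conv_Lam.
      eapply conv_trans; [apply conv_sym, (conv_eta Sg' Typ)|]. apply conv_Lam.
      replace (shift 1 (App (shift 1 Y) (Var 0))) with (App (shift 2 Y) (Var 1))
        by (unfold shift; cbn [ren]; now rewrite ren_ren).
      apply IH2, H, IHs1.
    + eapply conv_trans; [apply conv_sym, (conv_eta Sg' Typ)|]. apply conv_Lam.
      apply IH2, H.
Qed.

Lemma hom_unf_mor t : conv Sg' (hom m (hom (unf Sg) t)) (hom m t).
Proof.
  apply (mor_ok_conv Sg Sg'); auto. apply conv_sym, hom_unf_conv; auto.
Qed.

Definition sub_rel (Ga : list sty) (theta theta' : nat -> expr) : Prop :=
  let e := map defined Ga in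
  (forall i, conv Sg' (theta (S (twice i))) (theta' (emb e i))) /\
  (forall i tau k, nth_error Ga i = Some tau -> star_var e i = Some k ->
     LR tau (theta (twice i)) (theta' k)).

Lemma sub_rel_up Ga tau theta theta' rho x a b :
  sub_rel Ga theta theta' ->
  (if defined tau then LR tau a b else True) ->
  sub_rel (tau :: Ga) (scons a (scons x (fun i => ren rho (theta i))))
    (if defined tau then scons b (scons x (fun i => ren rho (theta' i)))
     else scons x (fun i => ren rho (theta' i))).
Proof.
  assert (Hd := wfs_closed_def _ tgt_wfs).
  intros [H1 H2] Hab; split; simpl.
  - intros [|i]; simpl; destruct (defined tau); simpl; auto using conv_ren with conv.
  - intros [|i] tau' k Ht Hk; simpl in *.
    + injection Ht as <-; destruct (defined tau); [|discriminate].
      now injection Hk as <-.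
    + destruct (star_var (map defined Ga) i) eqn:E; [|discriminate].
      injection Hk as <-. destruct (defined tau); simpl; apply LR_ren; eauto.
Qed.

(** The assumption on the constants is left open, because [LR_con] establishes it by induction over
    the declarations, applying this lemma to definientia. *)
Lemma LR_fundamental Ga t tau k :
  stt Ga t tau k ->
  over (fun c => forall A o p, In (c, A, o) Sg -> r c = Some p ->
          LR (erb A) (tot (unf Sg c)) p /\ clean (unf Sg c)) t ->
  forall theta theta' p, sub_rel Ga theta theta' ->
  rel m r (map defined Ga) t = Some p ->
  LR tau (subst theta (tot (hom (unf Sg) t))) (subst theta' p).
Proof.
  assert (Hd := wfs_closed_def _ tgt_wfs).
  assert (Em : forall Ga t theta theta', sub_rel Ga theta theta' ->
    conv Sg' (subst theta (ren (fun i => S (twice i)) (hom m (hom (unf Sg) t))))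
      (subst theta' (ren (emb (map defined Ga)) (hom m t)))).
  { intros Ga0 t0 theta theta' [H _]; asub. apply conv_subst; auto.
    apply hom_unf_mor. }
  induction 1; intros Ho theta theta' p Hth E; cbn [rel] in E.
  - destruct (Ho _ _ _ H E) as [J Hc]. simpl.
    rewrite (tot_closed _ Hc (unf_closed _ src_wfs c)), (asg_rel_closed _ _ E). exact J.
  - simpl. destruct (star_var _ i) eqn:Ek; [|discriminate].
    injection E as <-. eapply Hth; eauto.
  - destruct Ho as [Ho1 Ho2].
    pose proof (fam_defined false (map defined Ga) A H) as DA.
    assert (EA : erb (hom (unf Sg) A) = erb A) by (eapply er_unf; eauto).
    cbn [hom tot]; rewrite EA. simpl map in IHstt2.
    destruct (rel m r (map defined Ga) A) as [rA|] eqn:RA; simpl in DA;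
      rewrite <- DA in *.
    + destruct (rel m r (true :: _) B) as [rB|] eqn:RB; [|discriminate].
      injection E as <-. cbn [LR subst]. apply conv_Lam, conv_Pi; [|apply conv_Pi].
      * rewrite !subst_up_shift. apply conv_ren; auto.
      * eapply conv_trans; [|apply conv_sym, conv_subst1, conv_at_App; auto].
        cbn [subst]; apply conv_App; [|apply conv_refl].
        replace (subst (up (up theta)) (shift 2 (tot (hom (unf Sg) A))))
          with (shift 2 (subst theta (tot (hom (unf Sg) A)))) by asub_ext.
        replace (subst (up (up theta')) (shift 2 rA))
          with (shift 2 (subst theta' rA)) by asub_ext.
        apply conv_ren; auto. apply IHstt1; auto.
      * eapply conv_trans; [|apply conv_sym, conv_subst1, conv_at_App; auto].
        cbn [subst]; apply conv_App; [|apply conv_refl].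
        (* In a product [tot] binds [x*] in its original form and hands its padding to the codomain;
           [LR_pad] relates the two. *)
        pose proof (sub_rel_up Ga (erb A) theta theta' (fun i => 3 + i) (Var 1)
          (pad true (erb A) (Var 0)) (Var 0) Hth) as Hup.
        rewrite <- DA in Hup.
        specialize (IHstt2 Ho2 _ _ rB (Hup (proj1 (LR_pad _) _)) eq_refl).
        cbn [LR] in IHstt2. eapply conv_trans; [|eapply conv_trans; [exact IHstt2|]].
        -- asub. match goal with |- conv _ (subst ?f _) (subst ?g _) =>
             replace g with f; [apply conv_refl|] end.
           extensionality i; destruct i as [|[|i]]; simpl; rewrite ?pad_subst; auto.
           asub.
        -- replace (subst _ (ren (up_ren (up_ren S)) rB)) with
             (subst (scons (Var 0) (scons (Var 1) (fun i => ren (fun i => 3 + i) (theta' i)))) rB);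
             [apply conv_refl|asub_ext].
    + destruct (rel m r (false :: _) B) as [rB|] eqn:RB; [|discriminate].
      injection E as <-. cbn [LR subst]. apply conv_Lam, conv_Pi.
      * rewrite !subst_up_shift. apply conv_ren; auto.
      * eapply conv_trans; [|apply conv_sym, conv_subst1, conv_at_App; auto].
        cbn [subst]; apply conv_App; [|apply conv_refl].
        pose proof (sub_rel_up Ga (erb A) theta theta' (fun i => 2 + i) (Var 0)
          Typ (Var 0) Hth) as Hup.
        rewrite <- DA in Hup.
        specialize (IHstt2 Ho2 _ _ rB (Hup I) eq_refl).
        cbn [LR] in IHstt2. eapply conv_trans; [|eapply conv_trans; [exact IHstt2|]].
        -- asub. match goal with |- conv _ (subst ?f _) (subst ?g _) =>
             replace g with f; [apply conv_refl|] end.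
           extensionality i; destruct i as [|[|i]]; simpl; auto. asub.
        -- replace (subst _ (ren (up_ren S) rB)) with
             (subst (scons (Var 0) (fun i => ren (fun i => 2 + i) (theta' i))) rB);
             [apply conv_refl|asub_ext].
  - destruct Ho as [Ho1 Ho2].
    pose proof (fam_defined false (map defined Ga) A H) as DA.
    cbn [hom tot LR]; simpl map in IHstt2. intros rho x.
    destruct (rel m r (map defined Ga) A) as [rA|] eqn:RA; simpl in DA;
      rewrite <- DA in *.
    + destruct (rel m r (true :: _) b) as [rb|] eqn:RB; [|discriminate].
      injection E as <-. intros a b0 Hab.
      pose proof (sub_rel_up Ga (erb A) theta theta' rho x a b0 Hth) as Hup.
      rewrite <- DA in Hup.
      eapply LR_conv; [| |exact (IHstt2 Ho2 _ _ rb (Hup Hab) eq_refl)].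
      * apply conv_sym. cbn [subst ren].
        eapply conv_trans; [apply conv_beta2|].
        match goal with |- conv _ ?X ?Y => replace X with Y; [apply conv_refl|] end.
        asub_ext.
      * apply conv_sym. cbn [subst ren].
        eapply conv_trans; [apply conv_beta2|].
        match goal with |- conv _ ?X ?Y => replace X with Y; [apply conv_refl|] end.
        asub_ext.
    + destruct (rel m r (false :: _) b) as [rb|] eqn:RB; [|discriminate].
      injection E as <-. intros a.
      pose proof (sub_rel_up Ga (erb A) theta theta' rho x a Typ Hth) as Hup.
      rewrite <- DA in Hup.
      eapply LR_conv; [| |exact (IHstt2 Ho2 _ _ rb (Hup I) eq_refl)].
      * apply conv_sym. cbn [subst ren].
        eapply conv_trans; [apply conv_beta2|].
        match goal with |- conv _ ?X ?Y => replace X with Y; [apply conv_refl|] end.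
        asub_ext.
      * apply conv_sym. cbn [subst ren].
        eapply conv_trans; [apply conv_beta|].
        match goal with |- conv _ ?X ?Y => replace X with Y; [apply conv_refl|] end.
        asub_ext.
  - destruct Ho as [Ho1 Ho2].
    pose proof (stt_defined _ _ _ H0) as Da.
    destruct (rel m r (map defined Ga) f) as [rf|] eqn:Rf; [|discriminate].
    specialize (IHstt1 Ho1 _ _ rf Hth eq_refl); cbn [LR] in IHstt1.
    specialize (IHstt1 (fun i => i) (subst theta' (ren (emb (map defined Ga)) (hom m a)))).
    rewrite !ren_id in IHstt1. cbn [hom tot subst].
    destruct (rel m r (map defined Ga) a) as [ra|] eqn:Ra; simpl in Da;
      rewrite <- Da in *.
    + injection E as <-.
      eapply LR_conv; [| |apply IHstt1, (IHstt2 Ho2 _ _ ra Hth eq_refl)];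
        cbn [subst]; auto using conv_sym with conv.
    + injection E as <-.
      eapply LR_conv; [| |apply IHstt1];
        cbn [subst]; auto using conv_sym with conv.
Qed.

Lemma stt_clean Ga t tau k : stt Ga t tau k -> clean t.
Proof. induction 1; simpl; auto. Qed.

Lemma unf_clean c : clean (unf Sg c).
Proof.
  destruct (in_dec Nat.eq_dec c (map dname Sg)) as [Hin|Hin].
  - apply in_sig_names in Hin; revert c Hin.
    apply (wfs_decl_ind Sg (fun c => clean (unf Sg c)) src_wfs).
    intros c A o Hin _ Ho; rewrite (unf_eq _ _ _ _ src_wfs Hin).
    destruct o as [t|]; simpl; auto.
    destruct (ht_stt [] t A) as (k & _ & J); [constructor|now apply ht_In_def with c|].
    apply clean_hom; auto; [apply (wfs_sorted _ src_wfs)|eapply stt_clean; eauto].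
  - assert (E : unf Sg c = Con c); [|rewrite E; simpl; auto].
    clear L; unfold unf; induction Sg as [|d S IH]; simpl in *; auto.
    destruct (Nat.eqb_spec c (dname d)); simpl; auto. exfalso; auto.
Qed.

Lemma LR_con c A o p : In (c, A, o) Sg -> r c = Some p ->
  LR (erb A) (tot (unf Sg c)) p.
Proof.
  intros Hin; assert (Hc : in_sig Sg c) by (exists A, o; auto).
  revert c Hc A o p Hin.
  apply (wfs_decl_ind Sg (fun c => forall A o p, In (c, A, o) Sg -> r c = Some p ->
    LR (erb A) (tot (unf Sg c)) p) src_wfs).
  intros c A o Hin _ Ho A' o' p Hin' E.
  destruct (wfs_unique _ _ _ _ _ _ src_wfs Hin Hin') as [-> ->]; clear Hin'.
  rewrite (unf_eq _ _ _ _ src_wfs Hin). destruct o as [t|].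
  - destruct (asg_rel_ok _ _ _ Hin) as [_ J]; specialize (J t eq_refl).
    rewrite E in J. destruct (rel m r [] t) as [q|] eqn:Eq; [|easy].
    destruct (ht_stt [] t A) as (k & _ & S); [constructor|now apply ht_In_def with c|].
    eapply LR_conv; [apply conv_refl|apply conv_sym, J|].
    assert (Ht : closed t) by exact (wfs_closed_def _ src_wfs _ _ _ Hin).
    assert (Hcl : clean (unf Sg c)) by apply unf_clean.
    rewrite (unf_eq _ _ _ _ src_wfs Hin) in Hcl.
    assert (Hq : closed q) by (eapply closed_rel_nil; eauto).
    rewrite <- (Hq (fun _ => Typ)).
    rewrite <- (tot_closed _ Hcl (closed_hom _ _ (unf_closed _ src_wfs) Ht) (fun _ => Typ)).
    apply (LR_fundamental [] t (erb A) k); auto.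
    + eapply over_mono; [|apply (Ho t eq_refl)]; simpl.
      intros c' J' A' o' p' ? ?; split; eauto. apply unf_clean.
    + split; simpl; [auto with conv|]. intros [|i]; discriminate.
  - simpl; unfold ctot; rewrite (lookup_wfs _ _ _ _ src_wfs Hin), E. apply LR_pad.
Qed.

Fixpoint untwice (i : nat) : nat + nat :=
  match i with
  | 0 => inl 0
  | 1 => inr 0
  | S (S j) => match untwice j with inl k => inl (S k) | inr k => inr (S k) end
  end.

Lemma untwice_twice i : untwice (twice i) = inl i /\ untwice (S (twice i)) = inr i.
Proof.
  induction i as [|i [IH1 IH2]]; auto. split.
  - simpl; now rewrite IH1.
  - change (untwice (S (twice (S i)))) with
      (match untwice (S (twice i)) with inl k => inl (S k) | inr k => inr (S k) end
       : nat + nat).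
    now rewrite IH2.
Qed.

(** Simple types are assumed at the two ends only. The path between them is replaced by reductions
    of the unfoldings to a common reduct, which [tot] follows without typing. *)
Lemma rel_conv_stt Ga t u tau k k' p q :
  stt Ga t tau k -> stt Ga u tau k' -> conv Sg t u ->
  rel m r (map defined Ga) t = Some p -> rel m r (map defined Ga) u = Some q ->
  conv Sg' p q.
Proof.
  intros Ht Hu Hc Ep Eq.
  set (e := map defined Ga) in *.
  (* The counterpart of the identity on the total side: each [x*] becomes its padding, and a missing
     one the dummy [Typ]. *)
  pose (theta := fun i => match untwice i with
    | inl j => match nth_error Ga j, star_var e j with
               | Some sg, Some k => pad true sg (Var k)
               | _, _ => Typ
               end
    | inr j => Var (emb e j)
    end).
  assert (Hth : sub_rel Ga theta Var).
  { split; intros i; unfold theta.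
    - rewrite (proj2 (untwice_twice i)). apply conv_refl.
    - intros sg j Hsg Hj; rewrite (proj1 (untwice_twice i)). fold e in Hj; rewrite Hsg, Hj.
      apply LR_pad. }
  assert (J : forall t k p, stt Ga t tau k -> rel m r e t = Some p ->
     conv Sg' p (pad false tau (subst theta (tot (hom (unf Sg) t))))).
  { intros t0 k0 p0 H E; apply LR_pad. rewrite <- (subst_Var p0).
    eapply LR_fundamental; eauto.
    apply over_all; intros; split; [eapply LR_con; eauto|apply unf_clean]. }
  assert (C : forall t k, stt Ga t tau k -> clean (hom (unf Sg) t)).
  { intros; apply clean_hom; [apply (wfs_sorted _ src_wfs)| |eapply stt_clean; eauto].
    apply over_all, unf_clean. }
  eapply conv_trans; [exact (J t k p Ht Ep)|].
  eapply conv_trans; [|apply conv_sym; exact (J u k' q Hu Eq)].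
  apply pad_conv, conv_subst1; [exact (wfs_closed_def _ tgt_wfs)|].
  destruct (conv_unf _ _ _ src_wfs Hc) as (v & H1 & H2).
  apply conv_trans with (tot v); [|apply conv_sym]; apply tot_pars; eauto.
Qed.
(** * The abstraction theorem *)

(** Computed from simple types, so that [stt_defined] and [rel_conv_stt] apply to it verbatim;
    [env_of_cons] recovers the description by [rel]. *)
Definition env_of (G : ctx) : env := map defined (map erb G).

#[local] Notation mtr G t := (ren (emb (env_of G)) (hom m t)).

Fixpoint crel (G : ctx) : ctx :=
  match G with
  | [] => []
  | A :: G' =>
      match rel m r (env_of G') A with
      | Some rA => at_ (shift 1 rA) (Var 0) :: mtr G' A :: crel G'
      | None => mtr G' A :: crel G'
      end
  end.

Lemma env_of_cons A G k : fam P k A ->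
  env_of (A :: G) = is_some (rel m r (env_of G) A) :: env_of G.
Proof.
  intros H; unfold env_of at 1; simpl.
  now rewrite <- (fam_defined k (env_of G)).
Qed.

Lemma crel_emb G : Forall (fam P false) G ->
  ctx_ren (crel G) (emb (env_of G)) (map (hom m) G).
Proof.
  induction 1 as [|A G HA HG IH]; intros i B E; [destruct i; discriminate|].
  rewrite (env_of_cons _ _ _ HA); simpl crel.
  destruct i as [|i]; simpl in E.
  - injection E as <-.
    destruct (rel m r (env_of G) A); simpl; eexists; split; try reflexivity; asub.
  - destruct (IH _ _ E) as (B' & E' & J).
    destruct (rel m r (env_of G) A); simpl; exists B'; split; auto.
    + transitivity (shift 2 (shift (S (emb (env_of G) i)) B')); [asub|].
      rewrite J; asub.
    + transitivity (shift 1 (shift (S (emb (env_of G) i)) B')); [asub|].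
      rewrite J; asub.
Qed.

Lemma ht_emb G t T : wfc Sg G -> ht Sg G t T ->
  ht Sg' (crel G) (mtr G t) (option_map (fun A => mtr G A) T).
Proof.
  intros Hw H. apply (ht_hom Sg Sg' m) in H; auto.
  pose proof (ht_ren Sg' _ _ _ tgt_wfs H _ _ (crel_emb G (wfc_fam _ _ src_wfs Hw))) as J.
  destruct T; exact J.
Qed.

Lemma rel_shift b e t :
  rel m r (b :: e) (shift 1 t) = option_map (shift (width b)) (rel m r e t).
Proof. apply (rel_ren m r asg_closed asg_rel_closed t e (b :: e) S), env_ren_shift. Qed.

Lemma crel_star G i A k : Forall (fam P false) G ->
  nth_error G i = Some A -> star_var (env_of G) i = Some k ->
  exists rA X, rel m r (env_of G) (shift (S i) A) = Some rA /\
    nth_error (crel G) k = Some X /\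
    shift (S k) X = at_ rA (Var (emb (env_of G) i)).
Proof.
  intros HG; revert i k; induction HG as [|B G HB HG IH]; intros i k E Ek.
  - destruct i; discriminate.
  - rewrite (env_of_cons _ _ _ HB) in *; simpl crel.
    destruct i as [|i]; simpl in E, Ek.
    + injection E as ->. rewrite rel_shift.
      destruct (rel m r (env_of G) A) as [rA|] eqn:EA; simpl in *; [|discriminate].
      injection Ek as <-. eexists _, _; repeat split; try reflexivity.
      rewrite shift_at. f_equal. asub.
    + destruct (star_var (env_of G) i) as [j|] eqn:Ej; [|discriminate].
      destruct (IH _ _ E Ej) as (rA & X & E1 & E2 & E3).
      replace (shift (S (S i)) A) with (shift 1 (shift (S i) A)) by asub.
      rewrite rel_shift, E1. simpl in Ek; injection Ek as <-.
      eexists _, X; split; [reflexivity|].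
      destruct (rel m r (env_of G) B); simpl; split; auto.
      * transitivity (shift 2 (shift (S j) X)); [asub|]. rewrite E3, shift_at. reflexivity.
      * transitivity (shift 1 (shift (S j) X)); [asub|]. rewrite E3, shift_at. reflexivity.
Qed.

(** The translation of a classifier [A] yields a classifier when applied to a
    subject. *)
Definition good (G : ctx) (A : expr) (s : option expr) : Prop :=
  forall rA, rel m r (env_of G) A = Some rA ->
  forall Ga rho X, ctx_ren Ga rho (crel G) ->
    ht Sg' Ga X (Some (ren rho (mtr G A))) -> ht Sg' Ga (at_ (ren rho rA) X) s.

Lemma rel_Pi_Lam e A B p : rel m r e (Pi A B) = Some p ->
  exists b, p = Lam (ren (emb e) (hom m (Pi A B))) b.
Proof.
  simpl; intros H; destruct (rel m r e A).
  - destruct (rel m r (true :: e) B); [|discriminate]. injection H as <-; eauto.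
  - destruct (rel m r (false :: e) B); [|discriminate]. injection H as <-; eauto.
Qed.

(** The codomain is applied to the subject times the bound variable, in a context longer by one or
    two. This is why [good] allows any renaming and any subject. *)
Lemma good_Pi G A B s : is_sort s -> wfc Sg G -> ht Sg G A (Some Typ) ->
  ht Sg (A :: G) B s -> good G A (Some Typ) -> good (A :: G) B s ->
  good G (Pi A B) s.
Proof.
  intros Hsort Hw HA HB GA GB R ER Ga rho X Hrho HX.
  assert (Hw1 : wfc Sg (A :: G)) by (constructor; auto).
  assert (HfA : fam P false A) by exact (ht_type_fam Sg G A src_wfs Hw HA).
  assert (HmA : ht Sg' Ga (ren rho (mtr G A)) (Some Typ)).
  { apply (ht_ren Sg' (crel G) (mtr G A) (Some Typ)); auto.
    apply (ht_emb G A (Some Typ)); auto. }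
  assert (HnB : nonvar B).
  { destruct (cls_fam Sg (A :: G) B) as [J|J]; eauto using fam_nonvar. exists s; auto. }
  cbn [rel] in ER. unfold good in GB. rewrite (env_of_cons _ _ _ HfA) in GB.
  cbn [crel] in GB. cbn [hom ren] in HX.
  destruct (rel m r (env_of G) A) as [rA|] eqn:EA; cbn [is_some] in *.
  - destruct (rel m r (true :: env_of G) B) as [rB|] eqn:EB; [|discriminate].
    injection ER as <-. specialize (GB rB eq_refl).
    assert (Hn2 : nonvar (ren rho rA)).
    { pose proof (rel_nonvar _ _ asg_rel_closed _ _ _ (fam_nonvar _ _ _ HfA) EA).
      destruct rA; easy. }
    pose proof (rel_nonvar _ _ asg_rel_closed _ _ _ HnB EB) as Hn3.
    replace (at_ _ X) with
      (Pi (ren rho (mtr G A)) (Pi (at_ (shift 1 (ren rho rA)) (Var 0))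
         (at_ (ren (up_ren (up_ren rho)) rB) (App (shift 2 X) (Var 1))))).
    2:{ cbn [ren at_]. unfold inst. rewrite !ren_at. cbn [subst].
        rewrite !subst_at by (destruct rA, rB; easy). cbn [subst ren].
        cong; simpl; asub_ext. }
    apply ht_Pi; auto. apply ht_Pi; auto.
    + replace (shift 1 (ren rho rA)) with (ren (fun i => S (rho i)) rA) by asub.
      apply (GA rA EA (ren rho (mtr G A) :: Ga) (fun i => S (rho i)) (Var 0)).
      * apply (ctx_ren_comp _ S Ga rho); auto. apply ctx_ren_shift.
      * replace (ren (fun i => S (rho i)) (mtr G A)) with (shift 1 (ren rho (mtr G A))) by asub.
        now constructor.
    + apply GB.
      * replace (at_ (shift 1 (ren rho rA)) (Var 0)) with
          (ren (up_ren rho) (at_ (shift 1 rA) (Var 0)))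
          by (rewrite ren_at, ren_up_shift; reflexivity).
        apply ctx_ren_up, ctx_ren_up, Hrho.
      * replace (ren (up_ren (up_ren rho)) (ren (emb (true :: env_of G)) (hom m B)))
          with (inst (Var 1) (ren (up_ren (fun i => 2 + i))
                 (ren (up_ren rho) (ren (up_ren (emb (env_of G))) (hom m B))))).
        2:{ asub_ext. }
        eapply ht_App with (A := shift 2 (ren rho (mtr G A))).
        -- apply (ht_ren Sg' Ga X _ tgt_wfs HX).
           apply (ctx_ren_comp _ S (ren rho (mtr G A) :: Ga) S); apply ctx_ren_shift.
        -- now constructor.
  - destruct (rel m r (false :: env_of G) B) as [rB|] eqn:EB; [|discriminate].
    injection ER as <-. specialize (GB rB eq_refl).
    pose proof (rel_nonvar _ _ asg_rel_closed _ _ _ HnB EB) as Hn3.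
    replace (at_ _ X) with
      (Pi (ren rho (mtr G A))
         (at_ (ren (up_ren rho) rB) (App (shift 1 X) (Var 0)))).
    2:{ cbn [ren at_]. unfold inst. rewrite !ren_at. cbn [subst].
        rewrite !subst_at by (destruct rB; easy). cbn [subst ren].
        cong; simpl; asub_ext. }
    apply ht_Pi; auto. apply GB; [now apply ctx_ren_up|].
    replace (ren (up_ren rho) (ren (emb (false :: env_of G)) (hom m B)))
      with (inst (Var 0) (ren (up_ren (fun i => 1 + i))
             (ren (up_ren rho) (ren (up_ren (emb (env_of G))) (hom m B))))).
    2:{ asub_ext. }
    eapply ht_App with (A := shift 1 (ren rho (mtr G A))).
    + apply (ht_ren Sg' Ga X _ tgt_wfs HX), ctx_ren_shift.
    + now constructor.
Qed.

(** The translation of a kind abstracts over type families and is not typable in LF by itself; at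
    kinds the theorem can only speak of its instances. *)
Definition abs (G : ctx) (t : expr) (T : option expr) : Prop :=
  match T with
  | Some A => forall p, rel m r (env_of G) t = Some p ->
      exists rA, rel m r (env_of G) A = Some rA /\
        ht Sg' (crel G) p (Some (at_ rA (mtr G t)))
  | None => good G t None
  end.

Lemma abs_good G A s : is_sort s -> abs G A s -> good G A s.
Proof.
  intros [-> | ->] H; auto. intros rA E Ga rho X Hrho HX.
  destruct (H rA E) as (rT & ET & J). injection ET as <-.
  apply (ht_ren _ _ _ _ tgt_wfs) with (r := rho) (G' := Ga) in J; auto.
  exact (ht_at _ _ _ _ _ J HX tgt_wfs).
Qed.

(** Kinds have no simple type, so [rel_conv_stt] does not apply to them. But a kind is syntactically
    a product ending in [Typ], and injectivity of products leads back to its domains, which are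
    types. *)
Lemma rel_kind_conv G K : forall K', wfc Sg G -> ht Sg G K None -> ht Sg G K' None ->
  conv Sg K K' -> forall R R', rel m r (env_of G) K = Some R ->
  rel m r (env_of G) K' = Some R' -> conv Sg' R R'.
Proof.
  assert (Hd := wfs_closed_def _ tgt_wfs).
  revert G; induction K; intros G K' Hw HK HK' Hc R R' E E'.
  all: apply ht_None_inv in HK as [EK|(A & B & EK & HA & HB)]; try discriminate.
  - apply ht_None_inv in HK' as [->|(A & B & -> & _)].
    + simpl in *; injection E as <-; injection E' as <-; apply conv_refl.
    + exfalso; eapply conv_Typ_Pi; [|eauto]; auto.
  - injection EK as <- <-.
    apply ht_None_inv in HK' as [->|(A & B & -> & HA' & HB')].
    { exfalso; eapply conv_Pi_Typ; [|eauto]; auto. }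
    assert (Hcm : conv Sg' (mtr G (Pi K1 K2)) (mtr G (Pi A B))).
    { apply conv_ren; auto. apply (mor_ok_conv Sg Sg'); auto. }
    apply conv_Pi_inj in Hc as [HcA HcB]; auto.
    destruct (ht_type_stt G K1 Hw HA) as [F1 S1].
    destruct (ht_type_stt G A Hw HA') as [F2 S2].
    assert (Hd12 := fam_defined false (env_of G) K1 F1).
    assert (Hd22 := fam_defined false (env_of G) A F2).
    assert (EA : erb K1 = erb A) by (eapply er_conv; eauto).
    rewrite EA, <- Hd22 in Hd12.
    assert (HB2 : ht Sg (K1 :: G) B None)
      by (eapply (ht_ctx_conv Sg G A K1 (Some Typ)); eauto using conv_sym).
    assert (HcmA : conv Sg' (mtr G K1) (mtr G A)).
    { apply conv_ren; auto. apply (mor_ok_conv Sg Sg'); auto. }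
    specialize (IHK2 (K1 :: G) B ltac:(constructor; auto) HB HB2 HcB).
    rewrite (env_of_cons _ _ _ F1) in IHK2.
    cbn [rel] in E, E'.
    destruct (rel m r (env_of G) K1) as [rA|] eqn:E1,
      (rel m r (env_of G) A) as [rA'|] eqn:E2; try discriminate; simpl in IHK2.
    + destruct (rel m r (true :: env_of G) K2) as [rB|]; [|discriminate].
      destruct (rel m r (true :: env_of G) B) as [rB'|]; [|discriminate].
      injection E as <-; injection E' as <-.
      pose proof (rel_conv_stt _ _ _ _ _ _ _ _ S1 S2 HcA E1 E2) as HcR.
      apply conv_Lam, conv_Pi; [apply conv_ren; auto|apply conv_Pi];
        apply conv_at; auto using conv_ren with conv.
      apply conv_ren; auto.
    + destruct (rel m r (false :: env_of G) K2) as [rB|]; [|discriminate].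
      destruct (rel m r (false :: env_of G) B) as [rB'|]; [|discriminate].
      injection E as <-; injection E' as <-.
      apply conv_Lam, conv_Pi; [apply conv_ren; auto|].
      apply conv_at; auto using conv_ren with conv.
Qed.

Lemma rel_classifier_conv G A B : wfc Sg G -> cls Sg G A -> cls Sg G B ->
  conv Sg A B -> forall R, rel m r (env_of G) A = Some R ->
  exists R', rel m r (env_of G) B = Some R' /\ conv Sg' R R'.
Proof.
  intros Hw HA HB Hc R E.
  assert (HR : exists R', rel m r (env_of G) B = Some R').
  { destruct (cls_fam _ _ _ src_wfs Hw HA) as [FA|FA];
    destruct (cls_fam _ _ _ src_wfs Hw HB) as [FB|FB];
    pose proof (conv_fam_kind _ _ _ _ FA FB Hc) as Ek; try discriminate;
    pose proof (fam_defined _ (env_of G) _ FA) as DA;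
    pose proof (fam_defined _ (env_of G) _ FB) as DB;
    rewrite <- (er_conv _ _ _ FA FB Hc), <- DA, E in DB; simpl in DB;
    destruct (rel m r (env_of G) B); try discriminate; eauto. }
  destruct HR as (R' & E'); exists R'; split; auto.
  pose proof HA as HA0; pose proof HB as HB0.
  destruct HA as (s & [-> | ->] & HA), HB as (s' & [-> | ->] & HB).
  - exact (rel_kind_conv G A B Hw HA HB Hc R R' E E').
  - exfalso; apply (conv_fam_excl Sg A B src_wfs (wfs_sorted _ src_wfs)
      (ht_kind_fam Sg G A src_wfs Hw HA) (ht_type_fam Sg G B src_wfs Hw HB) Hc).
  - exfalso; apply (conv_fam_excl Sg B A src_wfs (wfs_sorted _ src_wfs)
      (ht_kind_fam Sg G B src_wfs Hw HB) (ht_type_fam Sg G A src_wfs Hw HA) (conv_sym _ _ _ Hc)).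
  - destruct (ht_type_stt G A Hw HA) as [F1 S1].
    destruct (ht_type_stt G B Hw HB) as [F2 S2].
    exact (rel_conv_stt _ _ _ _ _ _ _ _ S1 S2 Hc E E').
Qed.

Theorem abstraction G t T : ht Sg G t T -> wfc Sg G -> abs G t T.
Proof.
  assert (Hd := wfs_closed_def _ tgt_wfs).
  intros H; induction H; intros Hw; unfold abs.
  - intros rA E Ga rho X _ HX. injection E as <-. simpl.
    apply ht_Pi; auto. constructor.
  - intros p E; simpl in E.
    destruct (lrel_rel _ _ _ _ L _ _ _ H) as [J _].
    destruct (J p E) as (rA & EA & Hp).
    exists rA; split; [rewrite rel_closed; eauto|].
    cbn [hom]; rewrite closed_ren by auto. now apply ht_weaken_nil.
  - intros p E; cbn [rel] in E.
    destruct (star_var (env_of G) i) as [k|] eqn:Ek; [|discriminate].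
    injection E as <-.
    destruct (crel_star G i A k (wfc_fam _ _ src_wfs Hw) H Ek) as (rA & X & E1 & E2 & E3).
    exists rA; split; auto. cbn [hom ren]. rewrite <- E3. now constructor.
  - assert (Hw1 : wfc Sg (A :: G)) by (constructor; auto).
    pose proof (good_Pi G A B s H Hw H0 H1 (abs_good _ _ _ sort_Typ (IHht1 Hw))
      (abs_good _ _ _ H (IHht2 Hw1))) as GP.
    destruct H as [-> | ->]; auto.
    intros p E; destruct (rel_Pi_Lam _ _ _ _ E) as (b & ->).
    exists (Lam Typ (Pi (Var 0) Typ)); split; auto.
    change (at_ _ (mtr G (Pi A B))) with (Pi (mtr G (Pi A B)) Typ).
    assert (HP : ht Sg' (crel G) (mtr G (Pi A B)) (Some Typ)).
    { apply (ht_emb G (Pi A B) (Some Typ)); auto. apply ht_Pi; auto. }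
    eapply ht_Lam with (s := None); auto; [|constructor].
    (* The body of the translated product is its instance at the bound variable for the subject. *)
    specialize (GP _ E (mtr G (Pi A B) :: crel G) S (Var 0) (ctx_ren_shift _ _)).
    cbn [ren at_] in GP. rewrite inst_Var0_up in GP. apply GP. now constructor.
  - assert (Hw1 : wfc Sg (A :: G)) by (constructor; auto).
    pose proof (good_Pi G A B s H Hw H0 H2 (abs_good _ _ _ sort_Typ (IHht1 Hw))
      (abs_good _ _ _ H (IHht3 Hw1))) as GP.
    specialize (IHht2 Hw1); unfold abs in IHht2.
    assert (HfA : fam P false A) by exact (ht_type_fam Sg G A src_wfs Hw H0).
    rewrite (env_of_cons _ _ _ HfA) in IHht2. cbn [crel] in IHht2.
    assert (HmL : ht Sg' (crel G) (mtr G (Lam A b)) (Some (mtr G (Pi A B)))).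
    { apply (ht_emb G _ (Some (Pi A B))); auto. eapply ht_Lam; eauto. }
    assert (HmA : ht Sg' (crel G) (mtr G A) (Some Typ)).
    { apply (ht_emb G _ (Some Typ)); auto. }
    assert (HnB : nonvar B).
    { assert (cls Sg (A :: G) B) as HB by (exists s; auto).
      destruct (cls_fam _ _ _ src_wfs Hw1 HB); eauto using fam_nonvar. }
    intros p E; cbn [rel] in E. unfold good in GP; cbn [rel] in *.
    destruct (rel m r (env_of G) A) as [rA|] eqn:EA; simpl is_some in IHht2.
    + destruct (rel m r (true :: env_of G) b) as [rb|] eqn:Eb; [|discriminate].
      injection E as <-. destruct (IHht2 rb eq_refl) as (rB & EB & Hb).
      rewrite EB in *. eexists; split; [reflexivity|].
      specialize (GP _ eq_refl (crel G) (fun i => i) (mtr G (Lam A b)) (ctx_ren_id _)).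
      rewrite !ren_id in GP. specialize (GP HmL).
      pose proof (rel_nonvar _ _ asg_rel_closed _ _ _ (fam_nonvar _ _ _ HfA) EA) as Hn2.
      pose proof (rel_nonvar _ _ asg_rel_closed _ _ _ HnB EB) as Hn3.
      assert (ET : at_ (Lam (mtr G (Pi A B)) (Pi (shift 1 (mtr G A))
         (Pi (at_ (shift 2 rA) (Var 0)) (at_ (ren (up_ren (up_ren S)) rB) (App (Var 2) (Var 1))))))
         (mtr G (Lam A b)) =
        Pi (mtr G A) (Pi (at_ (shift 1 rA) (Var 0))
          (at_ rB (App (shift 2 (mtr G (Lam A b))) (Var 1))))).
      { cbn [at_]. unfold inst. cbn [subst].
        rewrite !subst_at by (destruct rA, rB; easy). cbn [subst].
        cong; simpl; asub_ext. }
      rewrite ET in *.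
      apply ht_Pi_inv in GP as (s1 & Hs1 & _ & GP & _).
      pose proof GP as GP1.
      apply ht_Pi_inv in GP as (s2 & Hs2 & GA & GB & _).
      apply ht_Lam with (s := s1); auto. apply ht_Lam with (s := s2); auto.
      eapply ht_conv; [exact Hs2| | |exact GB].
      * exact Hb.
      (* The induction hypothesis speaks of the image of the body, the expected type of the image of
         the abstraction applied to [x]: these differ by one beta step. *)
      * apply conv_at; [apply conv_refl|]. apply conv_sym.
        cbn [hom ren]. unfold shift; cbn [ren].
        eapply conv_trans; [apply conv_beta|].
        match goal with |- conv _ ?X ?Y => replace X with Y; [apply conv_refl|] end.
        asub_ext.
    + destruct (rel m r (false :: env_of G) b) as [rb|] eqn:Eb; [|discriminate].
      injection E as <-. destruct (IHht2 rb eq_refl) as (rB & EB & Hb).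
      rewrite EB in *. eexists; split; [reflexivity|].
      specialize (GP _ eq_refl (crel G) (fun i => i) (mtr G (Lam A b)) (ctx_ren_id _)).
      rewrite !ren_id in GP. specialize (GP HmL).
      pose proof (rel_nonvar _ _ asg_rel_closed _ _ _ HnB EB) as Hn3.
      assert (ET : at_ (Lam (mtr G (Pi A B)) (Pi (shift 1 (mtr G A))
         (at_ (ren (up_ren S) rB) (App (Var 1) (Var 0)))))
         (mtr G (Lam A b)) =
        Pi (mtr G A) (at_ rB (App (shift 1 (mtr G (Lam A b))) (Var 0)))).
      { cbn [at_]. unfold inst. cbn [subst].
        rewrite !subst_at by (destruct rB; easy). cbn [subst].
        cong; simpl; asub_ext. }
      rewrite ET in *.
      apply ht_Pi_inv in GP as (s1 & Hs1 & _ & GB & _).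
      apply ht_Lam with (s := s1); auto.
      eapply ht_conv; [exact Hs1| | |exact GB].
      * exact Hb.
      * apply conv_at; [apply conv_refl|]. apply conv_sym.
        cbn [hom ren]. unfold shift; cbn [ren].
        eapply conv_trans; [apply conv_beta|].
        match goal with |- conv _ ?X ?Y => replace X with Y; [apply conv_refl|] end.
        asub_ext.
  - intros p E; cbn [rel] in E.
    destruct (rel m r (env_of G) f) as [rf|] eqn:Ef; [|discriminate].
    destruct (IHht1 Hw rf Ef) as (rP & EP & Hf).
    assert (Hwl : well_labelled (Pi A B)).
    { destruct (ht_valid Sg G f (Pi A B) src_wfs Hw H) as (s & _ & J).
      exact (ht_well_labelled _ _ _ _ src_wfs J Hw). }
    destruct Hwl as (HnA & HnB & _ & HwB).
    assert (Hfa : fam P false A).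
    { destruct (ht_valid Sg G f (Pi A B) src_wfs Hw H) as (s & _ & J).
      apply ht_Pi_inv in J as (? & _ & J & _). exact (ht_type_fam Sg G A src_wfs Hw J). }
    (* The translation of the function expects a related argument exactly when the application
       supplies one. *)
    assert (Da : is_some (rel m r (env_of G) a) = is_some (rel m r (env_of G) A)).
    { destruct (ht_stt G a A Hw H0) as (k & Fk & S).
      rewrite (fam_kind_unique _ _ _ Fk Hfa) in S.
      unfold env_of at 1. rewrite (stt_defined _ _ _ S).
      symmetry; exact (fam_defined _ _ _ Hfa). }
    rewrite (rel_inst m r asg_closed asg_rel_closed) by auto. rewrite Da. unfold rel_inst_sub.
    specialize (IHht2 Hw). cbn [rel] in EP.
    destruct (rel m r (env_of G) A) as [rA|] eqn:EA; cbn [is_some] in *.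
    + destruct (rel m r (env_of G) a) as [ra|] eqn:Ea; [|discriminate].
      injection E as <-.
      destruct (rel m r (true :: env_of G) B) as [rB|] eqn:EB; [|discriminate].
      injection EP as <-. eexists; split; [reflexivity|].
      destruct (IHht2 ra Ea) as (rA' & EA' & Ha). rewrite EA in EA'; injection EA' as <-.
      pose proof (rel_nonvar _ _ asg_rel_closed _ _ _ HnA EA) as Hn2.
      pose proof (rel_nonvar _ _ asg_rel_closed _ _ _ HnB EB) as Hn3.
      assert (ET : at_ (Lam (mtr G (Pi A B)) (Pi (shift 1 (mtr G A))
         (Pi (at_ (shift 2 rA) (Var 0)) (at_ (ren (up_ren (up_ren S)) rB) (App (Var 2) (Var 1))))))
         (mtr G f) =
        Pi (mtr G A) (Pi (at_ (shift 1 rA) (Var 0))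
          (at_ rB (App (shift 2 (mtr G f)) (Var 1))))).
      { cbn [at_]. unfold inst. cbn [subst].
        rewrite !subst_at by (destruct rA, rB; easy). cbn [subst].
        cong; simpl; asub_ext. }
      cbn [hom ren] in ET; rewrite ET in Hf.
      pose proof (ht_App _ _ _ _ _ _ Hf (ht_emb G a (Some A) Hw H0)) as J1.
      replace (inst (mtr G a) _) with
        (Pi (at_ rA (mtr G a)) (subst (up (scons (mtr G a) Var))
           (at_ rB (App (shift 2 (mtr G f)) (Var 1))))) in J1.
      2:{ unfold inst; cbn [subst]. rewrite !subst_at by (destruct rA, rB; easy).
          cong; simpl; asub_ext. }
      pose proof (ht_App _ _ _ _ _ _ J1 Ha) as J2.
      replace (at_ _ _) with
        (inst ra (subst (up (scons (mtr G a) Var))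
          (at_ rB (App (shift 2 (mtr G f)) (Var 1))))); [exact J2|].
      unfold inst. rewrite !subst_at by (destruct rB; easy).
      cbn [hom ren]; cong; simpl; asub_ext.
    + destruct (rel m r (env_of G) a) as [ra|] eqn:Ea; [discriminate|].
      injection E as <-.
      destruct (rel m r (false :: env_of G) B) as [rB|] eqn:EB; [|discriminate].
      injection EP as <-. eexists; split; [reflexivity|].
      pose proof (rel_nonvar _ _ asg_rel_closed _ _ _ HnB EB) as Hn3.
      assert (ET : at_ (Lam (mtr G (Pi A B)) (Pi (shift 1 (mtr G A))
         (at_ (ren (up_ren S) rB) (App (Var 1) (Var 0)))))
         (mtr G f) =
        Pi (mtr G A) (at_ rB (App (shift 1 (mtr G f)) (Var 0)))).
      { cbn [at_]. unfold inst. cbn [subst].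
        rewrite !subst_at by (destruct rB; easy). cbn [subst].
        cong; simpl; asub_ext. }
      cbn [hom ren] in ET; rewrite ET in Hf.
      pose proof (ht_App _ _ _ _ _ _ Hf (ht_emb G a (Some A) Hw H0)) as J1.
      replace (at_ _ _) with
        (inst (mtr G a) (at_ rB (App (shift 1 (mtr G f)) (Var 0)))); [exact J1|].
      unfold inst. rewrite !subst_at by (destruct rB; easy).
      cbn [hom ren]; cong; simpl; asub_ext.
  - intros p E. destruct (IHht1 Hw p E) as (rA & EA & Hp).
    destruct (rel_classifier_conv G A B Hw (ht_valid _ _ _ _ src_wfs Hw H0)
      (ex_intro _ s (conj H H2)) H1 rA EA) as (rB & EB & Hc).
    exists rB; split; auto.
    pose proof (abs_good _ _ _ H (IHht2 Hw) rB EB (crel G) (fun i => i) (mtr G t)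
      (ctx_ren_id _)) as GB.
    rewrite !ren_id in GB.
    apply ht_conv with (s := s) (A := at_ rA (mtr G t)); auto.
    + apply conv_at; auto with conv.
    + apply GB, (ht_emb G t (Some B)); auto. eapply ht_conv; eauto.
Qed.

Lemma abstraction_nil t A p : ht Sg [] t (Some A) -> rel m r [] t = Some p ->
  exists rA, rel m r [] A = Some rA /\ ht Sg' [] p (Some (at_ rA (hom m t))).
Proof.
  intros H E. destruct (abstraction [] t _ H (wfc_nil _) p E)
    as (rA & EA & Hp).
  exists rA; split; auto. simpl in Hp. now rewrite ren_id in Hp.
Qed.

Lemma rel_classifier_nil A rA X : cls Sg [] A -> rel m r [] A = Some rA ->
  ht Sg' [] X (Some (hom m A)) -> cls Sg' [] (at_ rA X).
Proof.
  intros (s & Hsort & H) E HX; exists s; split; auto.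
  pose proof (abs_good _ _ _ Hsort (abstraction [] A s H (wfc_nil _))
    rA E [] (fun i => i) X (ctx_ren_id _)) as G.
  simpl in G; rewrite !ren_id in G. auto.
Qed.

Lemma rel_kind_defined A : fam (famc Sg) true A -> exists rA, rel m r [] A = Some rA.
Proof.
  intros H; pose proof (fam_defined _ [] _ H) as D.
  assert (D' : defined (er (er_base Sg r) A) = true).
  { clear D; induction A; simpl in *; try easy; apply IHA2, H. }
  rewrite D' in D; destruct (rel m r [] A); [eauto|discriminate].
Qed.

Lemma rel_type_defined t A : ht Sg [] t (Some A) -> ht Sg [] A (Some Typ) ->
  is_some (rel m r [] t) = is_some (rel m r [] A).
Proof.
  intros H HA.
  pose proof (ht_type_fam Sg [] A src_wfs (wfc_nil _) HA) as F.
  destruct (ht_stt [] t A (wfc_nil _) H) as (k & Fk & S).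
  rewrite (fam_kind_unique _ _ _ Fk F) in S.
  rewrite (fam_defined _ [] _ F).
  exact (stt_defined _ _ _ S).
Qed.

Lemma rel_conv_nil t u A B : ht Sg [] t (Some A) -> ht Sg [] u (Some B) ->
  conv Sg A B -> conv Sg t u ->
  match rel m r [] t, rel m r [] u with
  | Some p, Some q => conv Sg' p q
  | None, None => True
  | _, _ => False
  end.
Proof.
  intros Ht Hu HAB Hc.
  destruct (ht_stt [] t A (wfc_nil _) Ht) as (k & Fk & S).
  destruct (ht_stt [] u B (wfc_nil _) Hu) as (k' & Fk' & S').
  assert (k = k') as <- by exact (conv_fam_kind _ _ _ _ Fk Fk' HAB).
  rewrite <- (er_conv _ _ _ Fk Fk' HAB) in S'.
  assert (D : is_some (rel m r [] t) = is_some (rel m r [] u)).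
  { destruct k.
    - pose proof (stt_fam _ _ _ S) as F; pose proof (stt_fam _ _ _ S') as F'.
      rewrite (fam_defined _ [] _ F), (fam_defined _ [] _ F').
      f_equal; exact (er_conv _ _ _ F F' Hc).
    - pose proof (stt_defined _ _ _ S) as E.
      pose proof (stt_defined _ _ _ S') as E'.
      simpl in E, E'; congruence. }
  destruct (rel m r [] t) as [p|] eqn:E, (rel m r [] u) as [q|] eqn:E'; try easy.
  exact (rel_conv_stt [] t u _ _ _ _ _ S S' Hc E E').
Qed.

End Relation.

(** * Removal of arguments *)

Fixpoint nofree (i : nat) (t : expr) : Prop :=
  match t with
  | Typ | Con _ => True
  | Var k => k <> i
  | Pi A B => nofree i A /\ nofree (S i) B
  | Lam A b => nofree i A /\ nofree (S i) b
  | App f s => nofree i f /\ nofree i s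
  end.

Lemma nofree_agree t : forall s s', (forall j, nofree j t \/ s j = s' j) ->
  subst s t = subst s' t.
Proof.
  assert (U : forall b s s', (forall j, nofree (S j) b \/ s j = s' j) ->
    forall j, nofree j b \/ up s j = up s' j).
  { intros b s s' H [|j]; simpl; auto. destruct (H j) as [J| ->]; auto. }
  induction t; simpl; intros s s' H; auto; f_equal.
  1: destruct (H n); [congruence|auto].
  all: first [apply IHt1|apply IHt2]; try apply U; intros j; destruct (H j); tauto.
Qed.

Lemma nofree_closed t : (forall i, nofree i t) -> closed t.
Proof.
  intros H s. transitivity (subst Var t); [apply nofree_agree; auto|apply subst_Var].
Qed.

Lemma nofree_ren_image t : forall i r, (forall j, r j <> i) -> nofree i (ren r t).
Proof.
  assert (U : forall i r, (forall j, r j <> i) -> forall j, up_ren r j <> S i).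
  { intros i r H [|j] E; simpl in E; [discriminate|injection E; apply H]. }
  induction t; simpl; auto.
Qed.

Lemma closed_nofree t i : closed t -> nofree i t.
Proof.
  intros H. rewrite <- (closed_ren t (fun k => k + S i) H).
  apply nofree_ren_image. intros; lia.
Qed.

Lemma nofree_ren t : forall i i' r, nofree i t ->
  (forall j, j <> i -> r j <> i') -> nofree i' (ren r t).
Proof.
  assert (U : forall i i' r, (forall j, j <> i -> r j <> i') ->
    forall j, j <> S i -> up_ren r j <> S i').
  { intros i i' r H [|j] Hj E; simpl in E; [discriminate|injection E].
    apply H; auto. }
  induction t; simpl; intros; auto; intuition eauto.
Qed.

Lemma nofree_subst t : forall k i s, nofree k t ->
  (forall j, j <> k -> nofree i (s j)) -> nofree i (subst s t).
Proof.
  assert (U : forall k i s, (forall j, j <> k -> nofree i (s j)) ->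
    forall j, j <> S k -> nofree (S i) (up s j)).
  { intros k i s H [|j] Hj; simpl; auto. eapply nofree_ren; [apply H; auto|].
    simpl; intros; lia. }
  induction t; simpl; intros; auto; intuition eauto.
Qed.

Lemma nofree_inst i t : nofree (S i) t -> nofree i (inst Typ t).
Proof.
  intros H; apply nofree_subst with (S i); auto.
  intros [|j] Hj; simpl; auto.
Qed.

(** Exhibits an expression under a removed binding as a weakening, the form to which strengthening
    applies. *)
Lemma nofree_shift t : nofree 0 t -> shift 1 (inst Typ t) = t.
Proof.
  intros H. transitivity (subst Var t); [|apply subst_Var].
  rewrite inst_scons; unfold shift; rewrite ren_subst.
  apply nofree_agree. intros [|j]; simpl; auto.
Qed.

Section Removal.
Variable P : positions.

Lemma nofree_rm t : forall i, occurs P i t = false -> nofree i (rm P t).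
Proof.
  induction t; simpl; intros i H; auto.
  - now apply Nat.eqb_neq.
  - apply orb_false_iff in H as [? ?]; auto.
  - apply orb_false_iff in H as [? ?]; auto.
  - apply orb_false_iff in H as [? H].
    destruct (arg_removed P t1); simpl in *; auto.
Qed.

(** * Removal and expansion of the bindings of one constant *)

Section Constant.
Variable c : name.

Lemma nofree_rm_pis A : forall j i, nofree i (rm P A) -> nofree i (rm_pis P c j A).
Proof.
  induction A; intros j i H; auto. destruct H.
  simpl; destruct (memb j (P c)); simpl; auto using nofree_inst.
Qed.

Lemma nofree_rm_lams t : forall j i, nofree i (rm P t) -> nofree i (rm_lams P c j t).
Proof.
  induction t; intros j i H; auto. destruct H.
  simpl; destruct (memb j (P c)); simpl; auto using nofree_inst.
Qed.

Lemma closed_rm_lams t j : closed (rm P t) -> closed (rm_lams P c j t).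
Proof.
  intros H; apply nofree_closed; intros i. apply nofree_rm_lams, closed_nofree, H.
Qed.

(** In particular, [removed_below j j] says that nothing is left to remove from position [j] on. *)
Definition removed_below (j k : nat) : Prop :=
  forall i, In i (P c) -> j <= i -> i < k.

Lemma removed_below_memb j : removed_below j j -> memb j (P c) = false.
Proof. intros H; apply memb_false; intros Hj. specialize (H j Hj); lia. Qed.

Lemma removed_below_SS j : removed_below j j -> removed_below (S j) (S j).
Proof. intros H i Hi Hj; specialize (H i Hi); lia. Qed.

Lemma rm_pis_none A : forall j, removed_below j j -> rm_pis P c j A = rm P A.
Proof.
  induction A; intros j H; auto. simpl; rewrite removed_below_memb by easy.
  now rewrite IHA2 by now apply removed_below_SS.
Qed.

Lemma rm_lams_none t : forall j, removed_below j j -> rm_lams P c j t = rm P t.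
Proof.
  induction t; intros j H; auto. simpl; rewrite removed_below_memb by easy.
  now rewrite IHt2 by now apply removed_below_SS.
Qed.

(** [expand] stopped after [n] bindings. *)
Fixpoint expandn (n j : nat) (A h : expr) : expr :=
  match n, A with
  | S n, Pi A0 B =>
      Lam (rm P A0) (expandn n (S j) B
        (if memb j (P c) then shift 1 h else App (shift 1 h) (Var 0)))
  | _, _ => h
  end.

Lemma expand_expandn A : forall j h, expand P c j A h = expandn (pis A) j A h.
Proof. induction A; intros j h; simpl; auto. now rewrite IHA2. Qed.

Lemma expandn_none Sg n : forall j A h, removed_below j j ->
  conv Sg (expandn n j A h) h.
Proof.
  induction n; intros j A h H; simpl; [apply conv_refl|].
  destruct A; try apply conv_refl.
  rewrite removed_below_memb by easy.
  eapply conv_trans; [|apply (conv_eta Sg (rm P A1))].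
  apply conv_Lam, IHn, removed_below_SS, H.
Qed.

(** Past the last removed position a binding merely passes its variable on, so a longer expansion
    differs by eta only. *)
Lemma expandn_conv Sg n : forall n' j A h,
  (forall c A v, In (c, A, Some v) Sg -> closed v) ->
  removed_below j (j + n) -> removed_below j (j + n') ->
  conv Sg (expandn n j A h) (expandn n' j A h).
Proof.
  induction n; intros [|n'] j A h Hd H H'; try rewrite Nat.add_0_r in *.
  - apply conv_refl.
  - apply conv_sym, expandn_none, H.
  - apply expandn_none, H'.
  - simpl; destruct A; auto with conv. apply conv_Lam, IHn; auto.
    + intros i Hi Hj; specialize (H i Hi); lia.
    + intros i Hi Hj; specialize (H' i Hi); lia.
Qed.

Lemma conv_Lam_inv Sg A b A' b' :
  (forall c A v, In (c, A, Some v) Sg -> closed v) ->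
  conv Sg (Lam A b) (Lam A' b') -> conv Sg b b'.
Proof.
  intros Hd H.
  assert (J : forall A b, conv Sg b (App (shift 1 (Lam A b)) (Var 0))).
  { intros A0 b0; apply conv_sym; unfold shift; cbn [ren].
    eapply conv_trans; [apply conv_beta|].
    change (ren (up_ren (fun i => 1 + i)) b0) with (ren (up_ren S) b0).
    rewrite inst_Var0_up; apply conv_refl. }
  eapply conv_trans; [apply (J A)|]. eapply conv_trans; [|apply conv_sym, (J A')].
  apply conv_App; auto with conv. now apply conv_ren.
Qed.

Lemma conv_Lam_App Sg A b : conv Sg (App (shift 1 (Lam A b)) (Var 0)) b.
Proof.
  unfold shift; cbn [ren]. eapply conv_trans; [apply conv_beta|].
  change (ren (up_ren (fun i => 1 + i)) b) with (ren (up_ren S) b).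
  rewrite inst_Var0_up; apply conv_refl.
Qed.

Lemma removed_lams j t : removed_below j (j + lams t) ->
  removed_below j j \/ exists A b, t = Lam A b.
Proof.
  destruct t; simpl; intros H; eauto; left; intros i Hi Hj; specialize (H i Hi Hj); lia.
Qed.

Lemma removed_pis j t : removed_below j (j + pis t) ->
  removed_below j j \/ exists A b, t = Pi A b.
Proof.
  destruct t; simpl; intros H; eauto; left; intros i Hi Hj; specialize (H i Hi Hj); lia.
Qed.

Lemma removed_below_next j n : removed_below j (j + S n) -> removed_below (S j) (S j + n).
Proof. intros H i Hi Hj; specialize (H i Hi); lia. Qed.

Lemma shift_rm_lams j b : In j (P c) -> (In j (P c) -> occurs P 0 b = false) ->
  shift 1 (inst Typ (rm_lams P c (S j) b)) = rm_lams P c (S j) b.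
Proof. intros H Hu; apply nofree_shift, nofree_rm_lams, nofree_rm; auto. Qed.

Lemma shift_rm_pis j b : In j (P c) -> (In j (P c) -> occurs P 0 b = false) ->
  shift 1 (inst Typ (rm_pis P c (S j) b)) = rm_pis P c (S j) b.
Proof. intros H Hu; apply nofree_shift, nofree_rm_pis, nofree_rm; auto. Qed.

(** Expansion binds the removed variables again, vacuously, and thus undoes [rm_lams]. The head is
    arbitrary because each binding weakens it or applies it. *)
Lemma expandn_rm_lams Sg n : forall j A t h,
  (forall c A v, In (c, A, Some v) Sg -> closed v) ->
  n <= pis A ->
  removed_below j (j + n) -> removed_below j (j + lams t) ->
  lams_unused P c j t ->
  conv Sg h (rm_lams P c j t) -> conv Sg (expandn n j A h) (rm P t).
Proof.
  induction n; intros j A t h Hd Hn Hr Ht Hu Hc.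
  - rewrite Nat.add_0_r in Hr; simpl. rewrite rm_lams_none in Hc; auto.
  - destruct (removed_lams _ _ Ht) as [H|(A' & b & ->)].
    + eapply conv_trans; [now apply expandn_none|]. rewrite rm_lams_none in Hc; auto.
    + destruct A as [| | |A0 B| |]; simpl in Hn; try lia.
      simpl in *. destruct Hu as [Hu1 Hu2]. apply conv_Lam, IHn; auto; try lia.
      * now apply removed_below_next.
      * now apply removed_below_next.
      * destruct (memb j (P c)) eqn:E.
        -- apply memb_In in E. rewrite <- (shift_rm_lams j b) by auto.
           now apply conv_ren.
        -- eapply conv_trans; [|apply (conv_Lam_App Sg (rm P A'))].
           apply conv_App; auto with conv. now apply conv_ren.
Qed.

(** Lifts conversions from [rm] to [rm_lams]: bindings are opened in parallel, and dropping one is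
    instantiation by [Typ], which conversion respects. *)
Lemma rm_lams_hom_conv Sg f t1 : forall j t2,
  (forall c A v, In (c, A, Some v) Sg -> closed v) -> closed_asg f ->
  removed_below j (j + lams t1) -> removed_below j (j + lams t2) ->
  conv Sg (rm P t1) (hom f (rm P t2)) ->
  conv Sg (rm_lams P c j t1) (hom f (rm_lams P c j t2)).
Proof.
  induction t1; intros j t2 Hd Hf H1 H2 Hc;
    destruct (removed_lams _ _ H2) as [H|(A' & b & ->)];
    try (rewrite !rm_lams_none by easy; easy);
    destruct (removed_lams _ _ H1) as [H|(A1 & b1 & E)]; try discriminate;
    try (rewrite !rm_lams_none by easy; easy).
  simpl in *. apply conv_Lam_inv in Hc; auto.
  specialize (IHt1_2 (S j) b Hd Hf (removed_below_next _ _ H1)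
    (removed_below_next _ _ H2) Hc).
  destruct (memb j (P c)); simpl; auto with conv.
  rewrite hom_inst by easy. apply conv_inst; auto with conv.
Qed.

Lemma rm_lams_expandn_conv Sg n : forall j A t h,
  (forall c A v, In (c, A, Some v) Sg -> closed v) ->
  n <= pis A ->
  removed_below j (j + n) -> removed_below j (j + lams t) ->
  conv Sg (rm P t) (expandn n j A h) -> conv Sg (rm_lams P c j t) h.
Proof.
  induction n; intros j A t h Hd Hn Hr Ht Hc.
  - rewrite Nat.add_0_r in Hr; simpl in Hc. rewrite rm_lams_none; auto.
  - destruct (removed_lams _ _ Ht) as [H|(A' & b & ->)].
    + rewrite rm_lams_none by easy.
      eapply conv_trans; [exact Hc|now apply expandn_none].
    + destruct A as [| | |A0 B| |]; simpl in Hn; try lia.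
      simpl in *. apply conv_Lam_inv in Hc; auto.
      apply IHn in Hc; auto using removed_below_next; try lia.
      destruct (memb j (P c)).
      * apply (conv_inst Sg Typ Typ) in Hc; auto with conv.
        now rewrite inst_shift in Hc.
      * eapply conv_trans; [|apply (conv_eta Sg Typ)]. auto with conv.
Qed.

Lemma ht_rm_pis Sg A : forall G j s, wfs Sg -> wfc Sg G -> is_sort s ->
  ht Sg G (rm P A) s -> pis_unused P c j A -> ht Sg G (rm_pis P c j A) s.
Proof.
  induction A; intros G j s Hs Hw Hsort H Hu; auto. simpl in *.
  apply ht_Pi_inv in H as (s' & Hs' & HA & HB & E1 & E2).
  assert (s' = s) as ->.
  { destruct Hsort as [-> | ->]; auto. now destruct (E2 _ eq_refl). }
  assert (Hw1 : wfc Sg (rm P A1 :: G)) by (constructor; auto).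
  apply (IHA2 _ (S j)) in HB; try apply Hu; auto.
  destruct (memb j (P c)) eqn:E; [|apply ht_Pi; auto].
  apply memb_In in E. rewrite <- (shift_rm_pis j) in HB by (auto; apply Hu).
  eapply strengthen_shift_sort; eauto.
Qed.

Lemma ht_expandn Sg n : forall G j A h s, wfs Sg -> wfc Sg G -> is_sort s ->
  ht Sg G (rm P A) s -> pis_unused P c j A ->
  removed_below j (j + n) -> removed_below j (j + pis A) ->
  ht Sg G h (Some (rm_pis P c j A)) ->
  ht Sg G (expandn n j A h) (Some (rm P A)).
Proof.
  induction n; intros G j A h s Hs Hw Hsort HA Hu Hr Hp Hh.
  - rewrite Nat.add_0_r in Hr. rewrite rm_pis_none in Hh; auto.
  - destruct A; simpl in Hp; rewrite ?Nat.add_0_r in Hp;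
      try (rewrite rm_pis_none in Hh by easy; exact Hh).
    simpl in *. destruct Hu as [Hu1 Hu2].
    apply ht_Pi_inv in HA as (s' & Hs' & HA & HB & _ & _).
    assert (Hw1 : wfc Sg (rm P A1 :: G)) by (constructor; auto).
    apply ht_Lam with (s := s'); auto.
    apply IHn with (s := s'); auto using removed_below_next.
    destruct (memb j (P c)) eqn:E.
    + apply memb_In in E. rewrite <- (shift_rm_pis j) by auto.
      apply (ht_shift _ _ _ _ (rm P A1) Hs Hh).
    + apply (ht_shift _ _ _ _ (rm P A1) Hs) in Hh.
      rewrite <- (inst_Var0_up (rm_pis P c (S j) A2)).
      eapply ht_App; [exact Hh|]. now constructor.
Qed.

(** [f] serves the values of morphisms: they are stripped like a definiens, while their type is the
    image of the stripped type of [c]. For definientia [f] is [Con]. *)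
Lemma ht_rm_lams Sg f t : forall G j A, wfs Sg -> wfc Sg G -> closed_asg f ->
  removed_below j (j + lams t) -> removed_below j (j + pis A) ->
  lams_unused P c j t -> pis_unused P c j A ->
  ht Sg G (rm P t) (Some (hom f (rm P A))) ->
  ht Sg G (rm_lams P c j t) (Some (hom f (rm_pis P c j A))).
Proof.
  induction t; intros G j A Hs Hw Hf Ht HA Hu HuA H;
    destruct (removed_pis _ _ HA) as [HJ|(A0 & B & ->)];
    try (rewrite rm_pis_none, rm_lams_none by easy; easy);
    destruct (removed_lams _ _ Ht) as [HJ|(A1 & b1 & E)]; try discriminate;
    try (rewrite rm_pis_none, rm_lams_none by easy; easy).
  clear A1 b1 E; simpl in *.
  assert (HC : cls Sg G (Pi (hom f (rm P A0)) (hom f (rm P B)))).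
  { eapply ht_valid; eauto. }
  destruct HC as (s & Hsort & HC).
  apply ht_Pi_inv in HC as (s1 & Hs1 & HA0 & HB & _).
  apply ht_Lam_inv in H as (B' & s' & Hs' & HA' & Hb & HB' & Hc).
  apply conv_Pi_inj in Hc as [Hc1 Hc2]; auto.
  assert (Hw1 : wfc Sg (hom f (rm P A0) :: G)) by (constructor; auto).
  assert (Hb1 : ht Sg (hom f (rm P A0) :: G) (rm P t2) (Some (hom f (rm P B)))).
  { apply ht_conv with (A := B') (s := s1); auto.
    apply (ht_ctx_conv Sg G (rm P t1) _ (Some Typ)); auto. }
  apply (IHt2 _ (S j) B) in Hb1; try apply removed_below_next; try apply Hu;
    try apply HuA; auto.
  destruct (ht_valid _ _ _ _ Hs Hw1 Hb1) as (s2 & Hs2 & HB2).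
  destruct (memb j (P c)) eqn:E.
  - apply memb_In in E.
    rewrite <- (shift_rm_pis j) in Hb1, HB2 by (auto; apply HuA).
    rewrite hom_shift in Hb1, HB2 by easy.
    rewrite <- (shift_rm_lams j) in Hb1 by (auto; apply Hu).
    eapply strengthen_shift; eauto. exists s2; auto.
  - simpl. apply ht_conv with (A := Pi (rm P t1) (hom f (rm_pis P c (S j) B))) (s := s2);
      auto with conv; [|apply ht_Pi; auto].
    apply ht_Lam with (s := s2); auto;
      apply (ht_ctx_conv Sg G (hom f (rm P A0)) _ (Some Typ)); auto using conv_sym.
Qed.

(** The shape of [expandn] with the labels forgotten, which makes it stable under substitution. *)
Fixpoint expands (n j : nat) (h t : expr) : Prop :=
  match n with
  | 0 => t = h
  | S n => exists A b, t = Lam A b /\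
      expands n (S j) (if memb j (P c) then shift 1 h else App (shift 1 h) (Var 0)) b
  end.

Lemma expands_expandn n : forall j A h, n <= pis A ->
  expands n j h (expandn n j A h).
Proof.
  induction n; intros j A h Hn; simpl; auto.
  destruct A; simpl in *; try lia. eexists _, _; split; [reflexivity|].
  apply IHn; lia.
Qed.

Lemma expands_subst n : forall j h t s, expands n j h t ->
  expands n j (subst s h) (subst s t).
Proof.
  induction n; intros j h t s H; simpl in *; [congruence|].
  destruct H as (A & b & -> & H). eexists _, _; split; [reflexivity|].
  apply (IHn _ _ _ (up s)) in H. destruct (memb j (P c)); simpl in H;
    now rewrite subst_up_shift in H.
Qed.
End Constant.

(** [x c] binds the arguments of [c] up to the last removed one. *)
Definition expansion (x : assignment) (c : name) : Prop :=
  exists n, expands c n 0 (Con c) (x c) /\ (forall j, In j (P c) -> j < n) /\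
    forall k, (forall j, In j (P c) -> j < k) -> n <= k.

Lemma saturated_spine t : forall k c i, saturated P k t -> spine t = Some (c, i) ->
  forall j, In j (P c) -> j < i + k.
Proof.
  induction t; simpl; intros k c i Hs E j Hj; try discriminate.
  - injection E as -> <-; auto.
  - destruct (spine t1) as [[c' i']|] eqn:E1; [|discriminate].
    injection E as -> <-. destruct Hs as [Hs _].
    specialize (IHt1 _ _ _ Hs eq_refl _ Hj); lia.
Qed.

(** [hom x t] reduces to [rm P t], up to the bindings introduced by [x] if [t] is
    an application of a constant to too few arguments. *)
Definition spine_reds (x : assignment) (t : expr) : Prop :=
  match spine t with
  | Some (c, i) => exists n u, reds (hom x t) u /\ expands c (n - i) i (rm P t) u /\
      (forall j, In j (P c) -> j < n) /\
      forall k, (forall j, In j (P c) -> j < k) -> n <= k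
  | None => reds (hom x t) (rm P t)
  end.

Lemma spine_reds_saturated x t : saturated P 0 t -> spine_reds x t ->
  reds (hom x t) (rm P t).
Proof.
  unfold spine_reds; intros Hs H; destruct (spine t) as [[c i]|] eqn:E; auto.
  destruct H as (n & u & Hu & Hx & Hn & Hk).
  assert (n <= i) by (apply Hk; intros j Hj;
    pose proof (saturated_spine _ _ _ _ Hs E j Hj); lia).
  replace (n - i) with 0 in Hx by lia. simpl in Hx; now subst.
Qed.

(** Each argument consumes one binding of the expanded head by a beta step, which keeps or discards
    it; later arguments are kept. As the expansion ends at the last removed position, a saturated
    spine uses up all bindings and no eta step remains. *)
Lemma spine_reds_rm x t : over (expansion x) t -> forall k, saturated P k t ->
  spine_reds x t.
Proof.
  induction t; intros Ho k Hsat; simpl in Ho, Hsat; unfold spine_reds; simpl spine.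
  - apply reds_refl.
  - destruct Ho as (n0 & Hx & Hn & Hk).
    exists n0, (x n); rewrite Nat.sub_0_r. repeat split; auto. apply reds_refl.
  - apply reds_refl.
  - simpl; apply reds_cong; auto using red_Pi1, red_Pi2;
      apply spine_reds_saturated; try eapply IHt1; try eapply IHt2; apply Ho || apply Hsat.
  - simpl; apply reds_cong; auto using red_Lam1, red_Lam2;
      apply spine_reds_saturated; try eapply IHt1; try eapply IHt2; apply Ho || apply Hsat.
  - destruct Ho as [Ho1 Ho2], Hsat as [Hs1 Hs2].
    assert (R2 : reds (hom x t2) (rm P t2)) by (eapply spine_reds_saturated, IHt2; eauto).
    specialize (IHt1 Ho1 _ Hs1); unfold spine_reds in IHt1. simpl rm; unfold arg_removed.
    destruct (spine t1) as [[c i]|] eqn:E1.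
    + destruct IHt1 as (n & u & Hu & Hx & Hn & Hk).
      exists n. destruct (n - i) as [|p] eqn:Ep.
      * simpl in Hx; subst u. exists (App (rm P t1) (rm P t2)); repeat split; auto.
        -- simpl; apply reds_cong; auto using red_App1, red_App2.
        -- replace (n - S i) with 0 by lia. simpl.
           assert (memb i (P c) = false) as ->; auto.
           apply memb_false; intros Hi; specialize (Hn _ Hi); lia.
      * destruct Hx as (A & b & -> & Hx).
        exists (inst (rm P t2) b); repeat split; auto.
        -- simpl. eapply reds_trans; [apply reds_cong; auto using red_App1, red_App2;
             eassumption|]. eapply reds_step; [apply red_beta|apply reds_refl].
        -- replace (n - S i) with p by lia.
           apply (expands_subst c p _ _ _ (scons (rm P t2) Var)) in Hx.
           destruct (memb i (P c)); simpl in Hx;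
             change (subst _ (shift 1 (rm P t1))) with
               (inst (rm P t2) (shift 1 (rm P t1))) in Hx;
             rewrite inst_shift in Hx; exact Hx.
    + simpl; apply reds_cong; auto using red_App1, red_App2.
Qed.

Lemma reds_rm x t : over (expansion x) t -> saturated P 0 t ->
  reds (hom x t) (rm P t).
Proof.
  intros Ho Hs; eapply spine_reds_saturated, spine_reds_rm; eauto.
Qed.
End Removal.

(** * The operator on theories *)

Lemma rel_over (N : name -> Prop) m r m' r' t :
  (forall c, N c -> m c = m' c /\ r c = r' c) -> over N t ->
  forall e, rel m r e t = rel m' r' e t.
Proof.
  intros H. assert (Hh : forall t, over N t -> hom m t = hom m' t).
  { intros t0; apply hom_over; intros; now apply H. }
  induction t; intros Ho e; cbn [rel]; auto.
  - now apply H.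
  - rewrite !Hh by (simpl in *; tauto). destruct Ho as [Ho1 Ho2].
    rewrite (IHt1 Ho1), !(IHt2 Ho2). reflexivity.
  - rewrite !Hh by (simpl in *; tauto). destruct Ho as [Ho1 Ho2].
    rewrite (IHt1 Ho1), !(IHt2 Ho2). reflexivity.
  - rewrite !Hh by (simpl in *; tauto). destruct Ho as [Ho1 Ho2].
    rewrite (IHt1 Ho1), !(IHt2 Ho2). reflexivity.
Qed.

Lemma over_and (N N' : name -> Prop) t :
  over N t -> over N' t -> over (fun c => N c /\ N' c) t.
Proof. induction t; simpl; intuition auto. Qed.

Lemma typing_over Sg :
  (forall G, wf_ctx Sg G -> True) /\
  (forall G K, is_kind Sg G K -> over (in_sig Sg) K) /\
  (forall G t A, has_type Sg G t A -> over (in_sig Sg) t).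
Proof.
  apply typing_mut; simpl; intros; auto. exists A, o; auto.
Qed.

Lemma lookup_Some Sg c A : lookup c Sg = Some A -> exists o, In (c, A, o) Sg.
Proof.
  induction Sg as [|[[d B] o'] S IH]; simpl; [discriminate|].
  destruct (Nat.eqb_spec c d).
  - intros E; injection E as <-; subst; eauto.
  - intros E; destruct (IH E); eauto.
Qed.

Lemma type_back Sg0 Sg A : wfs Sg0 -> wfs Sg -> incl Sg0 Sg ->
  cls Sg0 [] A -> ht Sg [] A (Some Typ) -> ht Sg0 [] A (Some Typ).
Proof.
  intros H0 Hs Hi (s & [-> | ->] & H) HA; auto. exfalso.
  apply (ht_mono _ _ _ _ _ Hi) in H.
  apply (fam_excl (famc Sg) A).
  - exact (ht_kind_fam Sg [] A Hs (wfc_nil _) H).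
  - exact (ht_type_fam Sg [] A Hs (wfc_nil _) HA).
Qed.

Lemma rel_ok_mono Sg Sg' Sg'' m r : incl Sg' Sg'' ->
  rel_ok Sg Sg' m r -> rel_ok Sg Sg'' m r.
Proof.
  intros Hi H c A o Hin; destruct (H _ _ _ Hin) as [H1 H2]; split.
  - intros p E; destruct (H1 p E) as (rA & ? & ?); eauto using ht_mono.
  - intros t E; specialize (H2 t E).
    destruct (r c), (rel m r [] t); eauto using conv_mono.
Qed.

Lemma mor_ok_mono Sg Sg' Sg'' m : incl Sg' Sg'' ->
  mor_ok Sg Sg' m -> mor_ok Sg Sg'' m.
Proof.
  intros Hi H c A o Hin; destruct (H _ _ _ Hin); split; eauto using ht_mono, conv_mono.
Qed.

Lemma lrel_mono Sg Sg' Sg'' m r : wfs Sg'' -> incl Sg' Sg'' ->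
  lrel Sg Sg' m r -> lrel Sg Sg'' m r.
Proof.
  intros Hs Hi []; split; eauto using mor_ok_mono, rel_ok_mono.
Qed.

Lemma includes_over_tincl X E0 E1 : includes_over X (tincl E0 E1) ->
  includes_over X E0 /\ (E1 = X \/ E1 <> X /\ includes X E1 /\ includes_over X E1).
Proof.
  intros [H1 H2]; split; auto. destruct (theory_eq_dec E1 X); [auto|].
  destruct H2; tauto.
Qed.

Lemma own_flat X E d : In d (own X E) -> In d (flat E).
Proof.
  induction E; simpl; auto.
  - intros [H|H]; auto.
  - destruct (theory_eq_dec E2 X); intros H; apply in_or_app; auto.
    apply in_app_or in H as [H|H]; auto.
Qed.

Lemma flat_own X E d : includes_over X E -> In d (flat E) ->
  In d (own X E) \/ includes X E /\ In d (flat X).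
Proof.
  induction E; intros Ho H; auto.
  - destruct H as [H|H]; simpl; auto. destruct (IHE Ho H); auto.
  - apply includes_over_tincl in Ho as [Ho1 Ho2]; simpl in *.
    apply in_app_or in H as [H|H].
    + destruct Ho2 as [->|(Hn & Hi & Ho2)]; [right; auto|].
      destruct (theory_eq_dec E2 X); [easy|].
      destruct (IHE2 Ho2 H) as [J|J]; [left; apply in_or_app|right]; tauto.
    + destruct (IHE1 Ho1 H) as [J|J]; [left|right; tauto].
      destruct (theory_eq_dec E2 X); auto. apply in_or_app; auto.
Qed.

Lemma hom_at_conv Sg g R s : closed_asg g ->
  conv Sg (hom g (at_ R s)) (App (hom g R) (hom g s)).
Proof.
  intros Hg; destruct R; simpl; auto with conv.
  rewrite hom_inst by easy. auto with conv.
Qed.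

(** Agreement at the constants includes definedness, so both translations open the same binders and
    can be compared componentwise. *)
Lemma rel_natural (N : name -> Prop) Sg m1 r1 m2 r2 f g t :
  (forall c A v, In (c, A, Some v) Sg -> closed v) ->
  closed_asg m1 -> closed_asg m2 -> closed_asg f -> closed_asg g ->
  closed_rel r1 -> closed_rel r2 ->
  (forall c, N c -> conv Sg (hom g (m1 c)) (hom m2 (f c)) /\
     match r1 c, rel m2 r2 [] (f c) with
     | Some p, Some q => conv Sg (hom g p) q
     | None, None => True
     | _, _ => False
     end) ->
  over N t -> forall e,
  match rel m1 r1 e t, rel m2 r2 e (hom f t) with
  | Some p, Some q => conv Sg (hom g p) q
  | None, None => True
  | _, _ => False
  end.
Proof.
  intros Hd Hm1 Hm2 Hf Hg Hr1 Hr2 H.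
  assert (M : forall e t, over N t ->
    conv Sg (hom g (ren (emb e) (hom m1 t))) (ren (emb e) (hom m2 (hom f t)))).
  { intros e t0 Ht; rewrite hom_ren by easy. apply conv_ren; auto.
    rewrite !hom_hom. apply hom_conv with N; auto. intros; now apply H. }
  assert (A : forall R R' s s', conv Sg (hom g R) R' -> conv Sg (hom g s) s' ->
    conv Sg (hom g (at_ R s)) (at_ R' s')).
  { intros R R' s s' HR Hs. eapply conv_trans; [now apply hom_at_conv|].
    eapply conv_trans; [|apply conv_sym, conv_at_App]. auto with conv. }
  induction t; intros Ho e; cbn [rel hom].
  - apply conv_refl.
  - rewrite rel_closed by auto. now apply H.
  - destruct (star_var e n); simpl; auto with conv.
  - destruct Ho as [Ho1 Ho2].
    assert (MP := M e (Pi t1 t2) (conj Ho1 Ho2)). cbn [hom] in MP.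
    specialize (IHt1 Ho1 e).
    destruct (rel m1 r1 e t1) as [p|], (rel m2 r2 e (hom f t1)) as [q|]; try easy.
    + specialize (IHt2 Ho2 (true :: e)).
      destruct (rel m1 r1 (true :: e) t2) as [p2|],
        (rel m2 r2 (true :: e) (hom f t2)) as [q2|]; try easy.
      cbn [hom]. apply conv_Lam, conv_Pi; [|apply conv_Pi].
      * rewrite hom_shift by easy. apply conv_ren; auto.
      * apply A; [|apply conv_refl]. rewrite hom_shift by easy. apply conv_ren; auto.
      * apply A; [|apply conv_refl]. rewrite hom_ren by easy. apply conv_ren; auto.
    + specialize (IHt2 Ho2 (false :: e)).
      destruct (rel m1 r1 (false :: e) t2) as [p2|],
        (rel m2 r2 (false :: e) (hom f t2)) as [q2|]; try easy.
      cbn [hom]. apply conv_Lam, conv_Pi.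
      * rewrite hom_shift by easy. apply conv_ren; auto.
      * apply A; [|apply conv_refl]. rewrite hom_ren by easy. apply conv_ren; auto.
  - destruct Ho as [Ho1 Ho2]. specialize (IHt1 Ho1 e).
    destruct (rel m1 r1 e t1) as [p|], (rel m2 r2 e (hom f t1)) as [q|]; try easy.
    + specialize (IHt2 Ho2 (true :: e)).
      destruct (rel m1 r1 (true :: e) t2) as [p2|],
        (rel m2 r2 (true :: e) (hom f t2)) as [q2|]; try easy.
      cbn [hom]. now apply conv_Lam, conv_Lam.
    + specialize (IHt2 Ho2 (false :: e)).
      destruct (rel m1 r1 (false :: e) t2) as [p2|],
        (rel m2 r2 (false :: e) (hom f t2)) as [q2|]; try easy.
      cbn [hom]. now apply conv_Lam.
  - destruct Ho as [Ho1 Ho2]. specialize (IHt1 Ho1 e). specialize (IHt2 Ho2 e).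
    destruct (rel m1 r1 e t1) as [p|], (rel m2 r2 e (hom f t1)) as [q|]; try easy.
    destruct (rel m1 r1 e t2) as [p2|], (rel m2 r2 e (hom f t2)) as [q2|]; try easy;
      cbn [hom]; auto with conv.
Qed.

Lemma includes_flat X E : includes X E -> incl (flat X) (flat E).
Proof.
  induction E; simpl; [easy| |].
  - intros H; apply incl_tl; auto.
  - intros [->|[H|H]]; [apply incl_appl, incl_refl|apply incl_appl|apply incl_appr]; auto.
Qed.

Fixpoint theory_size (E : theory) : nat :=
  match E with
  | tnil => 0
  | tconst E0 _ _ _ => S (theory_size E0)
  | tincl E0 E1 => S (theory_size E0 + theory_size E1)
  end.

Lemma includes_size X E : includes X E -> theory_size X < theory_size E.
Proof.
  induction E; simpl; [easy| |].
  - intros H; specialize (IHE H); lia.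
  - intros [->|[H|H]]; [|specialize (IHE2 H)|specialize (IHE1 H)]; lia.
Qed.

(** * The operator for fixed data: expansions, the invariant, induction over theories *)

Section LR.
Variables (Sc Tg : theory) (m : assignment) (r : relation)
  (star : name -> name) (ch : choice).
Hypotheses (wf_Sc : wf_theory Sc) (wf_Tg : wf_theory Tg)
  (mor_m : morphism (flat Sc) (flat Tg) m)
  (rel_r : log_rel (flat Sc) (flat Tg) m r)
  (tot_r : term_total (flat Sc) m r)
  (star_inj : forall c d, star c = star d -> c = d)
  (Tg_kept : forall c, In c (names Tg) -> removed ch c = []).

#[local] Notation P := (removed ch).
#[local] Notation po := (po_mor Sc m).
#[local] Notation nrm A := (norm ch (hom po A)).
#[local] Notation ind := (ind_mor Sc m ch).
#[local] Notation lrr := (lr_rel Sc m r star ch).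
#[local] Notation lr := (lr_thy Sc Tg m r star ch).
#[local] Notation poT := (po_thy Sc Tg m).

Definition fresh_own (E : theory) : Prop :=
  forall d, In d (own Sc E) ->
    ~ In (dname d) (names Sc) /\ ~ In (dname d) (names Tg) /\
    ~ In (star (dname d)) (names Tg) /\
    (forall d', In d' (own Sc E) -> dname d' <> star (dname d)).

Lemma Sc_wfs : wfs (flat Sc).
Proof. now apply wf_theory_wfs. Qed.
Lemma Tg_wfs : wfs (flat Tg).
Proof. now apply wf_theory_wfs. Qed.

Lemma In_names E c A o : In (c, A, o) (flat E) -> In c (names E).
Proof. intros H; apply names_In; eauto. Qed.

Lemma in_sig_names_theory E c : in_sig (flat E) c <-> In c (names E).
Proof. symmetry; apply names_In. Qed.

Lemma m_ok : mor_ok (flat Sc) (flat Tg) m.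
Proof. apply morphism_ok; auto using Tg_wfs. Qed.

Lemma m_closed c : In c (names Sc) -> closed (m c).
Proof.
  intros H; apply names_In in H as (A & o & H).
  eapply ht_closed. apply (m_ok _ _ _ H).
Qed.

Lemma m_over c : In c (names Sc) -> over (in_sig (flat Tg)) (m c).
Proof.
  intros H; apply names_In in H as (A & o & H).
  eapply ht_over. apply (m_ok _ _ _ H).
Qed.

Lemma r_ok : rel_ok (flat Sc) (flat Tg) m r.
Proof.
  intros c A o H; destruct (rel_r _ _ _ H) as [H1 H2]; split; auto.
  intros p E; destruct (H1 p E) as (rA & ? & ?); exists rA; split; auto.
  apply has_type_ht; auto using Tg_wfs.
Qed.

Lemma lrr_closed E : closed_rel (lrr E).
Proof.
  induction E; intros c p H; simpl in H; [discriminate| |].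
  - destruct (Nat.eqb c n); [|eauto].
    destruct (starred _ _ _ _); [|discriminate]. injection H as <-. easy.
  - destruct (memb c (names E2)) eqn:Ec; [|eauto].
    destruct (theory_eq_dec E2 Sc) as [->|]; [|eauto].
    apply memb_In, names_In in Ec as (A & o & Ec).
    destruct (r_ok _ _ _ Ec) as [J _]. destruct (J p H) as (rA & _ & Hp).
    eapply ht_closed; eauto.
Qed.

(** [N] tells how many bindings to keep in the expansion of a constant. *)
Definition binding_count (N : name -> expr -> nat) : Prop :=
  forall c A, (forall j, In j (P c) -> j < pis A) ->
    (forall j, In j (P c) -> j < N c A) /\ N c A <= pis A.

(** The length of the expansions in [ind_mor], see [ind_xm]. *)
Definition full_count (c : name) (A : expr) : nat :=
  match P c with [] => 0 | _ => pis A end.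

(** One past the last removed position, or 0 if there is none. *)
Definition min_count (c : name) (A : expr) : nat := list_max (map S (P c)).

Lemma full_count_ok : binding_count full_count.
Proof.
  intros c A H; unfold full_count; destruct (P c); simpl in *; split; auto;
    [easy|lia].
Qed.

Lemma min_count_le c A k : (forall j, In j (P c) -> j < k) -> min_count c A <= k.
Proof.
  intros H; apply list_max_le, Forall_forall. intros x Hx.
  apply in_map_iff in Hx as (j & <- & Hj). now apply H.
Qed.

Lemma min_count_ok : binding_count min_count.
Proof.
  intros c A H; split; [|now apply min_count_le].
  intros j Hj. unfold min_count.
  pose proof (proj1 (list_max_le (map S (P c)) _) (le_n _)) as F.
  rewrite Forall_forall in F. apply F. now apply in_map.
Qed.

Definition xm (N : name -> expr -> nat) (E : theory) : assignment :=
  fun c =>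
    if memb c (names Sc) then m c
    else match lookup c (flat E) with
         | Some A => expandn P c (N c (nrm A)) 0 (nrm A) (Con c)
         | None => Con c
         end.

Lemma ind_xm E : ind E = xm full_count E.
Proof.
  extensionality c; unfold ind_mor, xm, full_count.
  destruct (memb c (names Sc)); auto. destruct (lookup c (flat E)).
  - destruct (P c) eqn:Ec; auto. rewrite <- expand_expandn. reflexivity.
  - now destruct (P c).
Qed.

Lemma xm_Sc N E c : In c (names Sc) -> xm N E c = m c.
Proof. intros H; unfold xm. apply memb_In in H; now rewrite H. Qed.

Lemma xm_eq N E c A o : wfs (flat E) -> ~ In c (names Sc) -> In (c, A, o) (flat E) ->
  xm N E c = expandn P c (N c (nrm A)) 0 (nrm A) (Con c).
Proof.
  intros Hs Hc Hin; unfold xm. apply memb_false in Hc; rewrite Hc.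
  now rewrite (lookup_wfs _ _ _ _ Hs Hin).
Qed.

Lemma xm_agree N E E' c d : wfs (flat E) -> wfs (flat E') ->
  In d (flat E) -> In d (flat E') -> dname d = c -> xm N E c = xm N E' c.
Proof.
  intros Hs Hs' H H' <-. destruct d as [[c A] o]; unfold dname; simpl.
  unfold xm. now rewrite (lookup_wfs _ _ _ _ Hs H), (lookup_wfs _ _ _ _ Hs' H').
Qed.

Lemma xm_incl N E E' c : wfs (flat E) -> wfs (flat E') -> incl (flat E) (flat E') ->
  in_sig (flat E) c -> xm N E' c = xm N E c.
Proof.
  intros Hs Hs' Hi (A & o & H). symmetry.
  now apply (xm_agree N E E' c (c, A, o)); [| |  |apply Hi|].
Qed.

Lemma hom_xm_incl N E E' t : wfs (flat E) -> wfs (flat E') -> incl (flat E) (flat E') ->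
  over (in_sig (flat E)) t -> hom (xm N E') t = hom (xm N E) t.
Proof.
  intros Hs Hs' Hi; apply hom_over. intros; now apply xm_incl.
Qed.

(** Second half of a factorisation: on expressions over [E], [xm N E] is [po] followed by [ex N E]
    ([ex_po]). It is the morphism from the plain pushout to [LR E] by which the typing of normal
    forms is transported. *)
Definition ex (N : name -> expr -> nat) (E : theory) : assignment :=
  fun c => if memb c (names Tg) then Con c else xm N E c.

Lemma hom_ex_Tg N E t : over (in_sig (flat Tg)) t -> hom (ex N E) t = t.
Proof.
  apply hom_over_id. intros c Hc; unfold ex.
  apply in_sig_names_theory, memb_In in Hc; now rewrite Hc.
Qed.

Record ok (E : theory) : Prop := {
  ok_wf : wf_theory E;
  ok_over : includes_over Sc E;
  ok_fresh : fresh_own E;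
  ok_good : good_for_theory Sc Tg m ch E
}.

Lemma ok_wfs E : ok E -> wfs (flat E).
Proof. intros H; apply wf_theory_wfs, H. Qed.

Lemma ex_po E N t : ok E -> over (in_sig (flat E)) t ->
  hom (ex N E) (hom po t) = hom (xm N E) t.
Proof.
  intros H Ht. rewrite hom_hom. apply hom_over with (in_sig (flat E)); auto.
  intros c (A & o & Hc). unfold po_mor.
  destruct (memb c (names Sc)) eqn:Ec.
  - apply memb_In in Ec. rewrite hom_ex_Tg by now apply m_over. now rewrite xm_Sc.
  - simpl. destruct (flat_own _ _ _ (ok_over _ H) Hc) as [J|[_ J]].
    + destruct (ok_fresh _ H _ J) as (_ & Hn & _). unfold ex.
      apply memb_false in Hn; unfold dname in Hn; simpl in Hn; now rewrite Hn.
    + apply In_names, memb_In in J; congruence.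
Qed.

Lemma flat_po E d : includes_over Sc E -> In d (flat (poT E)) ->
  includes Sc E /\ In d (flat Tg) \/
  exists c A o, In (c, A, o) (own Sc E) /\ d = (c, hom po A, option_map (hom po) o).
Proof.
  induction E; intros Ho H; simpl in H; [easy| |].
  - destruct H as [<-|H].
    + right; exists n, e, o; simpl; auto.
    + destruct (IHE Ho H) as [J|(c & A & o' & J & ->)]; auto.
      right; exists c, A, o'; simpl; auto.
  - apply includes_over_tincl in Ho as [Ho1 Ho2]; simpl.
    apply in_app_or in H as [H|H].
    + destruct (theory_eq_dec E2 Sc) as [Es|Es]; [left; auto|].
      destruct Ho2 as [|(_ & Hi & Ho2)]; [easy|].
      destruct (IHE2 Ho2 H) as [J|(c & A & o' & J & ->)]; [left; tauto|].
      right; exists c, A, o'; split; auto. apply in_or_app; auto.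
    + destruct (IHE1 Ho1 H) as [J|(c & A & o' & J & ->)]; [left; tauto|].
      right; exists c, A, o'; split; auto.
      destruct (theory_eq_dec E2 Sc); auto. apply in_or_app; auto.
Qed.

Lemma lr_tconst_incl E0 c A o : incl (flat (lr E0)) (flat (lr (tconst E0 c A o))).
Proof.
  simpl. destruct (rel _ _ _ A), o as [t|]; try destruct (rel _ _ _ t); simpl;
    auto with datatypes.
Qed.

Lemma Tg_incl E : includes Sc E -> incl (flat Tg) (flat (lr E)).
Proof.
  induction E; intros H; [easy| |].
  - eapply incl_tran; [apply IHE, H|apply lr_tconst_incl].
  - simpl in *. destruct (theory_eq_dec E2 Sc); [apply incl_appl, incl_refl|].
    destruct H as [H|[H|H]]; [easy|apply incl_appl; auto|apply incl_appr; auto].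
Qed.

(** Refers to the final [ind E] and [lrr E] instead of those at the moment of declaration, so that
    declarations arriving along different includes can be compared. *)
Definition starred_decl (E : theory) (c : name) (A : expr) (o : option expr)
    (d : decl) : Prop :=
  exists rA, rel (ind E) (lrr E) [] A = Some rA /\
    match o with
    | None => d = (star c, at_ rA (ind E c), None)
    | Some t => exists rt, rel (ind E) (lrr E) [] t = Some rt /\
        d = (star c, at_ rA (ind E c), Some rt)
    end.

Lemma starred_decl_intro E c A o rA ot :
  rel (ind E) (lrr E) [] A = Some rA ->
  (o = None /\ ot = None \/
   exists t rt, o = Some t /\ rel (ind E) (lrr E) [] t = Some rt /\ ot = Some rt) ->
  starred_decl E c A o (star c, at_ rA (ind E c), ot).
Proof.
  intros HA H; exists rA; split; auto.
  destruct H as [[-> ->]|(t & rt & -> & Ht & ->)]; eauto.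
Qed.

Lemma starred_decl_facts E c A o d : starred_decl E c A o d ->
  dname d = star c /\ starred (ind E) (lrr E) A o = true.
Proof.
  unfold starred; intros (rA & -> & H). destruct o as [t|]; [|now subst].
  now destruct H as (rt & -> & ->).
Qed.

Definition po_decl (c : name) (A : expr) (o : option expr) : decl :=
  (c, po_type Sc m ch c A, option_map (po_value Sc m ch c) o).

Definition own_ok (E : theory) (c : name) (A : expr) (o : option expr) : Prop :=
  let Sg := flat (lr E) in
  In (po_decl c A o) Sg /\ cls Sg [] (rm P (nrm A)) /\
  conv Sg (hom (ind E) A) (rm P (nrm A)) /\
  unused_in_type P c (nrm A) /\
  (forall t, o = Some t ->
     conv Sg (hom (ind E) t) (rm P (nrm t)) /\ unused_in_value P c (nrm t)).

Definition lr_decl (E : theory) (d : decl) : Prop :=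
  In d (flat Tg) \/
  exists c A o, In (c, A, o) (own Sc E) /\
    (d = po_decl c A o \/ starred_decl E c A o d).

(** [inv_mor] covers every count, because the next removal is typed with [min_count] while [ind] is
    the case of [full_count]. [inv_decl] lists the origins of all names, as needed for freshness and
    for the compatibility of includes. *)
Record inv (E : theory) : Prop := {
  inv_wf : wf_theory (lr E);
  inv_mor : forall N, binding_count N -> mor_ok (flat E) (flat (lr E)) (xm N E);
  inv_rel : rel_ok (flat E) (flat (lr E)) (ind E) (lrr E);
  inv_tot : forall c A o, In (c, A, o) (flat E) -> ht (flat E) [] A (Some Typ) ->
    rel (ind E) (lrr E) [] A <> None -> lrr E c <> None;
  inv_own : forall c A o, In (c, A, o) (own Sc E) -> own_ok E c A o;
  inv_lrr : forall c A o, In (c, A, o) (own Sc E) ->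
    lrr E c = if starred (ind E) (lrr E) A o then Some (Con (star c)) else None;
  inv_lrr_Sc : forall c, In c (names Sc) -> In c (names E) -> lrr E c = r c;
  inv_decl : forall d, In d (flat (lr E)) -> lr_decl E d
}.

Lemma inv_wfs E : inv E -> wfs (flat (lr E)).
Proof. intros H; apply wf_theory_wfs, H. Qed.

Lemma xm_closed N E : binding_count N -> inv E -> closed_asg (xm N E).
Proof.
  intros HN H c. destruct (in_dec Nat.eq_dec c (names Sc)) as [Hc|Hc].
  - rewrite xm_Sc by easy. now apply m_closed.
  - destruct (lookup c (flat E)) as [A|] eqn:El.
    + apply lookup_Some in El as (o & Hin).
      eapply ht_closed. apply (inv_mor _ H N HN _ _ _ Hin).
    + unfold xm. apply memb_false in Hc; rewrite Hc, El. easy.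
Qed.

Lemma ex_closed N E : binding_count N -> inv E -> closed_asg (ex N E).
Proof.
  intros HN H c; unfold ex. destruct (memb c (names Tg)); [easy|].
  now apply xm_closed.
Qed.

Lemma po_mor_ok N E : ok E -> inv E -> binding_count N ->
  mor_ok (flat (poT E)) (flat (lr E)) (ex N E).
Proof.
  intros Hok Hi HN c A o Hin.
  destruct (flat_po _ _ (ok_over _ Hok) Hin) as [[HSc HTg]|(c' & A' & o' & Hown & E')].
  - pose proof (Tg_incl _ HSc _ HTg) as Hin'.
    assert (Hc : ex N E c = Con c).
    { unfold ex. apply In_names, memb_In in HTg; now rewrite HTg. }
    rewrite Hc, hom_ex_Tg by (eapply cls_over, cls_In; eauto using Tg_wfs).
    split; [econstructor; eauto|]. intros t ->.
    rewrite hom_ex_Tg by (eapply ht_over, ht_In_def; eauto using Tg_wfs).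
    eapply conv_delta; eauto.
  - injection E' as -> -> ->.
    pose proof (own_flat _ _ _ Hown) as Hf.
    destruct (ok_fresh _ Hok _ Hown) as (HnS & HnT & _).
    unfold dname in HnS, HnT; simpl in HnS, HnT.
    destruct (inv_mor _ Hi N HN _ _ _ Hf) as [H1 H2].
    assert (Hc : ex N E c' = xm N E c').
    { unfold ex. apply memb_false in HnT; now rewrite HnT. }
    pose proof (ok_wfs _ Hok) as Hs.
    rewrite Hc, ex_po by (auto; eapply cls_over, cls_In; eauto).
    split; auto. intros t Et. destruct o' as [t'|]; [|discriminate].
    injection Et as <-. rewrite ex_po by (auto; eapply ht_over, ht_In_def; eauto).
    auto.
Qed.

Lemma ex_expansion E c : ok E -> in_sig (flat (poT E)) c ->
  (forall c A o, In (c, A, o) (own Sc E) -> unused_in_type P c (nrm A)) ->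
  expansion P (ex min_count E) c.
Proof.
  intros Hok (A & o & Hin) Hu.
  destruct (flat_po _ _ (ok_over _ Hok) Hin) as [[_ HTg]|(c' & A' & o' & Hown & E')].
  - apply In_names in HTg. unfold ex. exists 0.
    pose proof HTg as HTg'. apply memb_In in HTg' as ->.
    rewrite (Tg_kept _ HTg); simpl; repeat split; auto; try easy. intros; lia.
  - injection E' as -> -> ->. pose proof (own_flat _ _ _ Hown) as Hf.
    destruct (ok_fresh _ Hok _ Hown) as (HnS & HnT & _).
    unfold dname in HnS, HnT; simpl in HnS, HnT.
    destruct (Hu _ _ _ Hown) as (_ & _ & Hb & _).
    destruct (min_count_ok c' (nrm A') Hb) as [Hm1 Hm2].
    exists (min_count c' (nrm A')). unfold ex. apply memb_false in HnT; rewrite HnT.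
    rewrite (xm_eq min_count E c' A' o' (ok_wfs _ Hok) HnS Hf). repeat split; auto.
    + now apply expands_expandn.
    + intros k Hk. now apply min_count_le.
Qed.

(** Transfers the typing of a normal form in the pushout to the result of the
    removal of arguments: [ex min_count] preserves typing, and what it yields
    beta-reduces to the latter. *)
Lemma removal_typing E t T : ok E -> inv E -> saturated P 0 t ->
  over (in_sig (flat (poT E))) t ->
  ht (flat (lr E)) [] (hom (ex min_count E) t) T ->
  ht (flat (lr E)) [] (rm P t) T /\ forall N, binding_count N ->
    conv (flat (lr E)) (hom (ex N E) t) (rm P t).
Proof.
  intros Hok Hi Hsat Ho Ht.
  pose proof (inv_wfs _ Hi) as Hs.
  assert (R : reds (hom (ex min_count E) t) (rm P t)).
  { apply reds_rm; auto. eapply over_mono; [|exact Ho].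
    intros c Hc; apply ex_expansion; auto. intros c' A o H.
    now destruct (inv_own _ Hi _ _ _ H) as (_ & _ & _ & Hu & _). }
  split; [eapply ht_reds; eauto; constructor|].
  intros N HN. apply conv_trans with (hom (ex min_count E) t); [|now apply reds_conv].
  apply hom_conv with (in_sig (flat (poT E))); auto.
  intros c (A & o & Hin). unfold ex.
  destruct (memb c (names Tg)) eqn:Ec; [apply conv_refl|].
  destruct (flat_po _ _ (ok_over _ Hok) Hin) as [[_ HTg]|(c' & A' & o' & Hown & E')].
  - apply In_names, memb_In in HTg; congruence.
  - injection E' as -> -> ->. pose proof (own_flat _ _ _ Hown) as Hf.
    destruct (ok_fresh _ Hok _ Hown) as (HnS & _).
    unfold dname in HnS; simpl in HnS.
    rewrite !(xm_eq _ E c' A' o' (ok_wfs _ Hok) HnS Hf).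
    destruct (inv_own _ Hi _ _ _ Hown) as (_ & _ & _ & (_ & _ & Hb & _) & _).
    destruct (HN c' _ Hb) as [Hn _]. destruct (min_count_ok c' _ Hb) as [Hm _].
    apply expandn_conv; eauto; intros j Hj _; simpl; auto.
Qed.

(** Not an equality, since [g] acts on the labels; conversion ignores these. *)
Lemma hom_expandn_conv Sg g c n : closed_asg g -> forall j A h,
  conv Sg (hom g (expandn P c n j A h)) (expandn P c n j A (hom g h)).
Proof.
  intros Hg; induction n; intros j A h; simpl; auto with conv.
  destruct A; simpl; auto with conv. apply conv_Lam.
  eapply conv_trans; [apply IHn|].
  destruct (memb j (P c)); simpl; rewrite hom_shift by easy; apply conv_refl.
Qed.

Lemma po_typing E N : ok E -> inv E -> binding_count N ->
  (forall t u, conv (flat (poT E)) t u ->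
     conv (flat (lr E)) (hom (ex N E) t) (hom (ex N E) u)) /\
  (forall t A, has_type (flat (poT E)) [] t A ->
     over (in_sig (flat (poT E))) t /\
     ht (flat (lr E)) [] (hom (ex N E) t) (Some (hom (ex N E) A))) /\
  (forall A, classifier (flat (poT E)) A ->
     over (in_sig (flat (poT E))) A /\ cls (flat (lr E)) [] (hom (ex N E) A)).
Proof.
  intros Hok Hi HN.
  pose proof (po_mor_ok N E Hok Hi HN) as Hm.
  pose proof (ex_closed N E HN Hi) as Hc.
  pose proof (typing_hom _ _ _ (inv_wfs _ Hi) Hc Hm) as (_ & HK & HT).
  pose proof (typing_over (flat (poT E))) as (_ & OK & OT).
  repeat split.
  - intros t u; now apply mor_ok_conv.
  - eapply OT; eauto.
  - now apply HT in H.
  - destruct H as [H|H]; [eapply OT|eapply OK]; eauto.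
  - destruct H as [H|H]; [exists (Some Typ)|exists None]; split; auto.
    + now apply HT in H.
    + now apply HK in H.
Qed.

Lemma inv_lrel E : ok E -> inv E -> lrel (flat E) (flat (lr E)) (ind E) (lrr E).
Proof.
  intros Hok Hi; split.
  - now apply ok_wfs.
  - now apply inv_wfs.
  - rewrite ind_xm; apply xm_closed; auto using full_count_ok.
  - apply lrr_closed.
  - rewrite ind_xm; apply inv_mor; auto using full_count_ok.
  - now apply inv_rel.
  - intros c A o Hin Hf. apply (inv_tot _ Hi _ _ _ Hin).
    destruct (fam_kind_sort (flat E) A) as [J|[_ J]]; auto.
    + now apply ok_wfs.
    + eapply cls_In; eauto; now apply ok_wfs.
    + exfalso; eapply fam_excl; eauto.
Qed.

Lemma ok_tconst E0 c A o : ok (tconst E0 c A o) -> ok E0.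
Proof.
  intros [Hw Ho Hf Hg]; split.
  - now inversion Hw.
  - exact Ho.
  - intros d Hd; destruct (Hf d) as (H1 & H2 & H3 & H4); [simpl; auto|].
    repeat split; auto. intros; apply H4; simpl; auto.
  - apply Hg.
Qed.

Lemma starred_true m0 r0 A o : rel m0 r0 [] A <> None ->
  (forall t, o = Some t -> is_some (rel m0 r0 [] t) = is_some (rel m0 r0 [] A)) ->
  starred m0 r0 A o = true.
Proof.
  unfold starred; intros HA Ho. destruct (rel m0 r0 [] A); [|congruence].
  destruct o as [t|]; auto. specialize (Ho t eq_refl).
  now destruct (rel m0 r0 [] t).
Qed.

Lemma starred_over (N : name -> Prop) m0 r0 m1 r1 A o :
  (forall x, N x -> m1 x = m0 x /\ r1 x = r0 x) -> over N A ->
  (forall t, o = Some t -> over N t) -> starred m1 r1 A o = starred m0 r0 A o.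
Proof.
  intros H HA Ho; unfold starred.
  rewrite (rel_over N m1 r1 m0 r0 A H HA). destruct o as [t|]; auto.
  now rewrite (rel_over N m1 r1 m0 r0 t H (Ho t eq_refl)).
Qed.

(** Common interface of the prefixes of [E] and the extensions included in it: what was computed for
    [E0] remains valid in [E]. *)
Record part (E0 E : theory) : Prop := {
  part_wfs : wfs (flat E0);
  part_own : incl (own Sc E0) (own Sc E);
  part_lr : incl (flat (lr E0)) (flat (lr E));
  part_eq : forall x, in_sig (flat E0) x -> ind E x = ind E0 x /\ lrr E x = lrr E0 x
}.

Lemma part_rel E0 E t : part E0 E -> over (in_sig (flat E0)) t ->
  rel (ind E) (lrr E) [] t = rel (ind E0) (lrr E0) [] t.
Proof. intros H Ht; eapply rel_over; [apply H|exact Ht]. Qed.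

Lemma part_hom E0 E t : part E0 E -> over (in_sig (flat E0)) t ->
  hom (ind E) t = hom (ind E0) t.
Proof. intros H; apply hom_over; intros; now apply (part_eq _ _ H). Qed.

Lemma over_type Sg c A o : wfs Sg -> In (c, A, o) Sg -> over (in_sig Sg) A.
Proof. intros Hs H; eapply cls_over, cls_In; eauto. Qed.

Lemma over_def Sg c A o t : wfs Sg -> In (c, A, o) Sg -> o = Some t ->
  over (in_sig Sg) t.
Proof. intros Hs H ->; eapply ht_over, ht_In_def; eauto. Qed.

Lemma part_own_ok E0 E c A o : part E0 E -> In (c, A, o) (own Sc E0) ->
  own_ok E0 c A o -> own_ok E c A o.
Proof.
  intros Hp Hin (H1 & H2 & H3 & H4 & H5).
  pose proof (own_flat _ _ _ Hin) as Hf.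
  pose proof (part_lr _ _ Hp) as Hl. pose proof (part_wfs _ _ Hp) as Hs.
  repeat split; auto; try apply H4.
  - eapply cls_mono; eauto.
  - rewrite (part_hom _ _ _ Hp) by (eapply over_type; eauto). eapply conv_mono; eauto.
  - rewrite (part_hom _ _ _ Hp) by (eapply over_def; eauto).
    eapply conv_mono; [eauto|]. now apply H5.
  - apply (H5 t H).
  - apply (H5 t H).
  - apply (H5 t H).
  - apply (H5 t H).
Qed.

Lemma part_starred E0 E c A o : part E0 E -> In (c, A, o) (flat E0) ->
  starred (ind E) (lrr E) A o = starred (ind E0) (lrr E0) A o.
Proof.
  intros Hp Hin. pose proof (part_wfs _ _ Hp) as Hs.
  apply starred_over with (in_sig (flat E0)); [apply Hp|eapply over_type; eauto|].
  intros; eapply over_def; eauto.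
Qed.

Lemma part_lr_decl E0 E d : part E0 E -> lr_decl E0 d -> lr_decl E d.
Proof.
  intros Hp [H|(c & A & o & Hown & H)]; [left; auto|right].
  exists c, A, o; split; [now apply (part_own _ _ Hp)|].
  pose proof (own_flat _ _ _ Hown) as Hf. pose proof (part_wfs _ _ Hp) as Hs.
  destruct H as [H|(rA & HrA & H)]; [left; auto|right].
  assert (Hc : ind E c = ind E0 c) by (apply (part_eq _ _ Hp); exists A, o; auto).
  exists rA; split.
  - now rewrite (part_rel _ _ _ Hp) by (eapply over_type; eauto).
  - rewrite Hc. destruct o as [t|]; auto. destruct H as (rt & Ht & H).
    exists rt; split; auto.
    now rewrite (part_rel _ _ _ Hp) by (eapply over_def; eauto).
Qed.

Lemma part_refl E : wfs (flat E) -> part E E.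
Proof. split; auto using incl_refl. Qed.

Lemma part_trans E1 E2 E3 : incl (flat E1) (flat E2) ->
  part E1 E2 -> part E2 E3 -> part E1 E3.
Proof.
  intros H [] []; split; eauto using incl_tran.
  intros x Hx. assert (Hx2 : in_sig (flat E2) x).
  { destruct Hx as (A & o & Hx); exists A, o; auto. }
  destruct (part_eq0 x Hx) as [<- <-]. auto.
Qed.

(** Stated for signatures in order to apply to [Sc] as well, with [m] and [r] as the given data. *)
Lemma rel_ok_part Sg0 Sg0' Sg' m0 r0 m1 r1 : wfs Sg0 -> incl Sg0' Sg' ->
  (forall x, in_sig Sg0 x -> m1 x = m0 x /\ r1 x = r0 x) ->
  rel_ok Sg0 Sg0' m0 r0 -> rel_ok Sg0 Sg' m1 r1.
Proof.
  intros Hs Hi He H c A o Hin. destruct (H _ _ _ Hin) as [H1 H2].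
  destruct (He c ltac:(exists A, o; auto)) as [-> ->]. split.
  - intros p E; destruct (H1 p E) as (rA & HrA & Hp). exists rA; split.
    + rewrite (rel_over (in_sig Sg0) m1 r1 m0 r0); auto. eapply over_type; eauto.
    + eapply ht_mono; eauto.
  - intros t E; specialize (H2 t E).
    rewrite (rel_over (in_sig Sg0) m1 r1 m0 r0) by (auto; eapply over_def; eauto).
    destruct (r0 c), (rel m0 r0 [] t); eauto using conv_mono.
Qed.

Lemma mor_ok_part Sg0 Sg0' Sg' m0 m1 : wfs Sg0 -> incl Sg0' Sg' ->
  (forall x, in_sig Sg0 x -> m1 x = m0 x) ->
  mor_ok Sg0 Sg0' m0 -> mor_ok Sg0 Sg' m1.
Proof.
  intros Hs Hi He H c A o Hin. destruct (H _ _ _ Hin) as [H1 H2].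
  rewrite (He c) by (exists A, o; auto).
  rewrite (hom_over (in_sig Sg0) m1 m0 A) by (auto; eapply over_type; eauto).
  split; [eapply ht_mono; eauto|]. intros t E.
  rewrite (hom_over (in_sig Sg0) m1 m0 t) by (auto; eapply over_def; eauto).
  eapply conv_mono; eauto.
Qed.

Lemma tot_part Sg0 Sg m0 r0 m1 r1 : wfs Sg0 -> wfs Sg -> incl Sg0 Sg ->
  (forall x, in_sig Sg0 x -> m1 x = m0 x /\ r1 x = r0 x) ->
  (forall c A o, In (c, A, o) Sg0 -> ht Sg0 [] A (Some Typ) ->
     rel m0 r0 [] A <> None -> r0 c <> None) ->
  forall c A o, In (c, A, o) Sg0 -> ht Sg [] A (Some Typ) ->
     rel m1 r1 [] A <> None -> r1 c <> None.
Proof.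
  intros Hs0 Hs Hi He H c A o Hin HA HrA.
  rewrite (rel_over (in_sig Sg0) m1 r1 m0 r0) in HrA by (auto; eapply over_type; eauto).
  destruct (He c ltac:(exists A, o; auto)) as [_ ->].
  eapply H; eauto. eapply type_back; eauto. eapply cls_In; eauto.
Qed.

Lemma lr_tconst_cases E0 c A o :
  let E := tconst E0 c A o in
  let E' := tconst (lr E0) c (po_type Sc m ch c A)
              (option_map (po_value Sc m ch c) o) in
  rel (ind E) (lrr E0) [] A = rel (ind E0) (lrr E0) [] A ->
  (forall t, o = Some t ->
     rel (ind E) (lrr E0) [] t = rel (ind E0) (lrr E0) [] t) ->
  (lr E = E' /\ starred (ind E0) (lrr E0) A o = false) \/
  exists rA ot, rel (ind E0) (lrr E0) [] A = Some rA /\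
    (o = None /\ ot = None \/
     exists t rt, o = Some t /\ rel (ind E0) (lrr E0) [] t = Some rt /\ ot = Some rt) /\
    lr E = tconst E' (star c) (at_ rA (ind E c)) ot /\
    starred (ind E0) (lrr E0) A o = true.
Proof.
  intros E E' HA Ht; unfold E; cbn [lr_thy]; fold E; unfold starred.
  rewrite HA. destruct (rel (ind E0) (lrr E0) [] A) as [rA|]; [|left; auto].
  destruct o as [t|].
  - rewrite (Ht t eq_refl).
    destruct (rel (ind E0) (lrr E0) [] t) as [rt|] eqn:Er; [|left; auto].
    right; exists rA, (Some rt); repeat split; auto. right; exists t, rt; auto.
  - right; exists rA, None; repeat split; auto.
Qed.

Lemma option_map_Some {X Y} (f : X -> Y) o y :
  option_map f o = Some y -> exists x, o = Some x /\ f x = y.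
Proof. destruct o as [x|]; [|discriminate]. intros E; injection E; eauto. Qed.

(** * Preservation of the invariant by a declaration *)

Section Tconst.
Variables (E0 : theory) (c : name) (A : expr) (o : option expr).
Hypotheses (Hok : ok (tconst E0 c A o)) (Hi : inv E0).

#[local] Notation E := (tconst E0 c A o).
#[local] Notation Sg0 := (flat (lr E0)).
#[local] Notation E' := (tconst (lr E0) c (po_type Sc m ch c A)
  (option_map (po_value Sc m ch c) o)).

#[local] Lemma init_ok : ok E0.
Proof. eapply ok_tconst, Hok. Qed.

#[local] Lemma init_wfs : wfs (flat E0).
Proof. apply ok_wfs, init_ok. Qed.

#[local] Lemma ext_wfs : wfs (flat E).
Proof. apply ok_wfs, Hok. Qed.

#[local] Lemma init_lr_wfs : wfs Sg0.
Proof. now apply inv_wfs. Qed.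

#[local] Lemma head_fresh : ~ In c (names E0) /\ ~ In c (names Sc) /\ ~ In c (names Tg) /\
  ~ In (star c) (names Tg) /\ star c <> c /\
  forall d, In d (own Sc E0) -> dname d <> star c /\ star (dname d) <> c.
Proof.
  pose proof (ok_fresh _ Hok) as F.
  destruct (F (c, A, o)) as (H1 & H2 & H3 & H4); [simpl; auto|].
  unfold dname in H1, H2, H3, H4; simpl in H1, H2, H3, H4.
  assert (Hc : ~ In c (names E0)) by (pose proof (ok_wf _ Hok) as W; now inversion W).
  repeat split; auto.
  - intros J; apply (H4 (c, A, o)); auto.
  - intros J; apply (H4 d); auto.
  - destruct (F d) as (_ & _ & _ & F4); [simpl; auto|].
    intros J; apply (F4 (c, A, o)); simpl; auto.
Qed.

#[local] Lemma head_type : cls (flat E0) [] A.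
Proof.
  pose proof (ok_wf _ Hok) as W; inversion W; subst.
  apply classifier_cls; auto using init_wfs.
Qed.

#[local] Lemma head_def t : o = Some t -> ht (flat E0) [] t (Some A).
Proof.
  pose proof (ok_wf _ Hok) as W; inversion W; subst; intros Ho.
  apply has_type_ht; auto using init_wfs.
Qed.

#[local] Lemma type_facts : cls Sg0 [] (rm P (nrm A)) /\
  (forall N, binding_count N -> conv Sg0 (hom (xm N E0) A) (rm P (nrm A))) /\
  unused_in_type P c (nrm A) /\ cls Sg0 [] (po_type Sc m ch c A).
Proof.
  destruct (ok_good _ Hok) as [_ (Hc & Hcl & Hu & _)].
  destruct (po_typing E0 min_count init_ok Hi min_count_ok) as (_ & _ & J).
  destruct (J _ Hcl) as (Ho & s & Hsort & Hs).
  pose proof Hu as (_ & Hsat & Hb & Hp).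
  destruct (removal_typing E0 (nrm A) s init_ok Hi Hsat Ho Hs) as [R1 R2].
  repeat split; auto; try apply Hu.
  - exists s; auto.
  - intros N HN. eapply conv_trans; [|apply R2, HN].
    rewrite <- ex_po by (auto using init_ok; apply (cls_over _ _ _ head_type)).
    now apply po_typing; auto using init_ok.
  - exists s; split; auto. apply ht_rm_pis; auto using init_lr_wfs, wfc_nil.
Qed.

#[local] Lemma value_facts t : o = Some t ->
  (forall N, binding_count N -> conv Sg0 (hom (xm N E0) t) (rm P (nrm t))) /\
  unused_in_value P c (nrm t) /\
  ht Sg0 [] (po_value Sc m ch c t) (Some (po_type Sc m ch c A)).
Proof.
  intros Ho. destruct (ok_good _ Hok) as [_ (_ & _ & HuA & Hv)].
  destruct (Hv t Ho) as (Hc & Ht & Hu).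
  destruct (po_typing E0 min_count init_ok Hi min_count_ok) as (_ & J & _).
  destruct (J _ _ Ht) as (Hov & Ht').
  pose proof Hu as (_ & Hsat & Hb & Hp).
  destruct (removal_typing E0 (nrm t) _ init_ok Hi Hsat Hov Ht') as [R1 R2].
  destruct type_facts as (T1 & T2 & _ & _).
  repeat split; auto; try apply Hu.
  - intros N HN. eapply conv_trans; [|apply R2, HN].
    rewrite <- ex_po by (auto using init_ok; apply (ht_over _ _ _ _ (head_def _ Ho))).
    now apply po_typing; auto using init_ok.
  - rewrite ex_po in R1 by (auto using init_ok; apply (cls_over _ _ _ head_type)).
    assert (R : ht Sg0 [] (rm P (nrm t)) (Some (rm P (nrm A)))).
    { eapply ht_conv_cls; eauto. apply T2, min_count_ok. }
    (* The identity [Con] plays the role of [f] in [ht_rm_lams]. *)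
    rewrite <- (hom_Con (rm P (nrm A))) in R.
    unfold po_type; rewrite <- (hom_Con (rm_pis _ _ _ _)).
    apply ht_rm_lams; auto using init_lr_wfs, wfc_nil; try apply HuA.
    + intros x; apply closed_Con.
    + intros i Hx _; simpl; auto.
    + intros i Hx _; simpl. now apply HuA.
Qed.

#[local] Lemma step_wf : wf_theory E'.
Proof.
  destruct head_fresh as (F1 & F2 & F3 & F4 & F5 & F6).
  constructor.
  - apply (inv_wf _ Hi).
  - intros Hin; apply names_In in Hin as (B & o' & Hin).
    apply (inv_decl _ Hi) in Hin as [Hin|(c' & A' & o1 & Hown & [E1|E1])].
    + apply F3; eapply In_names; eauto.
    + injection E1 as -> _ _. apply F1. eapply In_names, own_flat; eauto.
    + apply starred_decl_facts in E1 as [E1 _]. now apply (F6 _ Hown).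
  - apply cls_classifier, type_facts.
  - intros t Ht. apply option_map_Some in Ht as (t' & Eo & <-).
    apply ht_nil_has_type. now apply value_facts.
Qed.

#[local] Notation Sg1 := (flat E').

#[local] Lemma step_wfs : wfs Sg1.
Proof. apply wf_theory_wfs, step_wf. Qed.

#[local] Lemma init_lr_incl : incl Sg0 Sg1.
Proof. simpl; auto with datatypes. Qed.

#[local] Lemma init_incl : incl (flat E0) (flat E).
Proof. simpl; auto with datatypes. Qed.

#[local] Lemma step_mor N : binding_count N -> mor_ok (flat E) Sg1 (xm N E).
Proof.
  intros HN. destruct head_fresh as (_ & F2 & _).
  destruct type_facts as (T1 & T2 & (_ & _ & Hb & Hp) & T4).
  pose proof (wfs_closed_def _ step_wfs) as Hd.
  assert (HA : forall t, over (in_sig (flat E0)) t -> hom (xm N E) t = hom (xm N E0) t).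
  { intros; apply hom_xm_incl; auto using init_wfs, ext_wfs, init_incl. }
  destruct (HN c (nrm A) Hb) as [Hn1 Hn2].
  intros c1 A1 o1 [E1|Hin].
  - injection E1 as <- <- <-.
    rewrite (HA A) by apply (cls_over _ _ _ head_type).
    rewrite (xm_eq N E c A o ext_wfs F2) by (simpl; auto). split.
    + apply ht_conv_cls with (rm P (nrm A)).
      * destruct T1 as (s & Hsort & T1).
        apply ht_expandn with s; auto using step_wfs, wfc_nil.
        -- eapply ht_mono; [apply init_lr_incl|exact T1].
        -- intros i Hx _; simpl; auto.
        -- intros i Hx _; simpl; auto.
        -- econstructor. simpl; left; reflexivity.
      * apply conv_sym; eapply conv_mono; [apply init_lr_incl|]; now apply T2.
      * eapply cls_mono; [apply init_lr_incl|].
        apply (cls_hom_nil (flat E0)); auto using init_lr_wfs, head_type.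
        -- now apply xm_closed.
        -- now apply (inv_mor _ Hi).
    + intros t Ho. rewrite (HA t) by apply (ht_over _ _ _ _ (head_def _ Ho)).
      destruct (value_facts t Ho) as (V1 & (_ & _ & Hbt & Hpt) & _).
      eapply conv_trans; [|apply conv_sym; eapply conv_mono; [apply init_lr_incl|now apply V1]].
      apply expandn_rm_lams; auto.
      * intros i Hx _; simpl; auto.
      * intros i Hx _; simpl; auto.
      * rewrite Ho. eapply conv_delta. simpl; left; reflexivity.
  - destruct (inv_mor _ Hi N HN _ _ _ Hin) as [M1 M2].
    rewrite (xm_incl N E0 E) by (auto using init_wfs, ext_wfs, init_incl; exists A1, o1; auto).
    rewrite HA by (eapply cls_over, cls_In; eauto using init_wfs).
    split; [eapply ht_mono; [apply init_lr_incl|exact M1]|].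
    intros t Ho. rewrite HA by (subst; eapply ht_over, ht_In_def; eauto using init_wfs).
    eapply conv_mono; [apply init_lr_incl|]. auto.
Qed.

#[local] Lemma lrr_init x : In x (names E0) -> lrr E x = lrr E0 x.
Proof.
  destruct head_fresh as (F1 & _). intros Hx; simpl.
  destruct (Nat.eqb_spec x c); [subst; contradiction|auto].
Qed.

#[local] Lemma ind_init x : In x (names E0) -> ind E x = ind E0 x.
Proof.
  intros Hx; rewrite !ind_xm. apply xm_incl; auto using init_wfs, ext_wfs, init_incl.
  now apply in_sig_names_theory.
Qed.

#[local] Lemma rel_init t : over (in_sig (flat E0)) t ->
  rel (ind E) (lrr E) [] t = rel (ind E0) (lrr E0) [] t /\
  rel (ind E) (lrr E0) [] t = rel (ind E0) (lrr E0) [] t.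
Proof.
  intros Ht; split; eapply rel_over; try exact Ht; intros x Hx;
    apply in_sig_names_theory in Hx; auto using ind_init, lrr_init.
Qed.

#[local] Lemma init_lrel : lrel (flat E0) Sg1 (ind E0) (lrr E0).
Proof.
  eapply lrel_mono; [apply step_wfs|apply init_lr_incl|]. apply inv_lrel; auto using init_ok.
Qed.

#[local] Lemma ind_head : ht Sg1 [] (ind E c) (Some (hom (ind E0) A)) /\
  forall t, o = Some t -> conv Sg1 (ind E c) (hom (ind E0) t).
Proof.
  rewrite !ind_xm.
  destruct (step_mor full_count full_count_ok c A o) as [M1 M2]; [simpl; auto|].
  assert (HA : forall t, over (in_sig (flat E0)) t ->
    hom (xm full_count E) t = hom (xm full_count E0) t).
  { intros; apply hom_xm_incl; auto using init_wfs, ext_wfs, init_incl. }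
  rewrite HA in M1 by apply (cls_over _ _ _ head_type). split; auto.
  intros t Ho; rewrite <- HA by apply (ht_over _ _ _ _ (head_def _ Ho)); auto.
Qed.

#[local] Lemma lr_cases :
  (lr E = E' /\ starred (ind E0) (lrr E0) A o = false) \/
  exists rA ot, rel (ind E0) (lrr E0) [] A = Some rA /\
    (o = None /\ ot = None \/
     exists t rt, o = Some t /\ rel (ind E0) (lrr E0) [] t = Some rt /\ ot = Some rt) /\
    lr E = tconst E' (star c) (at_ rA (ind E c)) ot /\
    starred (ind E0) (lrr E0) A o = true.
Proof.
  apply lr_tconst_cases.
  - now apply rel_init, (cls_over _ _ _ head_type).
  - intros t Ho. now apply rel_init, (ht_over _ _ _ _ (head_def _ Ho)).
Qed.

(** Abstraction types the definiens of [c*] at the image of [t]; the equation of [c] turns this into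
    the declared type, which is at the image of [c]. *)
#[local] Lemma wf_lr_E : wf_theory (lr E).
Proof.
  destruct head_fresh as (F1 & F2 & F3 & F4 & F5 & F6).
  destruct lr_cases as [[-> _]|(rA & ot & EA & Eo & -> & _)]; [apply step_wf|].
  destruct ind_head as [I1 I2].
  constructor; [apply step_wf| | |].
  - intros Hin; apply names_In in Hin as (B & o' & [E1|Hin]); [injection E1; auto|].
    apply (inv_decl _ Hi) in Hin as [Hin|(c' & A' & o1 & Hown & [E1|E1])].
    + apply F4; eapply In_names; eauto.
    + injection E1 as E1 _ _. destruct (F6 _ Hown) as [F7 _]. now apply F7.
    + apply starred_decl_facts in E1 as [E1 _]. apply star_inj in E1; subst.
      apply F1. eapply In_names, own_flat; eauto.
  - apply cls_classifier. eapply (rel_classifier_nil _ _ _ _ init_lrel); eauto using head_type.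
  - intros q Eq. destruct Eo as [[_ ->]|(t & rt & Eo & Ert & ->)]; [discriminate|].
    injection Eq as <-. apply ht_nil_has_type.
    assert (Ht : ht (flat E0) [] t (Some A)) by now apply head_def.
    destruct (abstraction_nil _ _ _ _ init_lrel _ _ _ Ht Ert) as (rA' & EA' & Hrt).
    rewrite EA in EA'; injection EA' as <-.
    eapply ht_conv_cls; [exact Hrt| |].
    + apply conv_at; auto with conv.
    + eapply (rel_classifier_nil _ _ _ _ init_lrel); eauto using head_type.
Qed.

#[local] Lemma part_tconst : part E0 E.
Proof.
  split.
  - apply init_wfs.
  - simpl; auto with datatypes.
  - apply lr_tconst_incl.
  - intros x Hx; apply in_sig_names_theory in Hx; split; [now apply ind_init|now apply lrr_init].
Qed.

#[local] Lemma step_incl : incl Sg1 (flat (lr E)).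
Proof.
  destruct lr_cases as [[-> _]|(rA & ot & _ & _ & -> & _)]; [apply incl_refl|].
  simpl; auto with datatypes.
Qed.

#[local] Lemma lrr_head : lrr E c = if starred (ind E0) (lrr E0) A o
  then Some (Con (star c)) else None.
Proof. simpl. now rewrite Nat.eqb_refl. Qed.

Lemma inv_tconst : inv E.
Proof.
  destruct head_fresh as (F1 & F2 & F3 & F4 & F5 & F6).
  pose proof part_tconst as Hp.
  assert (HoA : over (in_sig (flat E0)) A) by apply (cls_over _ _ _ head_type).
  assert (Hot : forall t, o = Some t -> over (in_sig (flat E0)) t)
    by (intros t Ho; apply (ht_over _ _ _ _ (head_def _ Ho))).
  assert (HrA := part_rel _ _ A Hp HoA).
  assert (Hrt : forall t, o = Some t ->
    rel (ind E) (lrr E) [] t = rel (ind E0) (lrr E0) [] t)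
    by (intros t Ho; apply part_rel; auto).
  assert (HstE : starred (ind E) (lrr E) A o = starred (ind E0) (lrr E0) A o).
  { apply starred_over with (in_sig (flat E0)); auto. apply Hp. }
  assert (HoE : forall t, over (in_sig (flat E0)) t -> hom (ind E) t = hom (ind E0) t)
    by (intros; now apply part_hom).
  split.
  - apply wf_lr_E.
  - intros N HN; eapply mor_ok_mono; [apply step_incl|now apply step_mor].
  - intros c1 A1 o1 [E1|Hin].
    + injection E1 as <- <- <-. rewrite lrr_head, HrA.
      destruct lr_cases as [[_ Est]|(rA & ot & EA & Eo & Elr & Est)]; rewrite Est; split.
      * discriminate.
      * intros t Ho; rewrite (Hrt t Ho). unfold starred in Est; rewrite Ho in Est.
        destruct (rel (ind E0) (lrr E0) [] t) as [rt|] eqn:Et; auto.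
        (* If the definiens were related, so would be its type by abstraction, and [c] would have
           been starred. *)
        destruct (abstraction_nil _ _ _ _ init_lrel _ _ _ (head_def t Ho) Et) as (rA & EA & _).
        rewrite EA in Est; discriminate.
      * intros p Ep; injection Ep as <-. exists rA; split; auto.
        rewrite Elr. econstructor. simpl; left; reflexivity.
      * intros t Ho; rewrite (Hrt t Ho).
        destruct Eo as [[Eo _]|(t' & rt & Eo & Et & ->)]; [congruence|].
        rewrite Eo in Ho; injection Ho as <-. rewrite Et, Elr.
        eapply conv_delta. simpl; left; reflexivity.
    + exact (rel_ok_part _ _ (flat (lr E)) _ _ _ _ init_wfs (part_lr _ _ Hp) (part_eq _ _ Hp)
        (inv_rel _ Hi) _ _ _ Hin).
  - intros c1 A1 o1 [E1|Hin] HT HR.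
    + injection E1 as <- <- <-. rewrite HrA in HR. rewrite lrr_head.
      apply (type_back (flat E0)) in HT; auto using init_wfs, ext_wfs, init_incl, head_type.
      (* At a type the definiens is related as soon as the type is, so the additional condition in
         [starred] is met. *)
      rewrite starred_true; auto; [discriminate|].
      intros t Ho. apply (rel_type_defined _ _ _ _ init_lrel); auto. now apply head_def.
    + exact (tot_part _ _ _ _ _ _ init_wfs ext_wfs init_incl (part_eq _ _ Hp) (inv_tot _ Hi)
        _ _ _ Hin HT HR).
  - intros c1 A1 o1 [E1|Hin].
    + injection E1 as <- <- <-. destruct type_facts as (T1 & T2 & T3 & _).
      assert (incl Sg0 (flat (lr E))) by apply lr_tconst_incl.
      split; [apply step_incl; simpl; left; reflexivity|].
      split; [eapply cls_mono; eauto|]. split; [|split; auto].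
      * rewrite HoE by easy. rewrite ind_xm. eapply conv_mono; [eauto|].
        apply T2, full_count_ok.
      * intros t Ho. destruct (value_facts t Ho) as (V1 & V2 & _). split; auto.
        rewrite HoE by auto. rewrite ind_xm. eapply conv_mono; [eauto|].
        apply V1, full_count_ok.
    + eapply part_own_ok; eauto. now apply (inv_own _ Hi).
  - intros c1 A1 o1 [E1|Hin].
    + injection E1 as <- <- <-. now rewrite lrr_head, HstE.
    + pose proof (own_flat _ _ _ Hin) as Hf.
      rewrite (part_starred _ _ _ _ _ Hp Hf), <- (inv_lrr _ Hi _ _ _ Hin).
      apply lrr_init. eapply In_names; eauto.
  - intros x Hx1 Hx2. assert (x <> c) by (intros ->; contradiction).
    assert (In x (names E0)).
    { unfold names in Hx2; simpl in Hx2; destruct Hx2 as [Hx2|Hx2]; auto.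
      exfalso; apply H; symmetry; exact Hx2. }
    rewrite lrr_init by easy. now apply (inv_lrr_Sc _ Hi).
  - intros d Hd.
    assert (J : In d Sg0 -> lr_decl E d).
    { intros J; apply (part_lr_decl _ _ _ Hp), (inv_decl _ Hi), J. }
    assert (J1 : In d Sg1 -> lr_decl E d).
    { intros [<-|Hd1]; [|auto]. right; exists c, A, o; split; [simpl|]; auto. }
    destruct lr_cases as [[Elr _]|(rA & ot & EA & Eo & Elr & _)];
      rewrite Elr in Hd; [auto|].
    destruct Hd as [<-|Hd]; [|auto].
    right; exists c, A, o; split; [simpl; auto|]. right.
    apply starred_decl_intro; [congruence|].
    destruct Eo as [Eo|(t & rt & Eo & Et & Eot)]; [left; auto|right].
    exists t, rt; rewrite (Hrt t Eo); auto.
Qed.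
End Tconst.

(** Supplies the compatibility of includes demanded by [wf_tincl]. *)
Lemma lr_decl_unique E d d' : ok E -> lr_decl E d -> lr_decl E d' ->
  dname d = dname d' -> d = d'.
Proof.
  intros Hok Hd Hd' Hn. pose proof (ok_wfs _ Hok) as Hs.
  assert (S : forall c A o d, starred_decl E c A o d -> dname d = star c)
    by (intros; eapply starred_decl_facts; eauto).
  assert (T : forall d, In d (flat Tg) -> In (dname d) (names Tg)).
  { intros [[c A] o] J; apply In_names in J; auto. }
  destruct Hd as [H|(c & A & o & Hown & H)], Hd' as [H'|(c' & A' & o' & Hown' & H')].
  - destruct d as [[x B] q], d' as [[x' B'] q']. unfold dname in Hn; simpl in Hn; subst.
    destruct (wfs_unique _ _ _ _ _ _ Tg_wfs H H') as [-> ->]; auto.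
  - exfalso. destruct (ok_fresh _ Hok _ Hown') as (_ & F2 & F3 & _).
    apply T in H; rewrite Hn in H.
    destruct H' as [->|H']; [contradiction|]. rewrite (S _ _ _ _ H') in H; contradiction.
  - exfalso. destruct (ok_fresh _ Hok _ Hown) as (_ & F2 & F3 & _).
    apply T in H'; rewrite <- Hn in H'.
    destruct H as [->|H]; [contradiction|]. rewrite (S _ _ _ _ H) in H'; contradiction.
  - destruct (ok_fresh _ Hok _ Hown) as (_ & _ & _ & F).
    destruct (ok_fresh _ Hok _ Hown') as (_ & _ & _ & F').
    assert (U : c = c' -> A' = A /\ o' = o).
    { intros <-. exact (wfs_unique _ _ _ _ _ _ Hs (own_flat _ _ _ Hown)
        (own_flat _ _ _ Hown')). }
    destruct H as [->|H], H' as [->|H'].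
    + unfold dname in Hn; simpl in Hn. destruct (U Hn) as [-> ->]; now subst.
    + exfalso. rewrite (S _ _ _ _ H') in Hn. apply (F' _ Hown Hn).
    + exfalso. rewrite (S _ _ _ _ H) in Hn. symmetry in Hn; apply (F _ Hown' Hn).
    + rewrite (S _ _ _ _ H), (S _ _ _ _ H') in Hn. apply star_inj in Hn.
      destruct (U Hn) as [-> ->]; subst c'.
      destruct H as (rA & EA & H), H' as (rA' & EA' & H').
      rewrite EA in EA'; injection EA' as <-. destruct o as [t|]; [|congruence].
      destruct H as (rt & Et & ->), H' as (rt' & Et' & ->). congruence.
Qed.

Lemma ok_tincl E0 E1 : ok (tincl E0 E1) ->
  ok E0 /\ (E1 = Sc \/ E1 <> Sc /\ ok E1 /\ includes Sc E1).
Proof.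
  intros [Hw Ho Hf Hg]. apply includes_over_tincl in Ho as [Ho1 Ho2].
  inversion Hw; subst. destruct Hg as [Hg1 Hg2].
  assert (F : forall E', incl (own Sc E') (own Sc (tincl E0 E1)) -> fresh_own E').
  { intros E' Hi d Hd; destruct (Hf d (Hi _ Hd)) as (? & ? & ? & J). auto 6. }
  split.
  - split; auto. apply F. simpl. destruct (theory_eq_dec E1 Sc);
      [apply incl_refl|apply incl_appr, incl_refl].
  - destruct Ho2 as [->|(Hn & Hi & Ho2)]; [left; auto|right].
    split; [easy|]; split; [|easy].
    split; auto; [|now destruct Hg2].
    apply F. simpl. destruct (theory_eq_dec E1 Sc); [contradiction|].
    apply incl_appl, incl_refl.
Qed.

(** A shared declaration is processed once along each include. The outcomes coincide, being
    determined by the declaration and by the outcomes at the constants in it. *)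
Lemma lrr_agree E0 E1 : ok E0 -> ok E1 -> inv E0 -> inv E1 ->
  (forall d d', In d (flat E0) -> In d' (flat E1) -> dname d = dname d' -> d = d') ->
  forall x, In x (names E0) -> In x (names E1) -> lrr E1 x = lrr E0 x.
Proof.
  intros Hok0 Hok1 Hi0 Hi1 Hc x Hx0.
  pose proof (ok_wfs _ Hok0) as Hs0. pose proof (ok_wfs _ Hok1) as Hs1.
  apply in_sig_names_theory in Hx0. revert x Hx0.
  apply (wfs_decl_ind (flat E0) (fun x => In x (names E1) -> lrr E1 x = lrr E0 x) Hs0).
  intros c A o Hin HA Ho Hc1.
  assert (Hin1 : In (c, A, o) (flat E1)).
  { apply names_In in Hc1 as (A' & o' & Hin1). now rewrite (Hc _ _ Hin Hin1 eq_refl). }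
  destruct (in_dec Nat.eq_dec c (names Sc)) as [HS|HS].
  { rewrite !inv_lrr_Sc; auto. eapply In_names; eauto. }
  assert (Own : forall E, ok E -> In (c, A, o) (flat E) -> In (c, A, o) (own Sc E)).
  { intros E Hok J; destruct (flat_own _ _ _ (ok_over _ Hok) J) as [|[_ J']]; auto.
    exfalso; apply HS; eapply In_names; eauto. }
  rewrite (inv_lrr _ Hi0 _ _ _ (Own _ Hok0 Hin)), (inv_lrr _ Hi1 _ _ _ (Own _ Hok1 Hin1)).
  rewrite (starred_over (fun x => in_sig (flat E1) x /\ (in_sig (flat E0) x /\
    (In x (names E1) -> lrr E1 x = lrr E0 x))) (ind E0) (lrr E0)); auto.
  - intros x (Hx1 & Hx0 & Hx). split.
    + rewrite !ind_xm. destruct Hx1 as (A1 & o1 & Hx1), Hx0 as (A0 & o0 & Hx0).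
      assert (E := Hc _ _ Hx0 Hx1 eq_refl).
      apply (xm_agree full_count E1 E0 x (x, A1, o1)); auto. now rewrite <- E.
    + apply Hx. now apply in_sig_names_theory.
  - apply over_and; [eapply over_type; eauto|].
    apply over_and; [eapply over_type; eauto|auto].
  - intros t Et. apply over_and; [eapply over_def; eauto|].
    apply over_and; [eapply over_def; eauto|auto].
Qed.

(** * Preservation of the invariant by an include *)

Section Tincl.
Variables (E0 E1 : theory).
Hypotheses (Hok : ok (tincl E0 E1)) (Hi : inv E0).
#[local] Notation E := (tincl E0 E1).

#[local] Lemma tincl_consistent d d' : In d (flat E0) -> In d' (flat E1) ->
  dname d = dname d' -> d = d'.
Proof. pose proof (ok_wf _ Hok) as W; inversion W; auto. Qed.

#[local] Lemma ind_tincl E' x : wfs (flat E') -> incl (flat E') (flat E) ->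
  in_sig (flat E') x -> ind E x = ind E' x.
Proof.
  intros Hs Hinc Hx; rewrite !ind_xm. apply xm_incl; auto using ok_wfs.
Qed.

Lemma part_tincl_l : E1 = Sc \/ inv E1 -> part E0 E.
Proof.
  intros H. destruct (ok_tincl _ _ Hok) as [Hok0 H1].
  split.
  - now apply ok_wfs.
  - simpl. destruct (theory_eq_dec E1 Sc); [apply incl_refl|apply incl_appr, incl_refl].
  - simpl. apply incl_appr, incl_refl.
  - intros x Hx. split.
    + apply ind_tincl; auto; [now apply ok_wfs|]. simpl; apply incl_appr, incl_refl.
    + apply in_sig_names_theory in Hx. simpl.
      destruct (memb x (names E1)) eqn:Ex; auto. apply memb_In in Ex.
      destruct (theory_eq_dec E1 Sc) as [E1S|E1S].
      * rewrite E1S in Ex. symmetry; now apply (inv_lrr_Sc _ Hi).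
      * apply lrr_agree; auto; try tauto. apply tincl_consistent.
Qed.

Lemma part_tincl_r : E1 <> Sc -> part E1 E.
Proof.
  intros H. destruct (ok_tincl _ _ Hok) as [_ [?|(_ & Hok1 & _)]]; [easy|].
  split.
  - now apply ok_wfs.
  - simpl. destruct (theory_eq_dec E1 Sc); [easy|apply incl_appl, incl_refl].
  - simpl. destruct (theory_eq_dec E1 Sc); [easy|apply incl_appl, incl_refl].
  - intros x Hx. split.
    + apply ind_tincl; auto; [now apply ok_wfs|]. simpl; apply incl_appl, incl_refl.
    + apply in_sig_names_theory, memb_In in Hx. simpl; rewrite Hx.
      now destruct (theory_eq_dec E1 Sc).
Qed.

(** For the constants of [Sc] the invariant is supplied by the hypotheses on [m] and [r] instead of
    an induction hypothesis. *)
Lemma inv_tincl_Sc : E1 = Sc -> inv E.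
Proof.
  intros E1S. destruct (ok_tincl _ _ Hok) as [Hok0 _].
  pose proof (ok_wfs _ Hok) as HsE. pose proof (ok_wfs _ Hok0) as Hs0.
  assert (HlSc : forall x, In x (names Sc) -> lrr E x = r x).
  { intros x Hx; simpl. rewrite E1S. apply memb_In in Hx; rewrite Hx.
    destruct (theory_eq_dec Sc Sc); easy. }
  assert (Hp : part E0 E) by (apply part_tincl_l; auto).
  assert (HSceq : forall x, in_sig (flat Sc) x -> ind E x = m x /\ lrr E x = r x).
  { intros x Hx; apply in_sig_names_theory in Hx; split; auto.
    rewrite ind_xm; now apply xm_Sc. }
  assert (HTg : incl (flat Tg) (flat (lr E))).
  { apply Tg_incl; simpl; auto. }
  assert (HlrE : flat (lr E) = flat Tg ++ flat (lr E0)).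
  { simpl. rewrite E1S. now destruct (theory_eq_dec Sc Sc). }
  assert (HownE : own Sc E = own Sc E0).
  { simpl. rewrite E1S. now destruct (theory_eq_dec Sc Sc). }
  assert (HflE : flat E = flat Sc ++ flat E0) by (simpl; now rewrite E1S).
  assert (Hinc0 : incl (flat E0) (flat E)) by (rewrite HflE; apply incl_appr, incl_refl).
  assert (HincS : incl (flat Sc) (flat E)) by (rewrite HflE; apply incl_appl, incl_refl).
  assert (Hdecl : forall d, In d (flat (lr E)) -> lr_decl E d).
  { intros d Hd; rewrite HlrE in Hd; apply in_app_or in Hd as [Hd|Hd]; [left; auto|].
    apply (part_lr_decl _ _ _ Hp), (inv_decl _ Hi), Hd. }
  split.
  - simpl. rewrite E1S. destruct (theory_eq_dec Sc Sc); [|easy].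
    constructor; auto; [apply Hi|]. intros d d' Hd Hd' Hn.
    apply (lr_decl_unique E d d' Hok); [| |easy].
    + apply Hdecl. rewrite HlrE; apply in_or_app; auto.
    + left; auto.
  - intros N HN c A o Hin. rewrite HflE in Hin; apply in_app_or in Hin as [Hin|Hin].
    + apply (mor_ok_part _ _ (flat (lr E)) m (xm N E) Sc_wfs HTg); auto using m_ok.
      intros x Hx; apply xm_Sc; now apply in_sig_names_theory.
    + apply (mor_ok_part _ _ (flat (lr E)) (xm N E0) (xm N E) Hs0 (part_lr _ _ Hp)); auto.
      * intros x Hx; now apply xm_incl.
      * now apply (inv_mor _ Hi).
  - intros c A o Hin. rewrite HflE in Hin; apply in_app_or in Hin as [Hin|Hin].
    + exact (rel_ok_part _ _ (flat (lr E)) m r _ _ Sc_wfs HTg HSceq r_ok _ _ _ Hin).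
    + exact (rel_ok_part _ _ (flat (lr E)) _ _ _ _ Hs0 (part_lr _ _ Hp) (part_eq _ _ Hp)
        (inv_rel _ Hi) _ _ _ Hin).
  - intros c A o Hin HT HR. rewrite HflE in Hin; apply in_app_or in Hin as [Hin|Hin].
    + refine (tot_part _ _ m r _ _ Sc_wfs HsE HincS HSceq _ _ _ _ Hin HT HR).
      intros c1 A1 o1 Hin1 HT1. apply (tot_r _ _ _ Hin1). now apply ht_nil_has_type.
    + exact (tot_part _ _ _ _ _ _ Hs0 HsE Hinc0 (part_eq _ _ Hp) (inv_tot _ Hi)
        _ _ _ Hin HT HR).
  - intros c A o Hin. rewrite HownE in Hin.
    eapply part_own_ok; eauto. now apply (inv_own _ Hi).
  - intros c A o Hin. rewrite HownE in Hin. pose proof (own_flat _ _ _ Hin) as Hf.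
    rewrite (part_starred _ _ _ _ _ Hp Hf), <- (inv_lrr _ Hi _ _ _ Hin).
    apply (part_eq _ _ Hp). exists A, o; auto.
  - intros x Hx _. now apply HlSc.
  - exact Hdecl.
Qed.

Lemma inv_tincl : E1 <> Sc -> inv E1 -> inv E.
Proof.
  intros E1S Hi1. destruct (ok_tincl _ _ Hok) as [Hok0 [?|(_ & Hok1 & Hinc)]]; [easy|].
  pose proof (ok_wfs _ Hok) as HsE. pose proof (ok_wfs _ Hok0) as Hs0.
  pose proof (ok_wfs _ Hok1) as Hs1.
  assert (Hp : part E0 E) by (apply part_tincl_l; auto).
  assert (HlrE : flat (lr E) = flat (lr E1) ++ flat (lr E0)).
  { simpl. now destruct (theory_eq_dec E1 Sc). }
  assert (HownE : own Sc E = own Sc E1 ++ own Sc E0).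
  { simpl. now destruct (theory_eq_dec E1 Sc). }
  assert (Hinc0 : incl (flat E0) (flat E)) by (simpl; apply incl_appr, incl_refl).
  assert (Hinc1 : incl (flat E1) (flat E)) by (simpl; apply incl_appl, incl_refl).
  pose proof (part_tincl_r E1S) as Hp1.
  assert (Hdecl : forall d, In d (flat (lr E)) -> lr_decl E d).
  { intros d Hd; rewrite HlrE in Hd; apply in_app_or in Hd as [Hd|Hd].
    - apply (part_lr_decl _ _ _ Hp1), (inv_decl _ Hi1), Hd.
    - apply (part_lr_decl _ _ _ Hp), (inv_decl _ Hi), Hd. }
  split.
  - simpl. destruct (theory_eq_dec E1 Sc); [easy|].
    constructor; [apply Hi|apply Hi1|]. intros d d' Hd Hd' Hn.
    apply (lr_decl_unique E); auto; apply Hdecl; rewrite HlrE; apply in_or_app; auto.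
  - intros N HN c A o Hin. simpl in Hin; apply in_app_or in Hin as [Hin|Hin].
    + apply (mor_ok_part _ _ (flat (lr E)) (xm N E1) (xm N E) Hs1 (part_lr _ _ Hp1)); auto.
      * intros x Hx; now apply xm_incl.
      * now apply (inv_mor _ Hi1).
    + apply (mor_ok_part _ _ (flat (lr E)) (xm N E0) (xm N E) Hs0 (part_lr _ _ Hp)); auto.
      * intros x Hx; now apply xm_incl.
      * now apply (inv_mor _ Hi).
  - intros c A o Hin. simpl in Hin; apply in_app_or in Hin as [Hin|Hin].
    + exact (rel_ok_part _ _ (flat (lr E)) _ _ _ _ Hs1 (part_lr _ _ Hp1) (part_eq _ _ Hp1)
        (inv_rel _ Hi1) _ _ _ Hin).
    + exact (rel_ok_part _ _ (flat (lr E)) _ _ _ _ Hs0 (part_lr _ _ Hp) (part_eq _ _ Hp)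
        (inv_rel _ Hi) _ _ _ Hin).
  - intros c A o Hin HT HR. simpl in Hin; apply in_app_or in Hin as [Hin|Hin].
    + exact (tot_part _ _ _ _ _ _ Hs1 HsE Hinc1 (part_eq _ _ Hp1) (inv_tot _ Hi1)
        _ _ _ Hin HT HR).
    + exact (tot_part _ _ _ _ _ _ Hs0 HsE Hinc0 (part_eq _ _ Hp) (inv_tot _ Hi)
        _ _ _ Hin HT HR).
  - intros c A o Hin. rewrite HownE in Hin; apply in_app_or in Hin as [Hin|Hin].
    + apply (part_own_ok E1); auto. now apply (inv_own _ Hi1).
    + apply (part_own_ok E0); auto. now apply (inv_own _ Hi).
  - intros c A o Hin. rewrite HownE in Hin; apply in_app_or in Hin as [Hin|Hin];
      pose proof (own_flat _ _ _ Hin) as Hf.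
    + rewrite (part_starred _ _ _ _ _ Hp1 Hf), <- (inv_lrr _ Hi1 _ _ _ Hin).
      apply (part_eq _ _ Hp1). exists A, o; auto.
    + rewrite (part_starred _ _ _ _ _ Hp Hf), <- (inv_lrr _ Hi _ _ _ Hin).
      apply (part_eq _ _ Hp). exists A, o; auto.
  - intros x Hx HxE. apply in_sig_names_theory in HxE as (A & o & HxE).
    simpl in HxE; apply in_app_or in HxE as [HxE|HxE].
    + rewrite (proj2 (part_eq _ _ Hp1 x ltac:(exists A, o; auto))).
      apply (inv_lrr_Sc _ Hi1); auto. eapply In_names; eauto.
    + rewrite (proj2 (part_eq _ _ Hp x ltac:(exists A, o; auto))).
      apply (inv_lrr_Sc _ Hi); auto. eapply In_names; eauto.
  - exact Hdecl.
Qed.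
End Tincl.

Lemma inv_tnil : inv tnil.
Proof.
  split; try (intros; easy).
  constructor.
Qed.

Theorem ok_inv E : ok E -> inv E.
Proof.
  induction E; intros Hok.
  - apply inv_tnil.
  - apply inv_tconst; auto. eapply IHE, ok_tconst, Hok.
  - destruct (ok_tincl _ _ Hok) as [Hok0 [?|(Hn & Hok1 & _)]].
    + apply inv_tincl_Sc; auto.
    + apply inv_tincl; auto.
Qed.

Lemma xm_conv N N' E c : ok E -> inv E -> binding_count N -> binding_count N' ->
  in_sig (flat E) c -> conv (flat (lr E)) (xm N E c) (xm N' E c).
Proof.
  intros Hok Hi HN HN' (A & o & Hin).
  destruct (flat_own _ _ _ (ok_over _ Hok) Hin) as [J|[_ J]].
  - destruct (ok_fresh _ Hok _ J) as (HnS & _). unfold dname in HnS; simpl in HnS.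
    rewrite !(xm_eq _ E c A o (ok_wfs _ Hok) HnS Hin).
    destruct (inv_own _ Hi _ _ _ J) as (_ & _ & _ & (_ & _ & Hb & _) & _).
    destruct (HN c _ Hb) as [Hn _]. destruct (HN' c _ Hb) as [Hn' _].
    pose proof (inv_wfs _ Hi).
    apply expandn_conv; eauto; intros i Hx _; simpl; auto.
  - apply In_names in J. rewrite !xm_Sc by easy. apply conv_refl.
Qed.

(** Only kinds remain to be treated. A primitive family of [E] is always starred, and a defined one
    because the families in its definiens are related by induction. *)
Lemma lrr_total E : total (flat Sc) m r -> ok E -> inv E ->
  total (flat E) (ind E) (lrr E).
Proof.
  intros Ht Hok Hi. pose proof (ok_wfs _ Hok) as Hs.
  pose proof (inv_lrel _ Hok Hi) as L.
  assert (J : forall c, in_sig (flat E) c -> forall A o, In (c, A, o) (flat E) ->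
    rel (ind E) (lrr E) [] A <> None -> lrr E c <> None).
  2:{ intros c A o Hin. apply J with o; auto. exists A, o; auto. }
  apply (wfs_decl_ind (flat E) (fun c => forall A o, In (c, A, o) (flat E) ->
    rel (ind E) (lrr E) [] A <> None -> lrr E c <> None) Hs).
  intros c A o Hin _ Ho A' o' Hin' HA.
  destruct (wfs_unique _ _ _ _ _ _ Hs Hin Hin') as [-> ->]; clear Hin'.
  destruct (fam_kind_sort (flat E) A Hs (cls_In _ _ _ _ Hs Hin)) as [HK|[_ HT]].
  2:{ exact (inv_tot _ Hi _ _ _ Hin HT HA). }
  destruct (flat_own _ _ _ (ok_over _ Hok) Hin) as [Hown|[HSc HinS]].
  - rewrite (inv_lrr _ Hi _ _ _ Hown).
    rewrite starred_true; [discriminate|exact HA|]. intros t ->.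
    destruct (rel (ind E) (lrr E) [] A) eqn:EA; [simpl|congruence].
    (* Once all family constants are related, the base that is constantly [Base true] describes
       definedness correctly. *)
    rewrite (rel_fam_defined (ind E) (lrr E) (famc (flat E)) false
      (fun _ => Base true) t).
    + clear. induction t; simpl; auto.
    + eapply over_mono; [|apply (Ho t eq_refl)]. simpl.
      intros x Hx (A1 & o1 & Hin1 & HA1).
      specialize (Hx A1 o1 Hin1). destruct (lrr E x); auto. exfalso; apply Hx; auto.
      destruct (fam_kind_sort (flat E) A1 Hs (cls_In _ _ _ _ Hs Hin1)) as [HK1|[HK1 _]].
      * destruct (rel_kind_defined _ _ _ _ L A1 HK1) as (rA1 & ->); discriminate.
      * exfalso; eapply fam_false_ends; eauto.
    + apply (ht_def_fam _ _ _ _ L c A); auto. exists A, (Some t); split; auto.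
      eapply fam_true_ends; eauto.
  - rewrite (inv_lrr_Sc _ Hi) by (eapply In_names; eauto).
    apply (Ht _ _ _ HinS).
    rewrite (rel_over (in_sig (flat Sc)) (ind E) (lrr E) m r) in HA; auto.
    + intros x Hx; apply in_sig_names_theory in Hx; split.
      * rewrite ind_xm; now apply xm_Sc.
      * apply (inv_lrr_Sc _ Hi); auto. apply names_In in Hx as (A1 & o1 & Hx).
        eapply In_names, includes_flat; eauto.
    + eapply over_type; [apply Sc_wfs|eauto].
Qed.

(** * Functoriality *)

Record arrow (E F : theory) (f : assignment) : Prop := {
  arrow_src : ok E;
  arrow_tgt : ok F;
  arrow_tgt_incl : includes Sc F;
  arrow_mor : ext_morphism Sc E F f;
  arrow_good : good_for_morphism Sc Tg m ch E F f;
  arrow_resp : total (flat Sc) m r \/ respects_definedness Sc m r star ch E F f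
}.

Section Morphism.
Variables (E F : theory) (f : assignment).
Hypothesis Harr : arrow E F f.

#[local] Lemma okE : ok E.
Proof. apply Harr. Qed.
#[local] Lemma okF : ok F.
Proof. apply Harr. Qed.
#[local] Lemma incF : includes Sc F.
Proof. apply Harr. Qed.
#[local] Hint Resolve okE okF : core.

#[local] Notation lm := (lr_mor Sc Tg m r star ch E F f).
#[local] Notation T := (flat (lr F)).

#[local] Lemma iE : inv E.
Proof. now apply ok_inv. Qed.
#[local] Lemma iF : inv F.
Proof. now apply ok_inv. Qed.
#[local] Lemma LE : lrel (flat E) (flat (lr E)) (ind E) (lrr E).
Proof. apply inv_lrel; auto using iE. Qed.
#[local] Lemma LF : lrel (flat F) T (ind F) (lrr F).
Proof. apply inv_lrel; auto using iF. Qed.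
#[local] Lemma wT : wfs T.
Proof. apply LF. Qed.
#[local] Lemma indE_closed : closed_asg (ind E).
Proof. apply LE. Qed.
#[local] Lemma indF_closed : closed_asg (ind F).
Proof. apply LF. Qed.

(** The assignments [f] and [lr_mor f], made closed outside of their domains. *)
Definition f_on : assignment := fun c => if memb c (names E) then f c else Con c.
Definition lr_mor_on : assignment :=
  fun c => if memb c (names (lr E)) then lm c else Con c.
#[local] Notation fR := f_on.
#[local] Notation gR := lr_mor_on.

#[local] Lemma fR_eq c : in_sig (flat E) c -> fR c = f c.
Proof.
  intros H; apply in_sig_names_theory, memb_In in H. unfold f_on; now rewrite H.
Qed.

#[local] Lemma gR_eq c : in_sig (flat (lr E)) c -> gR c = lm c.
Proof.
  intros H; apply in_sig_names_theory, memb_In in H. unfold lr_mor_on; now rewrite H.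
Qed.

#[local] Lemma fR_ok : mor_ok (flat E) (flat F) fR.
Proof.
  apply (mor_ok_part (flat E) (flat F) (flat F) f); auto using ok_wfs, incl_refl.
  - apply fR_eq.
  - apply morphism_ok; [now apply ok_wfs|apply Harr].
Qed.

#[local] Lemma fR_closed : closed_asg fR.
Proof.
  intros c. destruct (memb c (names E)) eqn:Ec.
  - pose proof Ec as Ec'. apply memb_In, names_In in Ec as (A & o & Hin).
    eapply ht_closed, fR_ok, Hin.
  - unfold f_on; rewrite Ec; easy.
Qed.

#[local] Lemma fR_over c : in_sig (flat E) c -> over (in_sig (flat F)) (fR c).
Proof. intros (A & o & Hin). eapply ht_over, fR_ok, Hin. Qed.

#[local] Lemma fR_Sc c : In c (names Sc) -> fR c = Con c.
Proof.
  intros Hc; unfold f_on; destruct (memb c (names E)); auto.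
  now apply (arrow_mor _ _ _ Harr).
Qed.

#[local] Lemma lm_Tg x : In x (names Tg) -> lm x = Con x.
Proof. intros H; unfold lr_mor. apply memb_In in H; now rewrite H. Qed.

#[local] Lemma gR_Tg x : In x (names Tg) -> gR x = Con x.
Proof. intros H; unfold lr_mor_on. rewrite lm_Tg by easy. now destruct (memb _ _). Qed.

#[local] Lemma hom_gR_Tg t : over (in_sig (flat Tg)) t -> hom gR t = t.
Proof.
  apply hom_over_id. intros x Hx; now apply gR_Tg, in_sig_names_theory.
Qed.

#[local] Lemma lm_own c A o : In (c, A, o) (own Sc E) -> lm c = po_value Sc m ch c (f c).
Proof.
  intros Hown. destruct (ok_fresh _ okE _ Hown) as (_ & F2 & _ & _).
  unfold dname in F2; simpl in F2.
  unfold lr_mor. apply memb_false in F2; rewrite F2.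
  destruct (find _ _) as [d|] eqn:Ed; auto. exfalso.
  apply find_some in Ed as [Hd Ed]. apply Nat.eqb_eq in Ed.
  destruct (ok_fresh _ okE _ Hd) as (_ & _ & _ & F4).
  now apply (F4 _ Hown).
Qed.

#[local] Lemma lm_star c A o : In (c, A, o) (own Sc E) ->
  lm (star c) = match rel (ind F) (lrr F) [] (f c) with
                | Some p => p | None => Con (star c) end.
Proof.
  intros Hown. destruct (ok_fresh _ okE _ Hown) as (_ & _ & F3 & _).
  unfold dname in F3; simpl in F3.
  unfold lr_mor. apply memb_false in F3; rewrite F3.
  destruct (find _ _) as [d|] eqn:Ed.
  - apply find_some in Ed as [Hd Ed]. apply Nat.eqb_eq, star_inj in Ed.
    now rewrite <- Ed.
  - exfalso. apply (find_none _ _ Ed) in Hown. unfold dname in Hown; simpl in Hown.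
    now rewrite Nat.eqb_refl in Hown.
Qed.

#[local] Lemma own_in c A o : In (c, A, o) (own Sc E) -> in_sig (flat E) c.
Proof. intros H; exists A, o; eapply own_flat; eauto. Qed.

#[local] Lemma own_in_lr c A o : In (c, A, o) (own Sc E) -> in_sig (flat (lr E)) c.
Proof.
  intros H. destruct (inv_own _ iE _ _ _ H) as (J & _).
  eexists _, _; exact J.
Qed.

#[local] Lemma gR_own c A o : In (c, A, o) (own Sc E) ->
  gR c = rm_lams P c 0 (nrm (f c)).
Proof.
  intros H. rewrite gR_eq by (eapply own_in_lr; eauto). now rewrite (lm_own _ _ _ H).
Qed.

#[local] Lemma image_facts c A o : In (c, A, o) (own Sc E) ->
  conv T (rm P (nrm (f c))) (hom (ind F) (f c)) /\
  ht T [] (rm P (nrm (f c))) (Some (hom (ind F) (hom fR A))) /\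
  unused_in_value P c (nrm (f c)).
Proof.
  intros Hown. destruct (arrow_good _ _ _ Harr _ _ _ Hown) as (Hc & Ht & Hu).
  pose proof (own_flat _ _ _ Hown) as Hin.
  assert (Hof : over (in_sig (flat F)) (f c)).
  { rewrite <- fR_eq by (exists A, o; auto). apply fR_over; exists A, o; auto. }
  assert (EA : hom f A = hom fR A).
  { apply hom_over with (in_sig (flat E)); [intros; symmetry; now apply fR_eq|].
    eapply over_type; eauto. now apply ok_wfs. }
  assert (CA : cls (flat F) [] (hom fR A)).
  { apply (cls_hom_nil (flat E)); auto using ok_wfs, fR_closed, fR_ok.
    eapply cls_In; eauto. now apply ok_wfs. }
  rewrite EA in Ht.
  destruct (po_typing F min_count okF iF min_count_ok) as (_ & J & _).
  destruct (J _ _ Ht) as (Ho & Ht').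
  pose proof Hu as (_ & Hsat & _ & _).
  destruct (removal_typing F (nrm (f c)) _ okF iF Hsat Ho Ht') as [R1 R2].
  split; [|split; auto].
  - apply conv_sym. eapply conv_trans; [|apply R2, full_count_ok].
    rewrite ind_xm, <- ex_po by auto.
    now apply po_typing; auto using iF, full_count_ok.
  - rewrite ex_po in R1 by (auto; eapply cls_over; eauto).
    eapply ht_conv_cls; [exact R1| |].
    + rewrite ind_xm. apply hom_conv with (in_sig (flat F)); [|eapply cls_over; eauto].
      intros; apply xm_conv; auto using iF, full_count_ok, min_count_ok.
    + apply (cls_hom_nil (flat F)); auto using wT, indF_closed. apply LF.
Qed.

#[local] Lemma gR_closed : closed_asg gR.
Proof.
  intros x. destruct (memb x (names (lr E))) eqn:Ex.
  2:{ unfold lr_mor_on; rewrite Ex; easy. }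
  unfold lr_mor_on; rewrite Ex. apply memb_In, names_In in Ex as (B & q & Hin).
  destruct (inv_decl _ iE _ Hin) as [Hin'|(c & A & o & Hown & [Ed|Ed])].
  - rewrite lm_Tg by (eapply In_names; eauto). easy.
  - injection Ed as -> _ _. rewrite (lm_own _ _ _ Hown).
    destruct (image_facts _ _ _ Hown) as (_ & H & Hu).
    eapply closed_rm_lams, ht_closed, H.
  - apply starred_decl_facts in Ed as [Ed _]. unfold dname in Ed; simpl in Ed; subst x.
    rewrite (lm_star _ _ _ Hown).
    destruct (rel (ind F) (lrr F) [] (f c)) as [p|] eqn:Ep; [|easy].
    eapply closed_rel_nil; [| | |exact Ep]; try apply LF.
    rewrite <- fR_eq by (eapply own_in; eauto). apply fR_closed.
Qed.

(** The expansion in [ind E c] restores the bindings that were stripped from the image of [f c]. *)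
#[local] Lemma square c : in_sig (flat E) c ->
  conv T (hom gR (ind E c)) (hom (ind F) (fR c)).
Proof.
  intros Hc. destruct Hc as (A & o & Hin).
  pose proof (wfs_closed_def _ wT) as Hd.
  destruct (flat_own _ _ _ (ok_over _ okE) Hin) as [Hown|[_ HinS]].
  - destruct (ok_fresh _ okE _ Hown) as (HnS & _). unfold dname in HnS; simpl in HnS.
    destruct (image_facts _ _ _ Hown) as (I1 & _ & (_ & _ & Hl & Hu)).
    destruct (inv_own _ iE _ _ _ Hown) as (_ & _ & _ & (_ & _ & Hb & _) & _).
    destruct (full_count_ok c _ Hb) as [Hn1 Hn2].
    rewrite fR_eq by (eapply own_in; eauto).
    rewrite ind_xm, (xm_eq full_count E c A o (ok_wfs _ okE) HnS Hin).
    eapply conv_trans; [apply hom_expandn_conv, gR_closed|].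
    eapply conv_trans; [|exact I1]. apply expandn_rm_lams; auto.
    + intros j Hj _; simpl; auto.
    + intros j Hj _; simpl; auto.
    + simpl. rewrite (gR_own _ _ _ Hown). apply conv_refl.
  - apply In_names in HinS. rewrite fR_Sc by easy; simpl.
    rewrite !ind_xm, !xm_Sc, hom_gR_Tg by (auto; now apply m_over). apply conv_refl.
Qed.

#[local] Lemma family_defined t K : total (flat Sc) m r ->
  ht (flat F) [] t (Some K) -> fam (famc (flat F)) true K ->
  is_some (rel (ind F) (lrr F) [] t) = true.
Proof.
  intros Ht H HK. pose proof (ok_wfs _ okF) as Hs.
  pose proof (lrr_total F Ht okF iF) as HF.
  rewrite (rel_fam_defined (ind F) (lrr F) (famc (flat F)) false (fun _ => Base true) t).
  - clear. induction t; simpl; auto.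
  - apply over_mono with (in_sig (flat F)); [|eapply ht_over; eauto].
    intros x (A & o & Hin) (A1 & o1 & Hin1 & HA1). simpl.
    specialize (HF _ _ _ Hin1). destruct (lrr F x); auto. exfalso; apply HF; auto.
    destruct (fam_kind_sort (flat F) A1 Hs (cls_In _ _ _ _ Hs Hin1)) as [J|[J _]].
    + destruct (rel_kind_defined _ _ _ _ LF A1 J) as (rA & ->); discriminate.
    + exfalso; eapply fam_false_ends; eauto.
  - destruct (ht_fam _ _ _ _ Hs (wfc_nil _) H) as [[_ J]|J]; auto.
    exfalso; eapply fam_excl; eauto.
Qed.

#[local] Lemma in_star c A o p : In (c, A, o) (own Sc E) -> lrr E c = Some p ->
  p = Con (star c) /\ in_sig (flat (lr E)) (star c).
Proof.
  intros Hown Hp. pose proof Hp as Hp'. rewrite (inv_lrr _ iE _ _ _ Hown) in Hp'.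
  destruct (starred _ _ _ _); [|discriminate]. injection Hp' as <-. split; auto.
  destruct (inv_rel _ iE _ _ _ (own_flat _ _ _ Hown)) as [J _].
  destruct (J _ Hp) as (rA & _ & J'). now apply ht_over in J'.
Qed.

#[local] Definition agrees (c : name) : Prop :=
  match lrr E c, rel (ind F) (lrr F) [] (fR c) with
  | Some p, Some q => conv T (hom gR p) q
  | None, None => True
  | _, _ => False
  end.

(** Agreement is assumed just for the constants in [t], for use within the induction of
    [all_agree]. *)
#[local] Lemma agrees_natural t :
  over (fun c => agrees c /\ in_sig (flat E) c) t -> forall e,
  match rel (ind E) (lrr E) e t, rel (ind F) (lrr F) e (hom fR t) with
  | Some p, Some q => conv T (hom gR p) q
  | None, None => True
  | _, _ => False
  end.
Proof.
  pose proof (wfs_closed_def _ wT).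
  apply rel_natural; auto using indE_closed, indF_closed, fR_closed, gR_closed, lrr_closed.
  intros c [Hc Hc']; split; [now apply square|exact Hc].
Qed.

#[local] Lemma all_agree c : in_sig (flat E) c -> agrees c.
Proof.
  pose proof (ok_wfs _ okE) as HsE. pose proof (ok_wfs _ okF) as HsF.
  apply (wfs_decl_ind (flat E) agrees HsE). intros x A o Hin HA _.
  destruct (flat_own _ _ _ (ok_over _ okE) Hin) as [Hown|[_ HinS]].
  2:{ pose proof (In_names _ _ _ _ HinS) as HxS. unfold agrees.
      rewrite fR_Sc by easy; simpl.
      rewrite (inv_lrr_Sc _ iE) by (auto; eapply In_names; eauto).
      rewrite (inv_lrr_Sc _ iF)
        by (auto; eapply In_names, (includes_flat _ _ incF); eauto).
      destruct (r x) as [p|] eqn:Ep; auto.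
      destruct (r_ok _ _ _ HinS) as [J _]. destruct (J _ Ep) as (rA & _ & Hp).
      rewrite hom_gR_Tg by (eapply ht_over; eauto). apply conv_refl. }
  pose proof (own_in _ _ _ Hown) as Hx.
  destruct (fR_ok _ _ _ Hin) as [HfA _].
  assert (D : is_some (lrr E x) = is_some (rel (ind F) (lrr F) [] (fR x))).
  { destruct (fam_kind_sort (flat E) A HsE (cls_In _ _ _ _ HsE Hin)) as [HK|[HT HT']].
    - assert (HKF : fam (famc (flat F)) true (hom fR A)).
      { destruct (cls_In _ _ _ _ HsE Hin) as (s & [-> | ->] & HAs).
        - apply (ht_hom_nil _ _ fR _ _ HsF fR_closed fR_ok) in HAs.
          exact (ht_kind_fam _ _ _ HsF (wfc_nil _) HAs).
        - exfalso. apply (fam_excl _ _ HK).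
          exact (ht_type_fam _ _ _ HsE (wfc_nil _) HAs). }
      destruct (arrow_resp _ _ _ Harr) as [Ht|Hr].
      + rewrite (family_defined _ _ Ht HfA HKF).
        destruct (rel_kind_defined _ _ _ _ LE A HK) as (rA & ErA).
        pose proof (lrr_total E Ht okE iE _ _ _ Hin) as J. rewrite ErA in J.
        destruct (lrr E x); auto. exfalso; apply J; [discriminate|auto].
      + assert (Hk : is_kind (flat E) [] A).
        { destruct (cls_In _ _ _ _ HsE Hin) as (s & [-> | ->] & HAs).
          - now apply ht_nil_is_kind.
          - exfalso. apply (fam_excl _ _ HK).
            exact (ht_type_fam _ _ _ HsE (wfc_nil _) HAs). }
        specialize (Hr _ _ _ Hown Hk). rewrite <- fR_eq in Hr by easy.
        destruct (lrr E x), (rel (ind F) (lrr F) [] (fR x)); auto.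
        * destruct Hr as [_ Hr]; discriminate Hr; auto.
        * destruct Hr as [Hr _]; discriminate Hr; auto.
    (* On both sides definedness moves from the term to its type, where the induction hypothesis
       applies. *)
    - rewrite (con_defined _ _ _ _ LE x A o []) by easy.
      assert (HTF : ht (flat F) [] (hom fR A) (Some Typ)).
      { exact (ht_hom_nil _ _ fR _ _ HsF fR_closed fR_ok HT'). }
      rewrite (rel_type_defined _ _ _ _ LF _ _ HfA HTF).
      assert (J := agrees_natural A (over_and _ _ _ HA (over_type _ _ _ _ HsE Hin)) []).
      destruct (rel (ind E) _ _ _), (rel (ind F) _ _ _); easy. }
  unfold agrees. destruct (lrr E x) as [p|] eqn:Ep.
  - destruct (in_star _ _ _ _ Hown Ep) as [-> Hst].
    simpl. rewrite gR_eq, (lm_star _ _ _ Hown) by easy.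
    rewrite <- fR_eq by easy.
    destruct (rel (ind F) (lrr F) [] (fR x)); [apply conv_refl|discriminate].
  - destruct (rel (ind F) (lrr F) [] (fR x)); [discriminate|easy].
Qed.

#[local] Lemma natural t : over (in_sig (flat E)) t -> forall e,
  match rel (ind E) (lrr E) e t, rel (ind F) (lrr F) e (hom fR t) with
  | Some p, Some q => conv T (hom gR p) q
  | None, None => True
  | _, _ => False
  end.
Proof.
  intros Ho; apply agrees_natural. eapply over_mono; [|exact Ho].
  intros c Hc; split; [now apply all_agree|easy].
Qed.

#[local] Lemma square_hom t : over (in_sig (flat E)) t ->
  conv T (hom gR (hom (ind E) t)) (hom (ind F) (hom fR t)).
Proof.
  intros Ho. rewrite !hom_hom. apply hom_conv with (in_sig (flat E)); auto.
  apply square.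
Qed.

#[local] Lemma gR_star c A o p : In (c, A, o) (own Sc E) -> lrr E c = Some p ->
  p = Con (star c) /\ rel (ind F) (lrr F) [] (fR c) = Some (gR (star c)).
Proof.
  intros Hown Hp. destruct (in_star _ _ _ _ Hown Hp) as [-> Hst]. split; auto.
  pose proof (own_in _ _ _ Hown) as Hc.
  pose proof (all_agree c Hc) as H. unfold agrees in H. rewrite Hp in H.
  rewrite gR_eq, (lm_star _ _ _ Hown) by easy. rewrite <- fR_eq by easy.
  now destruct (rel (ind F) (lrr F) [] (fR c)).
Qed.

#[local] Lemma gR_value c A o t : In (c, A, o) (own Sc E) -> o = Some t ->
  unused_in_value P c (nrm t) ->
  conv T (hom gR (hom (ind E) t)) (hom gR (rm P (nrm t))) ->
  conv T (gR c) (hom gR (po_value Sc m ch c t)).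
Proof.
  intros Hown Ho Hu Ht. pose proof (own_flat _ _ _ Hown) as Hin.
  destruct (image_facts _ _ _ Hown) as (I1 & _ & (_ & _ & Hb & _)).
  destruct Hu as (_ & _ & Hbt & _).
  rewrite (gR_own _ _ _ Hown). apply rm_lams_hom_conv.
  - apply wfs_closed_def, wT.
  - apply gR_closed.
  - intros j Hj _; simpl; auto.
  - intros j Hj _; simpl; auto.
  - eapply conv_trans; [exact I1|]. eapply conv_trans; [|exact Ht].
    eapply conv_trans; [|apply conv_sym, square_hom; eapply over_def; eauto;
      now apply ok_wfs].
    rewrite <- fR_eq by (eapply own_in; eauto).
    apply (mor_ok_conv (flat F)); [apply indF_closed|apply LF|].
    now apply (fR_ok _ _ _ Hin).
Qed.

(** The last two premises will come from the part of [E] before [c], on which [mor_part] already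
    knows that [gR] preserves typing and conversion. *)
#[local] Lemma gR_type c A o : In (c, A, o) (own Sc E) ->
  unused_in_type P c (nrm A) -> cls T [] (hom gR (rm P (nrm A))) ->
  conv T (hom gR (hom (ind E) A)) (hom gR (rm P (nrm A))) ->
  ht T [] (gR c) (Some (hom gR (po_type Sc m ch c A))).
Proof.
  intros Hown Hu HA Hc. pose proof (own_flat _ _ _ Hown) as Hin.
  destruct (image_facts _ _ _ Hown) as (_ & I2 & (_ & _ & Hb & Hl)).
  destruct Hu as (_ & _ & HbA & Hp).
  rewrite (gR_own _ _ _ Hown). apply ht_rm_lams; auto using wT, wfc_nil, gR_closed.
  - intros j Hj _; simpl; auto.
  - intros j Hj _; simpl; auto.
  - eapply ht_conv_cls; [exact I2| |exact HA]. eapply conv_trans; [|exact Hc].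
    apply conv_sym, square_hom. eapply over_type; eauto. now apply ok_wfs.
Qed.

(** Abstraction in [F] types the relation of [f c]; naturality and the square identify its type with
    the image of the type of [c*]. *)
#[local] Lemma gR_star_ok c A o rA : In (c, A, o) (own Sc E) ->
  rel (ind E) (lrr E) [] A = Some rA -> starred (ind E) (lrr E) A o = true ->
  cls T [] (hom gR (at_ rA (ind E c))) ->
  ht T [] (gR (star c)) (Some (hom gR (at_ rA (ind E c)))) /\
  forall t rt, o = Some t -> rel (ind E) (lrr E) [] t = Some rt ->
    conv T (gR (star c)) (hom gR rt).
Proof.
  intros Hown EA Est Hcls. pose proof (own_flat _ _ _ Hown) as Hin.
  pose proof (ok_wfs _ okE) as HsE. pose proof (ok_wfs _ okF) as HsF.
  assert (Hl : lrr E c = Some (Con (star c))).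
  { rewrite (inv_lrr _ iE _ _ _ Hown), Est; auto. }
  destruct (gR_star _ _ _ _ Hown Hl) as [_ Ep].
  destruct (fR_ok _ _ _ Hin) as [HfA Hft].
  split.
  - destruct (abstraction_nil _ _ _ _ LF _ _ _ HfA Ep) as (q & Eq & Hp).
    pose proof (natural A (over_type _ _ _ _ HsE Hin) []) as HN. rewrite EA, Eq in HN.
    eapply ht_conv_cls; [exact Hp| |exact Hcls].
    apply conv_sym. eapply conv_trans; [apply hom_at_conv, gR_closed|].
    eapply conv_trans; [|apply conv_sym, conv_at_App]. apply conv_App; auto.
    apply square. exists A, o; auto.
  - intros t rt Ho Et.
    assert (Hot : over (in_sig (flat E)) t) by (eapply over_def; eauto).
    pose proof (natural t Hot []) as HN. rewrite Et in HN.
    assert (Hht : ht (flat F) [] (hom fR t) (Some (hom fR A))).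
    { subst o. exact (ht_hom_nil _ _ fR _ _ HsF fR_closed fR_ok (ht_In_def _ _ _ _ HsE Hin)). }
    pose proof (rel_conv_nil _ _ _ _ LF _ _ _ _ HfA Hht (conv_refl _ _) (Hft t Ho)) as HC.
    rewrite Ep in HC. destruct (rel (ind F) (lrr F) [] (hom fR t)); [|easy].
    eapply conv_trans; [exact HC|now apply conv_sym].
Qed.

(** The induction runs over the parts of [E] while [gR] stays fixed: the type of a declaration has
    an image that is a classifier because [gR] is a morphism on what precedes. *)
#[local] Lemma mor_part E' : ok E' -> part E' E -> mor_ok (flat (lr E')) T gR.
Proof.
  induction E' as [|E0 IH c A o|E0 IH0 E1 IH1]; intros Hok Hpart; [easy| |].
  - pose proof (ok_tconst _ _ _ _ Hok) as Hok0.
    pose proof (ok_inv _ Hok0) as Hi0. pose proof (ok_inv _ Hok) as Hi.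
    pose proof (ok_wfs _ Hok0) as Hs0. pose proof (ok_wfs _ Hok) as Hs.
    pose proof (part_tconst _ _ _ _ Hok) as Hp0.
    assert (Hinc0 : incl (flat E0) (flat (tconst E0 c A o)))
      by (simpl; auto with datatypes).
    pose proof (part_trans _ _ _ Hinc0 Hp0 Hpart) as Hp.
    specialize (IH Hok0 Hp).
    assert (Hown : In (c, A, o) (own Sc E)) by (apply (part_own _ _ Hpart); simpl; auto).
    destruct (type_facts _ _ _ _ Hok Hi0) as (T1 & T2 & T3 & _).
    pose proof (cls_over _ _ _ (head_type _ _ _ _ Hok)) as HoA.
    assert (Hot : forall t, o = Some t -> over (in_sig (flat E0)) t).
    { intros t Ho; apply (ht_over _ _ _ _ (head_def _ _ _ _ Hok _ Ho)). }
    assert (V : forall t, over (in_sig (flat E0)) t ->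
      hom (xm full_count E0) t = hom (ind E) t).
    { intros t Ht. rewrite <- ind_xm. symmetry; now apply part_hom. }
    assert (M1 : mor_ok (flat (tconst (lr E0) c (po_type Sc m ch c A)
      (option_map (po_value Sc m ch c) o))) T gR).
    { intros c1 A1 o1 [E1|Hin1]; [|now apply IH].
      injection E1 as <- <- <-. split.
      - apply gR_type with o; auto.
        + apply (cls_hom_nil _ _ gR _ wT gR_closed IH T1).
        + rewrite <- V by easy.
          apply (mor_ok_conv _ _ gR _ _ gR_closed IH), T2, full_count_ok.
      - intros t1 Et. apply option_map_Some in Et as (t & Ho & <-).
        destruct (value_facts _ _ _ _ Hok Hi0 t Ho) as (V1 & V2 & _).
        eapply gR_value; eauto. rewrite <- V by auto.
        apply (mor_ok_conv _ _ gR _ _ gR_closed IH), V1, full_count_ok. }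
    destruct (lr_cases _ _ _ _ Hok) as [[-> _]|(rA & ot & EA & Eo & Elr & Est)];
      [exact M1|].
    pose proof (inv_wf _ Hi) as W. rewrite Elr in *. inversion W; subst.
    intros c1 A1 o1 [E1|Hin1]; [|now apply M1].
    injection E1 as <- <- <-.
    assert (Hc : ind (tconst E0 c A o) c = ind E c).
    { symmetry; apply (part_eq _ _ Hpart). exists A, o; simpl; auto. }
    rewrite Hc in *.
    destruct (gR_star_ok c A o rA Hown) as [G1 G2].
    + rewrite (part_rel _ _ _ Hp) by easy. exact EA.
    + rewrite <- Est. apply starred_over with (in_sig (flat E0)); auto. apply Hp.
    + apply (cls_hom_nil _ _ gR _ wT gR_closed M1).
      apply classifier_cls; auto using wf_theory_wfs.
    + split; auto. intros t1 Et.
      destruct Eo as [[_ ->]|(t & rt & Eo & Ert & ->)]; [discriminate|].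
      injection Et as <-. apply G2 with t; auto.
      rewrite (part_rel _ _ _ Hp) by auto. exact Ert.
  - destruct (ok_tincl _ _ Hok) as [Hok0 H1]. pose proof (ok_inv _ Hok0) as Hi0.
    assert (Hp0 : part E0 E).
    { eapply part_trans; [| |exact Hpart]; [simpl; apply incl_appr, incl_refl|].
      apply part_tincl_l; auto. destruct H1 as [|(_ & Hok1 & _)]; auto using ok_inv. }
    intros c A o Hin. simpl in Hin. apply in_app_or in Hin as [Hin|Hin];
      [|now apply (IH0 Hok0 Hp0)].
    destruct (theory_eq_dec E1 Sc) as [|HnS].
    + pose proof (Tg_incl _ incF _ Hin) as Hin'.
      rewrite gR_Tg by (eapply In_names; eauto).
      rewrite hom_gR_Tg by (eapply over_type; eauto using Tg_wfs).
      split; [econstructor; eauto|]. intros t ->.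
      rewrite hom_gR_Tg by (eapply over_def; eauto using Tg_wfs).
      eapply conv_delta; eauto.
    + destruct H1 as [?|(_ & Hok1 & _)]; [easy|].
      apply (IH1 Hok1); auto.
      eapply part_trans; [| |exact Hpart]; [simpl; apply incl_appl, incl_refl|].
      now apply part_tincl_r.
Qed.

#[local] Lemma gR_ok : mor_ok (flat (lr E)) T gR.
Proof. apply mor_part; auto. now apply part_refl, ok_wfs. Qed.

Lemma lr_mor_morphism : ext_morphism Tg (lr E) (lr F) lm.
Proof.
  split; [|apply lm_Tg]. apply ok_morphism.
  apply (mor_ok_part (flat (lr E)) T T gR); auto using inv_wfs, iE, incl_refl, gR_ok.
  intros; symmetry; now apply gR_eq.
Qed.

#[local] Lemma hom_lm t : over (in_sig (flat (lr E))) t -> hom lm t = hom gR t.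
Proof. apply hom_over. intros; symmetry; now apply gR_eq. Qed.

#[local] Lemma hom_fR t : over (in_sig (flat E)) t -> hom f t = hom fR t.
Proof. apply hom_over. intros; symmetry; now apply fR_eq. Qed.

#[local] Lemma f_ht c A o : In (c, A, o) (flat E) ->
  ht (flat F) [] (f c) (Some (hom f A)).
Proof.
  intros Hin. rewrite hom_fR by (eapply over_type; eauto; now apply ok_wfs).
  rewrite <- fR_eq by (exists A, o; auto). now apply (fR_ok _ _ _ Hin).
Qed.

Lemma lr_mor_square :
  mor_eq (flat E) T (fun c => hom lm (ind E c)) (fun c => hom (ind F) (f c)).
Proof.
  intros [[c A] o] Hin; unfold dname; simpl.
  assert (Hc : in_sig (flat E) c) by (exists A, o; auto).
  rewrite hom_lm by (eapply ht_over, (lrel_mor _ _ _ _ LE); eauto).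
  rewrite <- fR_eq by easy. now apply square.
Qed.

Lemma lr_mor_own c A o : In (c, A, o) (own Sc E) ->
  ht T [] (lm c) (Some (hom lm (po_type Sc m ch c A))) /\
  over (in_sig T) (lm c).
Proof.
  intros Hown. destruct (inv_own _ iE _ _ _ Hown) as (J & _).
  assert (H : ht T [] (lm c) (Some (hom lm (po_type Sc m ch c A)))).
  { apply (morphism_ok _ _ _ wT (proj1 lr_mor_morphism) _ _ _ J). }
  split; auto. eapply ht_over; eauto.
Qed.

End Morphism.

(** * Includes, identities and composition *)

Lemma lr_includes E : includes Sc E -> includes Tg (lr E).
Proof.
  induction E; intros H; [easy| |].
  - simpl in H. simpl. destruct (rel _ _ _ e), o as [t|];
      try destruct (rel _ _ _ t); simpl; auto.
  - simpl in *. destruct (theory_eq_dec E2 Sc); [auto|].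
    destruct H as [H|[H|H]]; [easy|auto|auto].
Qed.

Lemma lr_includes_over E : includes_over Sc E -> includes_over Tg (lr E).
Proof.
  induction E; intros H; [easy| |].
  - simpl in H. simpl. destruct (rel _ _ _ e), o as [t|];
      try destruct (rel _ _ _ t); simpl; auto.
  - apply includes_over_tincl in H as [H1 H2]. simpl.
    destruct (theory_eq_dec E2 Sc); [auto|].
    destruct H2 as [H2|(_ & H2 & H3)]; [easy|]. auto using lr_includes.
Qed.

Lemma lr_extends E : extends Sc E -> extends Tg (lr E).
Proof. intros []; split; auto using lr_includes, lr_includes_over. Qed.

(** Where [Sc] is replaced by [Tg], the includes inside [Sc] are lost. By size, a theory [E'] that
    includes [Sc] is neither [Sc] nor one of these. *)
Lemma lr_monotone E' E : includes Sc E' -> includes_over Sc E -> includes E' E ->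
  includes (lr E') (lr E).
Proof.
  intros HS. pose proof (includes_size _ _ HS).
  induction E; intros Ho Hi; [easy| |].
  - simpl in Ho, Hi. simpl. destruct (rel _ _ _ e), o as [t|];
      try destruct (rel _ _ _ t); simpl; auto.
  - apply includes_over_tincl in Ho as [H1 H2]. simpl in *.
    destruct (theory_eq_dec E2 Sc) as [->|].
    + destruct Hi as [<-|[Hi|Hi]]; [lia| |auto].
      apply includes_size in Hi; lia.
    + destruct H2 as [|(_ & H2 & H3)]; [easy|].
      destruct Hi as [<-|[Hi|Hi]]; auto.
Qed.

(** At [c], [ind E] gives the conversion between expanded forms, from which [rm_lams_expandn_conv]
    strips the bindings. At [c*], translations of convertible expressions are convertible. *)
Lemma lr_mor_id E f : arrow E E f -> mor_eq (flat E) (flat E) f Con ->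
  mor_eq (flat (lr E)) (flat (lr E)) (lr_mor Sc Tg m r star ch E E f) Con.
Proof.
  intros Harr Hf. pose proof (okE _ _ _ Harr) as Hok. pose proof (ok_inv _ Hok) as Hi.
  pose proof (ok_wfs _ Hok) as Hs. pose proof (inv_lrel _ Hok Hi) as L.
  assert (Hfc : forall c, in_sig (flat E) c -> conv (flat E) (f c) (Con c)).
  { intros c (A & o & Hin). apply (Hf _ Hin). }
  intros d Hd.
  destruct (inv_decl _ Hi _ Hd) as [Hin|(c & A & o & Hown & [->|Hst])].
  - rewrite lm_Tg; [apply conv_refl|]. destruct d as [[x B] q]; eapply In_names; eauto.
  - unfold dname; simpl. rewrite (lm_own _ _ _ Harr _ _ _ Hown).
    pose proof (own_flat _ _ _ Hown) as Hin.
    destruct (image_facts _ _ _ Harr _ _ _ Hown) as (I1 & _ & (_ & _ & Hb & _)).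
    destruct (inv_own _ Hi _ _ _ Hown) as (_ & _ & _ & (_ & _ & HbA & _) & _).
    destruct (full_count_ok c _ HbA) as [Hn1 Hn2].
    destruct (ok_fresh _ Hok _ Hown) as (HnS & _). unfold dname in HnS; simpl in HnS.
    apply rm_lams_expandn_conv with (n := full_count c (nrm A)) (A := nrm A); auto.
    + apply wfs_closed_def, L.
    + intros j Hj _; simpl; auto.
    + intros j Hj _; simpl; auto.
    + rewrite <- (xm_eq full_count E c A o Hs HnS Hin), <- ind_xm.
      eapply conv_trans; [exact I1|].
      apply (mor_ok_conv (flat E) _ (ind E) (f c) (Con c)); [apply L|apply L|].
      apply Hfc. exists A, o; auto.
  - destruct (starred_decl_facts _ _ _ _ _ Hst) as [-> Hst'].
    pose proof (own_flat _ _ _ Hown) as Hin.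
    assert (Hl : lrr E c = Some (Con (star c)))
      by (rewrite (inv_lrr _ Hi _ _ _ Hown), Hst'; auto).
    rewrite (lm_star _ _ _ Harr _ _ _ Hown).
    assert (HC : match rel (ind E) (lrr E) [] (f c), rel (ind E) (lrr E) [] (Con c) with
      | Some p, Some q => conv (flat (lr E)) p q
      | None, None => True
      | _, _ => False
      end).
    { apply (rel_conv_nil _ _ _ _ L _ _ (hom f A) A).
      - eapply f_ht; eauto.
      - econstructor; eauto.
      - apply hom_conv_id with (in_sig (flat E)); auto. eapply over_type; eauto.
      - apply Hfc. exists A, o; auto. }
    simpl in HC. rewrite Hl in HC.
    now destruct (rel (ind E) (lrr E) [] (f c)).
Qed.

(** At [c*], naturality along [g] is applied to the expression [f c]. As [h c] is merely convertible
    to the image of [f c] under [g], invariance of the translation under conversion closes the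
    gap. *)
Lemma lr_mor_comp E F G f g h :
  arrow E F f -> arrow F G g -> arrow E G h ->
  mor_eq (flat E) (flat G) h (fun c => hom g (f c)) ->
  mor_eq (flat (lr E)) (flat (lr G)) (lr_mor Sc Tg m r star ch E G h)
    (fun c => hom (lr_mor Sc Tg m r star ch F G g) (lr_mor Sc Tg m r star ch E F f c)).
Proof.
  intros Hf Hg Hh Heq.
  pose proof (okE _ _ _ Hf) as HokE. pose proof (okE _ _ _ Hg) as HokF.
  pose proof (okF _ _ _ Hg) as HokG.
  pose proof (ok_wfs _ HokE) as HsE. pose proof (ok_wfs _ HokF) as HsF.
  pose proof (ok_wfs _ HokG) as HsG.
  pose proof (iE _ _ _ Hf) as Hi. pose proof (LF _ _ _ Hg) as LG.
  intros d Hd.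
  destruct (inv_decl _ Hi _ Hd) as [Hin|(c & A & o & Hown & [->|Hst])].
  - destruct d as [[x B] q]. unfold dname; simpl. apply In_names in Hin.
    rewrite !lm_Tg by easy. simpl. rewrite lm_Tg by easy. apply conv_refl.
  - unfold dname; simpl. pose proof (own_flat _ _ _ Hown) as Hin.
    assert (Hof : over (in_sig (flat F)) (f c)) by (eapply ht_over, f_ht; eauto).
    rewrite (hom_lm F G g) by (eapply lr_mor_own; eauto).
    rewrite (lm_own _ _ _ Hh _ _ _ Hown), (lm_own _ _ _ Hf _ _ _ Hown).
    destruct (image_facts _ _ _ Hf _ _ _ Hown) as (I1 & _ & (_ & _ & Hb & _)).
    destruct (image_facts _ _ _ Hh _ _ _ Hown) as (J1 & _ & (_ & _ & Hb' & _)).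
    pose proof (gR_closed _ _ _ Hg) as Hgc.
    apply rm_lams_hom_conv; auto.
    + apply wfs_closed_def, LG.
    + intros j Hj _; simpl; auto.
    + intros j Hj _; simpl; auto.
    + eapply conv_trans; [exact J1|].
      apply conv_trans with (hom (ind G) (hom g (f c))).
      { apply (mor_ok_conv (flat G)); [apply LG|apply LG|apply (Heq _ Hin)]. }
      rewrite (hom_fR F g) by easy.
      eapply conv_trans; [apply conv_sym, square_hom; eauto|].
      apply conv_sym, (mor_ok_conv _ _ _ _ _ Hgc (gR_ok _ _ _ Hg)), I1.
  - destruct (starred_decl_facts _ _ _ _ _ Hst) as [-> Hst'].
    pose proof (own_flat _ _ _ Hown) as Hin.
    assert (Hc : in_sig (flat E) c) by (exists A, o; auto).
    assert (Hl : lrr E c = Some (Con (star c)))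
      by (rewrite (inv_lrr _ Hi _ _ _ Hown), Hst'; auto).
    destruct (gR_star _ _ _ Hf _ _ _ _ Hown Hl) as [_ Ef].
    destruct (gR_star _ _ _ Hh _ _ _ _ Hown Hl) as [_ Eh].
    destruct (in_star _ _ _ Hf _ _ _ _ Hown Hl) as [_ Hsc].
    rewrite <- (gR_eq E F f), <- (gR_eq E G h) by easy.
    rewrite (fR_eq E) in Ef, Eh by easy.
    pose proof (f_ht _ _ _ Hf _ _ _ Hin) as HtF.
    destruct (abstraction_nil _ _ _ _ (LF _ _ _ Hf) _ _ _ HtF Ef) as (rA & _ & Hp).
    rewrite (hom_lm F G g) by (eapply ht_over; exact Hp).
    pose proof (natural _ _ _ Hg (f c) (ht_over _ _ _ _ HtF) []) as HN.
    rewrite <- (hom_fR F g), Ef in HN by (eapply ht_over; exact HtF).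
    assert (HC : match rel (ind G) (lrr G) [] (h c), rel (ind G) (lrr G) [] (hom g (f c)) with
      | Some p, Some q => conv (flat (lr G)) p q
      | None, None => True
      | _, _ => False
      end).
    { apply (rel_conv_nil _ _ _ _ LG _ _ (hom h A) (hom g (hom f A))).
      - eapply f_ht; eauto.
      - rewrite !(hom_fR F g).
        + exact (ht_hom_nil _ _ _ _ _ HsG (fR_closed _ _ _ Hg) (fR_ok _ _ _ Hg) HtF).
        + eapply cls_over, ht_valid; eauto using wfc_nil.
        + eapply ht_over; eauto.
      - rewrite hom_hom. apply hom_conv with (in_sig (flat E)).
        + intros x (B & q & Hx). apply (Heq _ Hx).
        + eapply over_type; eauto.
      - apply (Heq _ Hin). }
    rewrite Eh in HC. destruct (rel (ind G) (lrr G) [] (hom g (f c))); [|easy].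
    eapply conv_trans; [exact HC|now apply conv_sym].
Qed.
End LR.

Theorem theorem3
  (Sc Tg : theory) (m : assignment) (r : relation)
  (star : name -> name) (D : diagram) (ch : choice)
  (wf_Sc : wf_theory Sc) (wf_Tg : wf_theory Tg)
  (mor_m : morphism (flat Sc) (flat Tg) m)
  (rel_r : log_rel (flat Sc) (flat Tg) m r)
  (tot_r : term_total (flat Sc) m r)
  (wf_D : wf_diagram Sc D)
  (fresh : fresh_names Sc Tg star D)
  (good : good_choice Sc Tg m D ch)
  (resp : forall E F f, mors D E F f ->
     total (flat Sc) m r \/ respects_definedness Sc m r star ch E F f) :
  natural_functor Sc Tg m D
    (lr_thy Sc Tg m r star ch)
    (lr_mor Sc Tg m r star ch)
    (ind_mor Sc m ch) /\
  (forall E, thys D E ->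
     log_rel (flat E) (flat (lr_thy Sc Tg m r star ch E))
       (ind_mor Sc m ch E) (lr_rel Sc m r star ch E) /\
     term_total (flat E) (ind_mor Sc m ch E) (lr_rel Sc m r star ch E) /\
     (total (flat Sc) m r ->
      total (flat E) (ind_mor Sc m ch E) (lr_rel Sc m r star ch E))).
Proof.
  destruct fresh as [star_inj fresh_D]. destruct good as (Tg_kept & good_E & good_f).
  destruct wf_D as [wf_E wf_f].
  assert (OK : forall E, thys D E -> ok Sc Tg m star ch E).
  { intros E HE. destruct (wf_E E HE) as (W & _ & Ho).
    split; auto. exact (fresh_D E HE). }
  assert (ARR : forall E F f, mors D E F f -> arrow Sc Tg m r star ch E F f).
  { intros E F f Hf. destruct (wf_f _ _ _ Hf) as (HE & HF & Hm).
    split; eauto; try (now apply wf_E). }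
  assert (INV : forall E, thys D E -> inv Sc Tg m r star ch E).
  { intros E HE. apply ok_inv; auto. }
  assert (LREL : forall E, thys D E -> lrel (flat E)
    (flat (lr_thy Sc Tg m r star ch E)) (ind_mor Sc m ch E) (lr_rel Sc m r star ch E)).
  { intros E HE. apply inv_lrel; auto. }
  split; [split|].
  - intros E HE. destruct (INV _ HE). split; auto.
    apply lr_extends. now apply (wf_E E).
  - intros E F f Hf. apply lr_mor_morphism; auto.
  - intros E f Hf. apply lr_mor_id; auto.
  - intros E F G f g h Hf Hg Hh. apply lr_mor_comp; auto.
  - intros E HE. split; [apply ok_morphism, LREL, HE|].
    intros c Hc. rewrite ind_xm. now apply xm_Sc.
  - intros E F f Hf. apply lr_mor_square; auto.
  - intros E E' HE HE' Hi. split.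
    + apply lr_monotone; auto; [now apply (wf_E E')|now apply (wf_E E)].
    + intros c Hc. rewrite !ind_xm. apply xm_incl.
      * now apply wf_theory_wfs, wf_E.
      * now apply wf_theory_wfs, wf_E.
      * now apply includes_flat.
      * now apply names_In in Hc.
  - intros E HE. destruct (LREL _ HE) as [Hs _ _ _ _ Hrel _]. split; [|split].
    + intros c A o Hin. destruct (Hrel _ _ _ Hin) as [H1 H2]. split; auto.
      intros p Hp. destruct (H1 p Hp) as (rA & ? & ?). eauto using ht_nil_has_type.
    + intros c A o Hin HA. apply (inv_tot _ _ _ _ _ _ _ (INV _ HE) c A o Hin).
      now apply has_type_ht.
    + intros Ht. apply (lrr_total Sc Tg); auto.
Qed.
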